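(* For every $\varepsilon>0$, as $n\to\infty$ through positive integers, $$r_{6,(1,1,1,1)}(n)=\frac{1}{16}\sigma(2n+1)+O\left(n^{\frac{15}{16}+\varepsilon}\right),$$ where the implied constant depends only on $\varepsilon$.
   Context: $p_6(\ell):=2\ell^2-\ell$ is the $\ell$-th hexagonal number, and $r_{6,(1,1,1,1)}(n):=\#\{\boldsymbol{\ell}\in\mathbb{N}_0^4:\ p_6(\ell_1)+p_6(\ell_2)+p_6(\ell_3)+p_6(\ell_4)=n\}$, where $\mathbb{N}_0=\{0,1,2,\dots\}$. The sum of divisors function is $\sigma(n):=\sum_{d\mid n}d$ (over positive divisors). *)

(* Defs.v *)
From mathcomp Require Import all_boot all_order all_algebra finmap.
From mathcomp Require Import all_classical all_reals all_analysis.

Set Implicit Arguments.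
Unset Strict Implicit.
Unset Printing Implicit Defensive.

Local Open Scope classical_set_scope.

(* The truncated subtraction is harmless since l <= 2 * l ^ 2. *)
Definition p6 (l : nat) : nat := 2 * l ^ 2 - l.

Definition r6_set (n : nat) : set (4.-tuple nat) :=
  [set l | \sum_(i < 4) p6 (tnth l i) = n].

Lemma p6_ge (l : nat) : l <= p6 l.
Proof.
by case: l => // l; rewrite /p6 leq_subRL ?addnn -?mul2n expnS expn1
  ?leq_mul2l ?leq_pmulr // mulnCA leq_pmulr.
Qed.

(* [fset_set] sends an infinite set to the empty one; this lemma shows that
   [r6] below is the genuine number of representations. *)
Lemma finite_r6_set (n : nat) : finite_set (r6_set n).
Proof.
pose f (t : 4.-tuple 'I_n.+1) : 4.-tuple nat := [tuple of map val t].
apply: (@sub_finite_set _ _ (range f)); last first.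
  exact/finite_image/finite_finset.
move=> l /= eln; exists [tuple of map inord l] => //.
have le_n i : tnth l i <= n.
  by apply: leq_trans (p6_ge _) _; rewrite -eln (bigD1 i) //= leq_addr.
by apply: eq_from_tnth => i; rewrite !tnth_map /= inordK ?ltnS.
Qed.

Definition r6 (n : nat) : nat := #|` fset_set (r6_set n)|.

Definition sigma (n : nat) : nat := \sum_(d <- divisors n) d.

(* Main.v *)
Require Import Defs.
From HB Require Import structures.
From mathcomp Require Import all_boot all_order all_algebra cyclic finfield finmap.
From mathcomp Require Import zify ring lra.
Import Order.TTheory GRing.Theory Num.Theory.
Local Open Scope ring_scope.

Set Implicit Arguments.
Unset Strict Implicit.
Unset Printing Implicit Defensive.

(** Put e(x) = exp(2 i pi x), tri(k) = k(k+1)/2, and Theta(x) = sum_k e(x tri(k)),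
    E(x) = sum_k (-1)^k e(x tri(k)).  Since p6(l) = tri(2l - 1), the hexagonal
    numbers are the triangular numbers of odd index, together with 0, so up to
    solutions with a zero coordinate, which are few, 16 r6(n) is the n-th
    coefficient of (Theta - E)^4.  The coefficient of Theta^4 is sigma(2n + 1);
    this follows from Dirichlet's involution on the solutions of dk + el = 2M
    and Jacobi's two squares theorem.  Every other term contains a factor E, whose
    complete Gauss sum vanishes at frequency zero, so it contributes no main term.
    It is bounded by Kloosterman's circle method: Poisson summation on the arc around a / q turns
    the summation over a into Kloosterman sums, incomplete because of the Farey
    dissection, and Kloosterman's fourth moment bounds these by q^(3/4 + eps);
    the Kusmin-Landau inequality sums over the dual frequencies.  The outcome is
    O(T^(7/4 + eps)) with T of order n^(1/2), better than the stated exponent. *)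

(** * Kloosterman sums *)

(** Why the numerators help: if a / q has a right neighbour of denominator x in the dissection, then
    a x = -1 modulo q. For a fixed q and a fixed distance from the centre of the arc, the admissible
    x form an interval, and a runs over the negated inverses of its members; this is the incomplete
    Kloosterman sum. The exponent 3/4 arises because the fourth moment has size q^4 up to divisor
    functions, while each value recurs along an orbit of about q pairs. The circle is a finite grid
    j / P, with P so divisible that every Farey endpoint is a grid point; the dissection is then an
    exact identity between finite sums. Fourth roots are replaced by an arithmetic-geometric mean
    with a free parameter [lam], which keeps the bound linear in the fourth power and so summable
    against gcd(8n + 4, q). The accounting: up to logarithms, divisor functions and that gcd, the
    denominator q contributes T q^(-1/4); the sum over q <= 4T is T^(7/4), of order n^(7/8). The
    exponent 15/16 leaves a margin n^(1/16) that absorbs all divisor functions and logarithms. *)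

Section CharacterSums.
Context (C : numClosedFieldType) (A : finComUnitRingType) (psi : A -> C).
Hypothesis psiD : forall x y, psi (x + y) = psi x * psi y.
Hypothesis norm_psi : forall x, `|psi x| = 1.
Hypothesis psi_orth : forall a, \sum_x psi (a * x) = (#|A| * (a == 0%R))%:R.

Lemma psi_neq0 x : psi x != 0.
Proof. by rewrite -normr_eq0 norm_psi oner_eq0. Qed.

Lemma psi0 : psi 0 = 1.
Proof. by apply: (mulfI (psi_neq0 0)); rewrite -psiD addr0 mulr1. Qed.

Lemma psiN x : psi (- x) = (psi x)^*.
Proof.
apply: (mulfI (psi_neq0 x)).
by rewrite -psiD subrr psi0 -normCK norm_psi expr1n.
Qed.

(** Once the square is expanded, orthogonality in [m] and in [n] detects equal [u] and equal [v]: an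
    analytic moment becomes a counting problem. *)
Lemma parseval_le (P : finType) (c : P -> C) (u v : P -> A) :
  (forall p, `|c p| <= 1) ->
  \sum_m \sum_n `|\sum_p c p * psi (m * u p + n * v p)| ^+ 2 <=
  (#|A| ^ 2 * \sum_(p | c p != 0%R) \sum_(r | c r != 0%R)
     ((u p == u r) && (v p == v r)))%:R.
Proof.
move=> c1.
have E m n : `|\sum_p c p * psi (m * u p + n * v p)| ^+ 2 =
    \sum_p \sum_r c p * (c r)^* * (psi ((u p - u r) * m) * psi ((v p - v r) * n)).
  rewrite normCK rmorph_sum /= big_distrlr /=.
  apply: eq_bigr => p _; apply: eq_bigr => r _.
  rewrite rmorphM /= -psiN mulrACA; congr (_ * _).
  by rewrite -!psiD; congr psi; ring.
rewrite -[leLHS]ger0_norm; last first.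
  by apply: sumr_ge0 => m _; apply: sumr_ge0 => n _; apply: exprn_ge0.
rewrite (_ : \sum_m _ = \sum_p \sum_r c p * (c r)^* *
   ((#|A| ^ 2 * ((u p == u r) && (v p == v r)))%:R)); last first.
  under eq_bigr => m _ do under eq_bigr => n _ do rewrite E.
  under eq_bigr => m _ do rewrite exchange_big /=.
  rewrite exchange_big /=; apply: eq_bigr => p _.
  under eq_bigr => m _ do rewrite exchange_big /=.
  rewrite exchange_big /=; apply: eq_bigr => r _.
  under eq_bigr => m _ do rewrite -mulr_sumr -mulr_sumr.
  rewrite -mulr_sumr -mulr_suml !psi_orth !subr_eq0; congr (_ * _).
  by rewrite -natrM mulnACA mulnb.
rewrite natrM natr_sum mulr_sumr; apply: le_trans (ler_norm_sum _ _ _) _.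
rewrite [leRHS]big_mkcond /=; apply: ler_sum => p _; case: (c p =P 0) => [->|_] /=.
  by rewrite big1 ?normr0 // => r _; rewrite !mul0r.
rewrite natr_sum mulr_sumr [leRHS]big_mkcond /=.
apply: le_trans (ler_norm_sum _ _ _) _; apply: ler_sum => r _.
case: (c r =P 0) => [->|_] /=; first by rewrite conjC0 mulr0 mul0r normr0.
rewrite normrM [X in _ * X]ger0_norm // -natrM ler_piMl //.
by rewrite normrM norm_conjC mulr_ile1.
Qed.

(* The curves a + b = s and 1/a + 1/b = t meet in a point and its mirror image
   unless s is a zero divisor: eliminating the fourth unknown leaves a product. *)
Lemma kloosterman_quadruple (a b c d : A) :
  a \is a GRing.unit -> b \is a GRing.unit -> c \is a GRing.unit ->
  d \is a GRing.unit -> a + b = c + d -> a^-1 + b^-1 = c^-1 + d^-1 ->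
  (c - a) * (c - b) * (2 * c - (c - a) - (c - b)) = 0.
Proof.
move=> ua ub uc ud e1 e2.
have invD (x y : A) : x \is a GRing.unit -> y \is a GRing.unit ->
    x + y = (x^-1 + y^-1) * (x * y).
  by move=> ux uy; rewrite mulrDl (mulKr ux) (mulrC x) (mulKr uy) addrC.
have e3 : (a + b) * (c * d) = (a + b) * (a * b).
  by rewrite [in RHS]e1 (invD c d) // -e2 [in LHS](invD a b) //; ring.
have ed : d = a + b - c by rewrite e1 addrC addKr.
rewrite ed in e3.
have : (a + b) * (c * (a + b - c)) - (a + b) * (a * b) = 0 by rewrite e3 subrr.
move=> e4; rewrite -[RHS]oppr0 -e4; ring.
Qed.

(** The weight [eps] will carry the normalised Gauss sums, which depend on [a] only up to squares of
    units. *)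
Definition klo (eps : A -> C) (m n : A) : C :=
  \sum_(a | a \is a GRing.unit) eps a * psi (m * a + n * a^-1).

(** The square of a Kloosterman sum is a sum over pairs (a, b), so the moment counts quadruples with
    equal sums and equal sums of inverses. In a ring with zero divisors these need not be diagonal;
    they are controlled by the triples of product zero. *)
Lemma klo_moment (eps : A -> C) : (forall a, `|eps a| <= 1) ->
  (forall y : A, leq #|[pred x : A | 2 * x == y]| 2) ->
  \sum_m \sum_n `|klo eps m n| ^+ 4 <=
  (2 * #|A| ^ 2 * \sum_a \sum_b \sum_(x : A) ((a * b * x)%R == 0%R))%:R.
Proof.
move=> eps1 two2.
pose P := (A * A)%type.
pose c (p : P) := ((p.1 \is a GRing.unit) && (p.2 \is a GRing.unit))%:R
  * (eps p.1 * eps p.2).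
pose u (p : P) := p.1 + p.2; pose v (p : P) := p.1^-1 + p.2^-1.
have E m n : `|klo eps m n| ^+ 4 =
    `|\sum_p c p * psi (m * u p + n * v p)| ^+ 2.
  rewrite -[4%N]/(2 * 2)%N exprM -normrX; congr (`|_| ^+ 2).
  rewrite /klo expr2 big_distrlr /= pair_big /= big_mkcond /=.
  apply: eq_bigr => -[a b] _; rewrite /c /u /v /=.
  case: ifP => _; last by rewrite !mul0r.
  by rewrite mul1r mulrACA -psiD; congr (_ * psi _); ring.
rewrite (eq_bigr _ (fun m _ => eq_bigr _ (fun n _ => E m n))).
have c1 p : `|c p| <= 1.
  rewrite /c normrM mulr_ile1 //; last by rewrite normrM mulr_ile1.
  by rewrite normr_nat; case: (_ && _).
apply: le_trans (parseval_le _ _ c1) _; rewrite ler_nat (mulnC 2%N) -mulnA leq_mul2l; apply/orP; right.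
have cu p : c p != 0 -> (p.1 \is a GRing.unit) && (p.2 \is a GRing.unit).
  by rewrite /c; case: (_ && _) => //; rewrite mul0r eqxx.
(* The quadruple (a, b, c, d) is encoded by c - a, c - b and c, the quantities in
   [kloosterman_quadruple]; then d follows from a + b = c + d. *)
pose f (pr : P * P) := (pr.2.1 - pr.1.1, (pr.2.1 - pr.1.2, pr.2.1)).
pose D := [pred pr : P * P | [&& c pr.1 != 0, c pr.2 != 0,
             u pr.1 == u pr.2 & v pr.1 == v pr.2]].
have -> : (\sum_(p | c p != 0%R) \sum_(r | c r != 0%R)
     ((u p == u r) && (v p == v r)))%N = (\sum_(pr | D pr) 1)%N.
  rewrite pair_big /= big_mkcond [RHS]big_mkcond /=; apply: eq_bigr => -[p r] _ /=.
  by rewrite /D /=; do 4!case: (_ == _).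
rewrite sum1_card.
have injf : {in D &, injective f}.
  move=> [[a b] [x d]] [[a' b'] [x' d']] /and4P[/= _ _ /eqP e _] /and4P[/= _ _ /eqP e' _].
  rewrite /u /= in e e'; rewrite /f /= => -[h1 h2 h3].
  move: h1 h2; rewrite h3 => /addrI /oppr_inj ea /addrI /oppr_inj eb.
  congr (_, (_, _)) => //; first by congr (_, _).
  by apply: (addrI x); rewrite -e h3 -e' ea eb.
rewrite -(card_in_image injf).
apply: (@leq_trans #|[pred w : A * (A * A) |
     w.1 * w.2.1 * (2 * w.2.2 - w.1 - w.2.1) == 0]|).
  apply: subset_leq_card; apply/subsetP => w /imageP[[[a b] [x d]]].
  move=> /and4P[/= /cu /= /andP[ua ub] /cu /= /andP[uc ud] /eqP e1 /eqP e2] ->.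
  by rewrite inE /f /= (kloosterman_quadruple ua ub uc ud).
have dst (f0 : A -> nat) : (2 * \sum_a f0 a = \sum_a 2 * f0 a)%N by rewrite big_distrr.
pose F (a b x : A) := ((a * b * (2 * x - a - b))%R == 0%R : nat).
rewrite -sum1_card big_mkcond /=.
rewrite (eq_bigr (fun w : A * (A * A) => F w.1 w.2.1 w.2.2)); last first.
  by move=> w _; rewrite /F [in LHS]/(_ \in _) /=; case: eqP.
rewrite -(pair_bigA _ (fun a w => F a w.1 w.2)) /= dst.
apply: leq_sum => a _; rewrite -(pair_bigA _ (F a)) /= dst.
apply: leq_sum => b _; rewrite /F.
rewrite (partition_big (fun x : A => 2 * x - a - b) xpredT) //= dst.
apply: leq_sum => y _; rewrite (eq_bigr (fun=> (a * b * y == 0) : nat)); last by move=> x /eqP ->.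
rewrite sum_nat_const leq_mul2r; apply/orP; right.
apply: leq_trans (two2 (y + b + a)); apply: subset_leq_card; apply/subsetP => x.
by rewrite !inE => /eqP <-; rewrite !subrK.
Qed.

(* Replacing (m, n) by (m u^2, n / u^2) does not change the sum, so the fourth
   moment bounds each value by the size of its orbit. *)
Lemma klo_bound (eps : A -> C) (n0 n : A) (B : nat) :
  (forall a, `|eps a| <= 1) -> (forall a u, u \is a GRing.unit -> eps (a * u ^+ 2) = eps a) ->
  (forall y : A, leq #|[pred x : A | 2 * x == y]| 2) ->
  (forall u0 : A, u0 \is a GRing.unit ->
    leq #|[pred u : A | (u \is a GRing.unit) && (n0 * (u ^+ 2 - u0 ^+ 2) == 0)]| B) ->
  #|[pred u : A | u \is a GRing.unit]|%:R * `|klo eps n0 n| ^+ 4 <=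
  (B * (2 * #|A| ^ 2 * \sum_a \sum_b \sum_(x : A) ((a * b * x)%R == 0%R)))%:R.
Proof.
move=> e1 einv two2 hB.
have kinv u : u \is a GRing.unit -> klo eps (n0 * u ^+ 2) (n * u^-1 ^+ 2) = klo eps n0 n.
  move=> uu; have uu2 : u ^+ 2 \is a GRing.unit by rewrite unitrX.
  rewrite /klo [RHS](reindex (fun a => a * u ^+ 2)) /=; last first.
    by exists (fun x => x / u ^+ 2) => x _; rewrite ?mulrK ?divrK.
  apply: eq_big => [a|a ua]; first by rewrite unitrM uu2 andbT.
  rewrite einv // invrM //.
  by congr (_ * psi _); rewrite exprVn; ring.
rewrite natrM; apply: le_trans (ler_wpM2l (ler0n _ B) (klo_moment e1 two2)).
rewrite -sum1_card natr_sum mulr_suml mulr_sumr.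
(* Each copy of the value is charged to its pair (n0 u^2, n / u^2); when these are grouped by the
   first entry [m], at most [B] units share one [m]. *)
rewrite (eq_bigr (fun u => \sum_m (m == n0 * u ^+ 2)%:R * `|klo eps m (n * u^-1 ^+ 2)| ^+ 4)).
  rewrite exchange_big /=; apply: ler_sum => m _.
  apply: (@le_trans _ _ (\sum_(u | u \is a GRing.unit)
     (m == n0 * u ^+ 2)%:R * \sum_l `|klo eps m l| ^+ 4)).
    apply: ler_sum => u uu; apply: ler_wpM2l => //.
    by rewrite (bigD1 (n * u^-1 ^+ 2)) //= lerDl sumr_ge0 // => l _; apply: exprn_ge0.
  rewrite -mulr_suml; apply: ler_wpM2r; first by rewrite sumr_ge0 // => l _; apply: exprn_ge0.
  rewrite -natr_sum ler_nat.
  case: (pickP [pred u : A | (u \is a GRing.unit) && (m == n0 * u ^+ 2)]) => [u0|no].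
    move=> /= /andP[uu0 /eqP mE]; apply: leq_trans (hB _ uu0).
    rewrite -sum1_card big_mkcondr /=; apply: leq_sum => u _.
    by rewrite mE -subr_eq0 -mulrBr -opprB mulrN oppr_eq0; case: eqP.
  rewrite big1 // => u uu; move: (no u); rewrite /= uu /= => ->.
  by [].
move=> u uu; rewrite mul1r (bigD1 (n0 * u ^+ 2)) //= eqxx mul1r kinv //.
by rewrite big1 ?addr0 // => m /negPf ->; rewrite mul0r.
Qed.

End CharacterSums.

(** * Divisors, gcds and totients *)

Notation tau n := (size (divisors n)).

Lemma dvdn_count (d n : nat) : (0 < d)%N -> (d %| n)%N ->
  (\sum_(0 <= i < n) (d %| i) = n %/ d)%N.
Proof.
move=> d0 dn; rewrite divn_count_dvd; case: n dn => [|n] dn; first by rewrite !big_geq.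
by rewrite big_nat_recl // big_nat_recr //= dvdn0 dn addnC big_add1.
Qed.

(** A gcd is at most the sum of all common divisors, and a divisor e of q divides q / e of the
    residues, so it contributes q in total. *)
Lemma sum_gcdn_le (q : nat) : (0 < q)%N -> (\sum_(0 <= a < q) gcdn a q <= q * tau q)%N.
Proof.
move=> q0; have -> : (q * tau q = \sum_(e <- divisors q) \sum_(0 <= a < q) e * (e %| a))%N.
  rewrite big_seq (eq_bigr (fun=> q)); last first.
    move=> e; rewrite -dvdn_divisors // => eq.
    by rewrite -big_distrr /= dvdn_count ?(dvdn_gt0 q0 eq) // mulnC divnK.
  by rewrite -big_seq big_const_seq count_predT iter_addn_0.
rewrite exchange_big /=; apply: leq_sum => a _.
have h : gcdn a q \in divisors q by rewrite -dvdn_divisors // dvdn_gcdr.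
by rewrite (big_rem _ h) /= dvdn_gcdl muln1 leq_addr.
Qed.

Lemma leq_totient_dvd (d q : nat) : (0 < q)%N -> (d %| q)%N ->
  (totient d <= totient q)%N.
Proof.
move=> q0 dq; have d0 := dvdn_gt0 q0 dq.
rewrite !totientE // (perm_big [seq p <- primes q | p \in primes d]) /=; last first.
  apply: uniq_perm; rewrite ?filter_uniq ?primes_uniq // => p; rewrite mem_filter.
  apply/idP/andP => [pd|[]//]; split=> //; move: pd; rewrite !mem_primes q0 d0.
  by move=> /and3P[-> _ /dvdn_trans ->].
rewrite big_filter big_mkcond /= big_seq [leqRHS]big_seq; apply: leq_prod => p pq.
have [p_pr _ pdq] : [/\ prime p, (0 < q)%N & (p %| q)%N] by apply/and3P; rewrite -mem_primes.
have p1 : (0 < p.-1)%N by case: p p_pr {pq pdq} => [|[]].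
case: ifP => _; last by rewrite muln_gt0 p1 expn_gt0 prime_gt0.
rewrite leq_mul2l leq_exp2l ?prime_gt1 //; apply/orP; right.
by have := dvdn_leq_log p q0 dq; lia.
Qed.

(** By Gauss, q is the sum of the totients of its divisors, none of which exceeds the totient of q.
    It trades the number of units for [q] in [klo_le]. *)
Lemma leq_totient_tau (q : nat) : (0 < q)%N -> (q <= totient q * tau q)%N.
Proof.
move=> q0; rewrite -{1}(sum_totient_dvd q).
have -> : (totient q * tau q = \sum_(e <- divisors q) totient q)%N.
  by rewrite big_const_seq count_predT iter_addn_0.
rewrite -(big_mkord (fun d => d %| q)%N totient) -big_filter.
apply: (@leq_trans (\sum_(e <- divisors q) totient e)%N).
  rewrite (perm_big (divisors q)) //; apply: uniq_perm.
  - by rewrite filter_uniq ?iota_uniq.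
  - exact: divisors_uniq.
  move=> d; rewrite mem_filter -dvdn_divisors // mem_index_iota ltnS.
  by case dq: (d %| q)%N => //=; rewrite dvdn_leq.
rewrite !big_seq; apply: leq_sum => d; rewrite -dvdn_divisors // => dq.
exact: leq_totient_dvd.
Qed.

Lemma coprime_divn_gcd (n q : nat) : (0 < q)%N ->
  coprime (n %/ gcdn n q) (q %/ gcdn n q).
Proof.
move=> q0; have g0 : (0 < gcdn n q)%N by rewrite gcdn_gt0 q0 orbT.
rewrite /coprime -(eqn_pmul2r g0) muln_gcdl !divnK ?dvdn_gcdl ?dvdn_gcdr //.
by rewrite mul1n.
Qed.

Lemma gcdn_mull_le (a b q : nat) : (0 < q)%N ->
  (gcdn (a * b) q <= gcdn a q * gcdn b q)%N.
Proof.
move=> q0; have p n : (0 < gcdn n q)%N by rewrite gcdn_gt0 q0 orbT.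
rewrite dvdn_leq ?muln_gt0 ?p // muln_gcdl !muln_gcdr !dvdn_gcd dvdn_gcdl.
by rewrite dvdn_mull ?dvdn_gcdr // dvdn_mulr ?dvdn_gcdr // dvdn_mulr ?dvdn_gcdr.
Qed.

(** * Kloosterman's bound modulo q *)

Section ModQ.
Context (q : nat) (q1 : (1 < q)%N).

Let q0 : (0 < q)%N := ltnW q1.

Lemma natr_Zp_eq0 (n : nat) : (n%:R == 0 :> 'Z_q) = (q %| n)%N.
Proof. by rewrite -val_eqE /= val_Zp_nat // -/(dvdn _ _). Qed.

Lemma ltn_Zq (x : 'Z_q) : (x < q)%N.
Proof. by rewrite -[X in (_ < X)%N](Zp_cast q1) ltn_ord. Qed.

Lemma big_Zq (T : Type) (idx : T) (op : Monoid.law idx) (F : nat -> T) :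
  \big[op/idx]_(x : 'Z_q) F x = \big[op/idx]_(0 <= i < q) F i.
Proof. by rewrite -[X in \big[_/_]_(0 <= i < X) _](Zp_cast q1) big_mkord. Qed.

Lemma card_Zq : #|{: 'Z_q}| = q.
Proof. by rewrite card_ord Zp_cast. Qed.

(** Two distinct solutions differ by exactly q / 2, so they are told apart by the half of [0, q) in
    which they lie. *)
Lemma count_two (y : 'Z_q) : leq #|[pred x : 'Z_q | 2 * x == y]| 2.
Proof.
pose f (x : 'Z_q) := (2 * x < q)%N.
have inj (x x' : 'Z_q) : 2 * x == y -> 2 * x' == y -> (x < x')%N -> f x != f x'.
  move=> /eqP ex /eqP ex' lt; have hx' := ltn_Zq x'.
  have /eqP : (2 * (x' - x))%:R = 0 :> 'Z_q.
    by rewrite natrM natrB ?(ltnW lt) // !natr_Zp mulrBr ex ex' subrr.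
  rewrite natr_Zp_eq0 /f; move: lt hx'; move: (x : nat) (x' : nat) => a b lt hb.
  move=> /dvdnP[k hk]; have {hk}e : (2 * (b - a) = q)%N by case: k hk => [|[|k]]; nia.
  by have -> : (2 * a < q)%N by [lia]; apply/eqP; lia.
apply: (@leq_trans #|[set f x | x in [pred x : 'Z_q | 2 * x == y]]|); last first.
  by apply: leq_trans (max_card _) _; rewrite card_bool.
rewrite card_in_imset // => x x'; rewrite !inE => hx hx' e; apply: val_inj => /=.
by case: (ltngtP x x') => // lt; [have := inj x x' hx hx' lt | have := inj x' x hx' hx lt];
  rewrite e eqxx.
Qed.

Lemma count_ann (n : nat) : (\sum_(x : 'Z_q) ((n%:R * x)%R == 0%R) <= gcdn n q)%N.
Proof.
pose g := gcdn n q.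
have g0 : (0 < g)%N by rewrite gcdn_gt0 q0 orbT.
have qg : (q %/ g * g = q)%N by rewrite divnK ?dvdn_gcdr.
have qg0 : (0 < q %/ g)%N by rewrite divn_gt0 // dvdn_leq ?dvdn_gcdr.
apply: (@leq_trans (\sum_(x : 'Z_q) (q %/ g %| x))%N).
  apply: leq_sum => x _; case: eqP => // e.
  have : (q %| n * x)%N by rewrite -natr_Zp_eq0 natrM natr_Zp e.
  rewrite -{1}qg -{1}(divnK (dvdn_gcdl n q)) -/g mulnAC dvdn_pmul2r // Gauss_dvdr.
    by move=> ->.
  by rewrite coprime_sym; apply: coprime_divn_gcd.
rewrite (big_Zq _ (fun x => (q %/ g %| x) : nat)).
rewrite dvdn_count //; last by rewrite -{2}qg dvdn_mulr.
by rewrite -{1}qg mulKn.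
Qed.

Lemma count_mul3 :
  (\sum_(a : 'Z_q) \sum_(b : 'Z_q) \sum_(x : 'Z_q) ((a * b * x)%R == 0%R)
   <= q ^ 2 * tau q ^ 2)%N.
Proof.
apply: (@leq_trans (\sum_(a : 'Z_q) \sum_(b : 'Z_q) gcdn a q * gcdn b q)%N).
  apply: leq_sum => a _; apply: leq_sum => b _.
  apply: leq_trans (gcdn_mull_le a b q0); apply: leq_trans (count_ann (a * b)).
  by apply: leq_sum => x _; rewrite natrM !natr_Zp.
under eq_bigr => a _ do rewrite -big_distrr /=.
rewrite -big_distrl /= (big_Zq _ (fun a => gcdn a q)) -expnMn expnS expn1.
by rewrite leq_mul // sum_gcdn_le.
Qed.

(* A solution u of n0 (u^2 - u0^2) = 0 is determined by d = gcd(u - u0, q'), where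
   q' = q / gcd(n0, q), and by the quotient of u by lcm(d, q' / d), since u = u0
   mod d and u = -u0 mod q' / d. *)
Lemma count_sqr (n0 : nat) (u0 : 'Z_q) : u0 \is a GRing.unit ->
  leq #|[pred u : 'Z_q | (u \is a GRing.unit) && (n0%:R * (u ^+ 2 - u0 ^+ 2) == 0)]|
      (2 * gcdn n0 q * tau q).
Proof.
move=> uu0; set g := gcdn n0 q; pose q' := (q %/ g)%N.
have g0 : (0 < g)%N by rewrite gcdn_gt0 q0 orbT.
have qg : (q' * g = q)%N by rewrite divnK ?dvdn_gcdr.
have q'0 : (0 < q')%N by rewrite divn_gt0 // dvdn_leq ?dvdn_gcdr.
have q'q : (q' %| q)%N by rewrite -qg dvdn_mulr.
have cu0 : coprime q u0 by rewrite -unitZpE // natr_Zp.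
pose s (u : 'Z_q) := (u + (q - u0))%N; pose t (u : 'Z_q) := (u + u0)%N.
have u0q : (u0 <= q)%N := ltnW (ltn_Zq u0).
have hst (u : 'Z_q) : n0%:R * (u ^+ 2 - u0 ^+ 2) == 0 -> (q' %| s u * t u)%N.
  move=> h; have : (q %| n0 * (s u * t u))%N.
    rewrite -natr_Zp_eq0 !natrM /s /t !natrD natrB // !natr_Zp.
    have -> : q%:R = 0 :> 'Z_q by apply/eqP; rewrite natr_Zp_eq0.
    by rewrite sub0r -(eqP h); apply/eqP; ring.
  rewrite -{1}qg -(divnK (dvdn_gcdl n0 q)) -/g mulnAC dvdn_pmul2r // Gauss_dvdr //.
  by rewrite coprime_sym; apply: coprime_divn_gcd.
pose dv (u : 'Z_q) := gcdn (s u) q'.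
have dvq u : (dv u %| q')%N by rewrite dvdn_gcdr.
have dv0 u : (0 < dv u)%N := dvdn_gt0 q'0 (dvq u).
have ht (w : 'Z_q) : n0%:R * (w ^+ 2 - u0 ^+ 2) == 0 -> (q' %/ dv w %| t w)%N.
  move=> /hst; rewrite -{1}(divnK (dvq w)) -{1}(divnK (_ : dv w %| s w)%N) ?dvdn_gcdl //.
  rewrite mulnAC dvdn_pmul2r // Gauss_dvdr // coprime_sym.
  exact: coprime_divn_gcd.
pose m u := lcmn (dv u) (q' %/ dv u).
have m0 u : (0 < m u)%N.
  by rewrite lcmn_gt0 dv0 divn_gt0 // dvdn_leq.
have q'm (u : 'Z_q) : n0%:R * (u ^+ 2 - u0 ^+ 2) == 0 -> (q' <= 2 * m u)%N.
  move=> hu; have p2 : (gcdn (dv u) (q' %/ dv u) %| 2)%N.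
    set p := gcdn _ _; have pd : (p %| dv u)%N by rewrite dvdn_gcdl.
    have ps : (p %| s u)%N by rewrite (dvdn_trans pd) // dvdn_gcdl.
    have pt : (p %| t u)%N by rewrite (dvdn_trans (dvdn_gcdr _ _)) // ht.
    have pq : (p %| q)%N by rewrite (dvdn_trans pd) // (dvdn_trans (dvq u)).
    have : (p %| 2 * u0)%N.
      have e : (t u + q = s u + 2 * u0)%N by rewrite /s /t -!addnA; congr addn; rewrite mul2n -addnn addnA subnK // addnC.
      by rewrite -(dvdn_addr _ ps) -e dvdn_add.
    by rewrite Gauss_dvdl // (coprime_dvdl pq).
  rewrite -{1}(divnK (dvq u)) mulnC -muln_lcm_gcd mulnC leq_mul2r dvdn_leq ?orbT //.
pose f (u : 'Z_q) := (dv u, (u %/ m u)%N).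
set P := [pred u | _]; rewrite cardE -(size_map f).
have -> : (2 * g * tau q = size [seq (d, r) | d <- divisors q, r <- iota 0 (2 * g)])%N.
  by rewrite size_allpairs size_iota mulnC.
apply: uniq_leq_size.
  rewrite map_inj_in_uniq ?enum_uniq // => u v; rewrite !mem_enum => /andP[_ hu] /andP[_ hv].
  move=> [ed]; rewrite /m -ed; set M := lcmn _ _ => er.
  have e1 : u = v %[mod dv u].
    have hs1 : (dv u %| s u)%N by rewrite dvdn_gcdl.
    have hs2 : (dv u %| s v)%N by rewrite ed dvdn_gcdl.
    by apply/eqP; rewrite -(eqn_modDr (q - u0)) -/(s u) -/(s v) (eqP hs1) (eqP hs2).
  have e2 : u = v %[mod q' %/ dv u].
    apply/eqP; rewrite -(eqn_modDr u0) -/(t u) -/(t v).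
    by rewrite (eqP (ht u hu)) // ed (eqP (ht v hv)).
  have e3 : u = v %[mod M].
    have H (a b : nat) : (b <= a)%N -> a = b %[mod dv u] -> a = b %[mod q' %/ dv u] -> a = b %[mod M].
      by move=> le h1 h2; apply/eqP; rewrite eqn_mod_dvd // dvdn_lcm -!eqn_mod_dvd // h1 h2 !eqxx.
    by case: (leqP v u) => [|/ltnW] le; [apply: H | apply/esym/H].
  by apply: val_inj; rewrite /= (divn_eq u M) (divn_eq v M) er e3.
move=> w /mapP[u]; rewrite mem_enum => /andP[_ hu] ->; apply/allpairsP; exists (f u); split => //=.
  by rewrite -dvdn_divisors // (dvdn_trans (dvq u)).
rewrite mem_iota add0n ltn_divLR //; apply: leq_trans (ltn_Zq u) _.
by rewrite -{1}qg [X in (_ <= X)%N]mulnAC leq_mul2r q'm ?orbT.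
Qed.

Lemma card_unit_Zq : #|[pred u : 'Z_q | u \is a GRing.unit]| = totient q.
Proof.
rewrite -sum1_card totient_count_coprime -(big_Zq _ (fun d => coprime q d : nat)).
rewrite big_mkcond /=; apply: eq_bigr => u _.
by rewrite -{1}[u]natr_Zp unitZpE //; case: coprime.
Qed.

(** Kloosterman's exponent: a moment of size about q^4, divided by an orbit of about q pairs, leaves
    q^3 for the fourth power of one value. *)
Theorem klo_le (C : numClosedFieldType) (psi eps : 'Z_q -> C) (n0 : nat) (n : 'Z_q) :
  (forall x y, psi (x + y) = psi x * psi y) -> (forall x, `|psi x| = 1) ->
  (forall a, \sum_x psi (a * x) = (q * (a == 0%R))%:R) ->
  (forall a, `|eps a| <= 1) -> (forall a u, u \is a GRing.unit -> eps (a * u ^+ 2) = eps a) ->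
  `|klo psi eps n0%:R n| ^+ 4 <= (4 * gcdn n0 q * tau q ^ 4 * q ^ 3)%:R.
Proof.
move=> psiD psin psio e1 einv.
have psio' a : \sum_x psi (a * x) = (#|{: 'Z_q}| * (a == 0%R))%:R by rewrite psio card_Zq.
have := klo_bound psiD psin psio' n e1 einv count_two (@count_sqr n0).
rewrite card_unit_Zq card_Zq => le1.
have q0' : 0 < q%:R :> C by rewrite ltr0n.
rewrite -(ler_pM2l q0') -natrM.
apply: (@le_trans _ _ ((totient q * tau q)%:R * `|klo psi eps n0%:R n| ^+ 4)).
  by apply: ler_wpM2r; rewrite ?exprn_ge0 // ler_nat leq_totient_tau.
rewrite natrM mulrAC mulrC; apply: le_trans (ler_wpM2l (ler0n _ _) le1) _.
rewrite -natrM ler_nat; apply: leq_trans (_ : tau q * (2 * gcdn n0 q * tau q * (2 * q ^ 2 * (q ^ 2 * tau q ^ 2))) <= _)%N.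
  by rewrite !leq_mul2l count_mul3 !orbT.
by apply: eq_leq; ring.
Qed.

End ModQ.

(** * Farey dissection *)

Section Farey.

(* An entry (a, q, a', q') stands for the interval [a / q, a' / q'] between
   neighbours; the next level cuts at the mediant those with q + q' minimal. *)
Definition farey_step (s : nat) (e : nat * nat * nat * nat) :=
  let: (a, q, a', q') := e in
  if (q + q' == s)%N then [:: (a, q, a + a', q + q')%N; (a + a', q + q', a', q')%N] else [:: e].

Fixpoint farey (n : nat) : seq (nat * nat * nat * nat) :=
  if n is n'.+1 then flatten [seq farey_step n'.+2 e | e <- farey n'] else [:: (0, 1, 1, 1)%N].

(** Level [n] is the Farey dissection of order [n.+1]: the equation says that the two fractions are
    neighbours, the last clause that their mediant lies beyond that order. *)
Definition farey_ok (n : nat) (e : nat * nat * nat * nat) : bool :=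
  let: (a, q, a', q') := e in
  [&& (0 < q <= n.+1), (0 < q' <= n.+1), a' * q == a * q' + 1, a < q, a' <= q' & n.+1 < q + q']%N.

Lemma fareyP n e : e \in farey n -> farey_ok n e.
Proof.
elim: n e => [|n IH] e /=; first by rewrite inE => /eqP ->.
case/flattenP => s /mapP[[[[a q] a'] q'] /IH] /and5P[/andP[h1 h2] /andP[h3 h4] /eqP h5 h6 /andP[h7 h8]] -> /=.
case: eqP => h9; rewrite !inE; last first.
  move/eqP ->; rewrite /farey_ok h5 eqxx h6 h7 h1 h3 /=; lia.
case/orP=> /eqP ->; rewrite /farey_ok.
  have -> : ((a + a') * q == a * (q + q') + 1)%N by apply/eqP; nia.
  nia.
have -> : (a' * (q + q') == (a + a') * q' + 1)%N by apply/eqP; nia.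
nia.
Qed.

(** Each coprime pair (q, x) with q + x beyond the order occurs exactly once as the denominators of
    neighbours. By induction: raising the order replaces a pair of sum [n.+2] by (q, n.+2) and
    (n.+2, x). *)
Lemma farey_pairs (V : nmodType) (h : nat -> nat -> V) n :
  \sum_(e <- farey n) h e.1.1.2 e.2 =
  \sum_(1 <= q < n.+2) \sum_(1 <= x < n.+2 | coprime x q && (n.+1 < q + x)%N) h q x.
Proof.
elim: n h => [|n IH] h; first by rewrite /= big_seq1 big_nat1 big_mkcond /= big_nat1.
rewrite /= big_flatten big_map /=.
pose H q x := if (q + x == n.+2)%N then h q n.+2 + h n.+2 x else h q x.
rewrite (eq_bigr (fun e => H e.1.1.2 e.2)) => [|[[[a q] a'] q'] _]; last first.
  by rewrite /H /=; case: eqP => [<-|_]; rewrite ?big_cons big_nil /= ?addr0.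
rewrite IH; pose D q := if coprime n.+2 q then h q n.+2 else 0.
have E q : (1 <= q < n.+2)%N ->
    \sum_(1 <= x < n.+2 | coprime x q && (n.+1 < q + x)%N) H q x =
    \sum_(1 <= x < n.+2 | coprime x q && (n.+2 < q + x)%N) h q x +
    (D q + (if coprime (n.+2 - q) n.+2 then h n.+2 (n.+2 - q)%N else 0)).
  (* [x0] is the only [x] for which the interval is cut at this level. *)
  move=> /andP[q1 qn]; set x0 := (n.+2 - q)%N.
  have x0m : x0 \in index_iota 1 n.+2 by rewrite mem_index_iota /x0; lia.
  have x0q : (x0 + q = n.+2)%N by rewrite subnK // ltnW.
  have cE : coprime n.+2 q = coprime x0 q.
    by rewrite -x0q /coprime gcdnC gcdnDr gcdnC.
  have cE2 : coprime x0 n.+2 = coprime x0 q by rewrite -x0q /coprime gcdnDl.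
  rewrite [LHS]big_mkcond [in RHS]big_mkcond /= (bigD1_seq x0) ?iota_uniq //=.
  rewrite [X in _ = X + _](bigD1_seq x0) ?iota_uniq //=.
  have -> : (n.+1 < q + x0)%N by lia.
  have -> : (n.+2 < q + x0)%N = false by lia.
  rewrite andbT andbF add0r addrC; congr (_ + _).
    rewrite big_seq_cond [RHS]big_seq_cond; apply: eq_bigr => x.
    rewrite mem_index_iota => /andP[_ ne].
    rewrite /H; have -> : (q + x == n.+2)%N = false by apply/eqP => e; case/eqP: ne; rewrite /x0; lia.
    by have -> : (n.+1 < q + x)%N = (n.+2 < q + x)%N by [move/eqP: ne; rewrite /x0; lia].
  rewrite /D cE cE2 /H; have -> : (q + x0 == n.+2)%N by lia.
  by case: ifP; rewrite ?addr0.
rewrite (eq_big_nat _ _ E) !big_split /=.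
rewrite [RHS]big_nat_recr //=.
have -> : \sum_(1 <= q < n.+2) \sum_(1 <= x < n.+3 | coprime x q && (n.+2 < q + x)%N) h q x =
   \sum_(1 <= q < n.+2) (\sum_(1 <= x < n.+2 | coprime x q && (n.+2 < q + x)%N) h q x + D q).
  apply: eq_big_nat => q /andP[q1 _]; rewrite big_mkcond big_nat_recr //= -big_mkcond /=; congr (_ + _).
  by have -> : (n.+2 < q + n.+2)%N by [lia]; rewrite andbT.
rewrite big_split /= -addrA; congr (_ + (_ + _)).
rewrite [RHS]big_mkcond [RHS]big_nat_recr //=.
have -> : coprime n.+2 n.+2 = false by rewrite /coprime gcdnn.
rewrite addr0 [RHS]big_nat_rev /=; apply: eq_big_nat => q /andP[q1 qn].
have -> : (1 + n.+2 - q.+1 = n.+2 - q)%N by lia.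
have -> : (n.+2 < n.+2 + (n.+2 - q))%N by lia.
by rewrite andbT.
Qed.

(** The numerator of the fraction of denominator [q] whose right neighbour has denominator [x], that
    is -1 / x modulo q. *)
Definition alpha (q x : nat) : nat := find (fun a => q %| a * x + 1)%N (iota 0 q).

Lemma alphaP q x : (0 < q)%N -> coprime x q -> (q %| alpha q x * x + 1)%N.
Proof.
move=> q0 /eqP c; have [a aq ha] := Bezoutr x q0.
have hs : has (fun a => q %| a * x + 1)%N (iota 0 q).
  by apply/hasP; exists a; rewrite ?mem_iota // addnC -c.
have := nth_find 0%N hs; rewrite nth_iota //.
by have := hs; rewrite has_find size_iota.
Qed.

Lemma alpha_lt q x : (0 < q)%N -> coprime x q -> (alpha q x < q)%N.
Proof.
move=> q0 /eqP c; have [a aq ha] := Bezoutr x q0.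
have : has (fun a => q %| a * x + 1)%N (iota 0 q).
  by apply/hasP; exists a; rewrite ?mem_iota // addnC -c.
by rewrite has_find size_iota.
Qed.

Lemma alphaE q x a : coprime x q -> (a < q)%N -> (q %| a * x + 1)%N -> alpha q x = a.
Proof.
move=> c aq ha; have q0 : (0 < q)%N by lia.
have H b b' : (b <= b')%N -> (b' < q)%N -> (q %| b * x + 1)%N -> (q %| b' * x + 1)%N -> b = b'.
  move=> le b'q h h'; have : (q %| (b' - b) * x)%N.
    by rewrite mulnBl -(subnDr 1) dvdn_sub.
  rewrite Gauss_dvdl 1?coprime_sym // => /dvdn_leq; lia.
by case: (leqP (alpha q x) a) => [|/ltnW] le; [|apply/esym]; apply: H; rewrite ?alpha_lt ?alphaP.
Qed.

Lemma farey_pos (P b s a q : nat) : (0 < q)%N -> (0 < s)%N -> (q * s %| P)%N ->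
  (b * q = a * s + 1)%N -> (b * (P %/ s) = a * (P %/ q) + P %/ (q * s))%N.
Proof.
move=> q0 s0 /dvdnP[k ->] e.
have -> : (k * (q * s) %/ s = k * q)%N by rewrite mulnA mulnK.
have -> : (k * (q * s) %/ q = k * s)%N by rewrite mulnCA mulKn.
rewrite mulnK ?muln_gt0 ?q0 //; nia.
Qed.

(** The grid j / P stands for the circle. The divisibility below places every fraction and mediant
    of the dissection on the grid, so nothing is rounded. *)
Context (V : nmodType) (g : nat -> V) (P Q : nat).
Hypothesis dvP : forall q s, (0 < q <= Q)%N -> (q < s <= 2 * Q)%N -> (q * s %| P)%N.

Lemma farey_intervals n : (n.+1 <= Q)%N ->
  \sum_(0 <= j < P) g j = \sum_(e <- farey n)
     \sum_(e.1.1.1 * (P %/ e.1.1.2) <= j < e.1.2 * (P %/ e.2)) g j.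
Proof.
elim: n => [|n IH] nQ; first by rewrite /= big_seq1 /= divn1 mul0n mul1n.
rewrite IH 1?ltnW //= big_flatten big_map /= big_seq [RHS]big_seq.
apply: eq_bigr => -[[[a q] a'] q'] /fareyP /and5P[/andP[h1 h2] /andP[h3 h4] /eqP h5 h6 /andP[h7 h8]] /=.
case: eqP => e; rewrite ?big_seq1 // big_cons big_seq1 /=.
have p1 : ((a + a') * (P %/ (q + q')) = a * (P %/ q) + P %/ (q * (q + q')))%N.
  by apply: farey_pos; [lia|lia|apply: dvP; lia|nia].
have p2 : (a' * (P %/ q') = (a + a') * (P %/ (q + q')) + P %/ ((q + q') * q'))%N.
  by apply: farey_pos; [lia|lia|rewrite mulnC; apply: dvP; lia|nia].
by rewrite -big_cat_nat // ?p2 ?p1 leq_addr.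
Qed.

(** The number of grid points from a / q to its mediant with the neighbour of denominator [x], at
    distance 1 / (q (q + x)). *)
Definition farc (q x : nat) : nat := P %/ (q * (q + x)).

Lemma farey_dissection : (0 < Q)%N ->
  \sum_(0 <= j < P) g j = \sum_(1 <= q < Q.+1) \sum_(1 <= x < Q.+1 | coprime x q && (Q < q + x)%N)
    (\sum_(0 <= i < farc q x) g (alpha q x * (P %/ q) + i)%N +
     \sum_(0 <= i < farc q x) g (P - alpha q x * (P %/ q) - i.+1)%N).
Proof.
move=> Q0; have [n Qn] : exists n, Q = n.+1 by exists Q.-1; rewrite prednK.
rewrite Qn (@farey_intervals n) ?Qn //.
pose Rt q x := \sum_(0 <= i < farc q x) g (alpha q x * (P %/ q) + i)%N.
(* The half arc to the left of a' / q' is the mirror image, under j -> P - j, of a right half arc at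
   (q' - a') / q'. The [i.+1] is due to intervals closed on the left and open on the right. *)
pose Lt q x := \sum_(0 <= i < farc q x) g (P - alpha q x * (P %/ q) - i.+1)%N.
transitivity (\sum_(e <- farey n) (Rt e.1.1.2 e.2 + Lt e.2 e.1.1.2)).
  rewrite big_seq [RHS]big_seq; apply: eq_bigr => -[[[a q] a'] q'] /fareyP.
  move=> /and5P[/andP[h1 h2] /andP[h3 h4] /eqP h5 h6 /andP[h7 h8]] /=.
  have d1 : (q * (q + q') %| P)%N by apply: dvP; lia.
  have d2 : (q' * (q + q') %| P)%N by apply: dvP; lia.
  have c1 : coprime q' q.
    rewrite /coprime -dvdn1 -(dvdn_addr 1 (_ : gcdn q' q %| a * q')%N) ?dvdn_mull ?dvdn_gcdl //.
    by rewrite -h5 dvdn_mull ?dvdn_gcdr.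
  have a'0 : (0 < a')%N by nia.
  have e1 : alpha q q' = a by apply: alphaE => //; rewrite -h5 dvdn_mull.
  have e2 : alpha q' q = (q' - a')%N.
    apply: alphaE; rewrite 1?coprime_sym //; first by lia.
    apply/dvdnP; exists (q - a)%N; nia.
  have qP : (q %| P)%N by apply: dvdn_trans d1; rewrite dvdn_mulr.
  have q'P : (q' %| P)%N by apply: dvdn_trans d2; rewrite dvdn_mulr.
  rewrite /Rt /Lt e1 e2 /farc (addnC q' q).
  have p1 : ((a + a') * (P %/ (q + q')) = a * (P %/ q) + P %/ (q * (q + q')))%N.
    by apply: farey_pos => //; nia.
  have p2 : (a' * (P %/ q') = (a + a') * (P %/ (q + q')) + P %/ (q' * (q + q')))%N.
    by rewrite [(q' * (q + q'))%N]mulnC; apply: farey_pos; [lia|lia|rewrite mulnC; exact: d2|by rewrite mulnDr mulnDl h5 addnAC].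
  rewrite mulnBl [(q' * (P %/ q'))%N]mulnC divnK // subKn; last first.
    by rewrite -{2}(divnK q'P) mulnC leq_mul2l h7 orbT.
  rewrite (big_cat_nat (n := ((a + a') * (P %/ (q + q')))%N)) /= ?p2 ?p1 ?leq_addr //.
  rewrite -{1}[(a * (P %/ q))%N]add0n big_addn addKn; congr (_ + _).
    by apply: eq_bigr => i _; rewrite addnC.
  rewrite -{1}[(a * (P %/ q) + P %/ (q * (q + q')))%N]add0n big_addn addKn big_nat_rev /= add0n.
  apply: eq_big_nat => i; move: (P %/ (q' * (q + q')))%N (a * (P %/ q) + P %/ (q * (q + q')))%N.
  by move=> u v /andP[_ hi]; congr g; move: hi; clear; lia.
rewrite big_split /= (farey_pairs Rt) (farey_pairs (fun q x => Lt x q)).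
have -> : \sum_(1 <= q < n.+2) \sum_(1 <= x < n.+2 | coprime x q && (n.+1 < q + x)%N) Lt x q =
   \sum_(1 <= q < n.+2) \sum_(1 <= x < n.+2 | coprime x q && (n.+1 < q + x)%N) Lt q x.
  under eq_bigr => q _ do rewrite big_mkcond /=.
  rewrite exchange_big_nat /=; apply: eq_bigr => q _; rewrite [RHS]big_mkcond /=.
  by apply: eq_bigr => x _; rewrite coprime_sym addnC.
by rewrite -big_split /=; apply: eq_bigr => q _; rewrite -big_split.
Qed.

End Farey.

(** * Four triangular numbers *)

Definition chi4 (n : nat) : int :=
  if (n %% 4 == 1)%N then 1 else if (n %% 4 == 3)%N then - 1 else 0.

(** The characters will be attached to [d] and [e]; the sum over these quadruples is then a
    convolution of two divisor sums of [chi4], hence of two counts of sums of two squares. *)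
Definition quad_ok (M : nat) (x : nat * nat * nat * nat) : bool :=
  let: (d, k, e, l) := x in
  [&& odd d, odd k, odd e, odd l & d * k + e * l == 2 * M]%N.

Definition quads (M : nat) : seq (nat * nat * nat * nat) :=
  [seq x <- [seq (y, l) | y <- [seq (z, e) | z <- [seq (d, k) | d <- iota 0 (2 * M).+1, k <- iota 0 (2 * M).+1],
     e <- iota 0 (2 * M).+1], l <- iota 0 (2 * M).+1] | quad_ok M x].

Lemma quads_uniq M : uniq (quads M).
Proof.
rewrite filter_uniq // allpairs_uniq ?iota_uniq //; last by move=> [? ?] [? ?] _ _ [-> ->].
rewrite allpairs_uniq ?iota_uniq //; last by move=> [? ?] [? ?] _ _ [-> ->].
by rewrite allpairs_uniq ?iota_uniq //; move=> [? ?] [? ?] _ _ [-> ->].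
Qed.

Lemma mem_quads M x : (x \in quads M) = quad_ok M x.
Proof.
rewrite mem_filter; case: x => [[[d k] e] l]; apply/andP/idP => [[//]|q]; split=> //; move: (q) => /and5P[od ok oe ol /eqP E].
have [d0 k0 e0 l0] : [/\ 0 < d, 0 < k, 0 < e & 0 < l]%N by split; apply: odd_gt0.
have h a b c : (0 < b)%N -> (a * b + c = 2 * M)%N -> (a < (2 * M).+1)%N.
  by move=> b0 <-; rewrite ltnS; apply: leq_trans (leq_addr _ _); rewrite leq_pmulr.
have I a : (a < (2 * M).+1)%N -> a \in iota 0 (2 * M).+1 by rewrite mem_iota.
have Ed : d \in iota 0 (2 * M).+1 by apply: I; apply: h k0 E.
have Ek : k \in iota 0 (2 * M).+1 by apply: I; apply: h d0 _; rewrite mulnC; exact: E.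
have Ee : e \in iota 0 (2 * M).+1 by apply: I; apply: h l0 _; rewrite addnC; exact: E.
have El : l \in iota 0 (2 * M).+1 by apply: I; apply: h e0 _; rewrite mulnC addnC; exact: E.
apply/allpairsPdep; exists (d, k, e), l; split=> //.
apply/allpairsPdep; exists (d, k), e; split=> //.
by apply/allpairsPdep; exists d, k.
Qed.

(* Since dk + el = 2 mod 4, exactly one of d - e and k + l is divisible by 4. *)
Definition flip (x : nat * nat * nat * nat) : nat * nat * nat * nat :=
  let: (d, k, e, l) := x in let n := (e %/ (d - e))%N in
  ((n + 2) * k + (n + 1) * l, (n + 1) * e - n * d, (n + 1) * k + n * l, (n + 1) * d - (n + 2) * e)%N.

Lemma flipP M d k e l : quad_ok M (d, k, e, l) -> odd M -> (e < d)%N ->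
  exists d' k' e' l', [/\ flip (d, k, e, l) = (d', k', e', l'), quad_ok M (d', k', e', l'), (e' < d')%N,
    flip (d', k', e', l') = (d, k, e, l) & chi4 d' * chi4 e' = - (chi4 d * chi4 e)].
Proof.
move=> /and5P[od ok oe ol /eqP E] oM ed; rewrite /flip.
set n := (e %/ (d - e))%N.
have [k0 l0] : (0 < k)%N /\ (0 < l)%N by split; apply: odd_gt0.
have de0 : (0 < d - e)%N by rewrite subn_gt0.
(* [d - e] is even and [e] is odd, so the division leaves a positive remainder e - n (d - e), the
   new entry [K]; the other new entry is [L] = d - e - K. *)
have n1 : (n * (d - e) < e)%N.
  rewrite ltn_neqAle leq_trunc_div andbT; apply/eqP => h.
  by have oe2 := oe; move: oe; rewrite -h oddM oddB ?(ltnW ed) // od oe2 andbF.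
have n2 : (e < (n + 1) * (d - e))%N by rewrite addn1 ltn_ceil.
have hK : (n * d < (n + 1) * e)%N.
  by move: n1; rewrite mulnBr mulnDl mul1n; move: (n * d)%N (n * e)%N => a b; clear; lia.
have hL : ((n + 2) * e < (n + 1) * d)%N.
  move: n2; rewrite mulnBr (_ : (n + 2) * e = (n + 1) * e + e)%N; last by ring.
  by move: ((n + 1) * d)%N ((n + 1) * e)%N => a b; clear; lia.
have [K KE] : exists K, ((n + 1) * e = n * d + K /\ 0 < K)%N.
  by exists ((n + 1) * e - n * d)%N; rewrite subnKC ?subn_gt0 // ltnW.
have [L LE] : exists L, ((n + 1) * d = (n + 2) * e + L /\ 0 < L)%N.
  by exists ((n + 1) * d - (n + 2) * e)%N; rewrite subnKC ?subn_gt0 // ltnW.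
case: KE LE => KE K0 [LE L0].
have -> : ((n + 1) * e - n * d = K)%N by rewrite KE addKn.
have -> : ((n + 1) * d - (n + 2) * e = L)%N by rewrite LE addKn.
set d' := ((n + 2) * k + (n + 1) * l)%N; set e' := ((n + 1) * k + n * l)%N.
have de' : (d' = e' + (k + l))%N by rewrite /d' /e'; ring.
exists d', K, e', L.
have oK : odd K by have := congr1 odd KE; rewrite oddD !oddM oddD od oe; case: (odd n); case: (odd K).
have oL : odd L by have := congr1 odd LE; rewrite oddD !oddM !oddD od oe; case: (odd n); case: (odd L).
have oe' : odd e' by rewrite /e' oddD !oddM oddD ok ol; case: (odd n).
have od' : odd d' by rewrite de' oddD oe' oddD ok ol.
have EK : K%:Z = (n%:Z + 1) * e%:Z - n%:Z * d%:Z.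
  have := congr1 Posz KE; rewrite !(PoszD, PoszM) => h.
  by apply: (addrI (n%:Z * d%:Z)); rewrite -h; ring.
have EL : L%:Z = (n%:Z + 1) * d%:Z - (n%:Z + 2) * e%:Z.
  have := congr1 Posz LE; rewrite !(PoszD, PoszM) => h.
  by apply: (addrI ((n%:Z + 2) * e%:Z)); rewrite -h; ring.
have toZ (a b : nat) : a%:Z = b%:Z -> a = b by case.
have E' : (d' * K + e' * L = 2 * M)%N.
  by rewrite -E; apply: toZ; rewrite /d' /e' !(PoszD, PoszM) EK EL; ring.
split=> //.
- by rewrite /quad_ok od' oK oe' oL E' eqxx.
- by rewrite de' -[X in (X < _)%N]addn0 ltn_add2l addn_gt0 k0.
(* Since e' = n (k + l) + k and d' - e' = k + l, the quotient is [n] again; this makes [flip] an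
   involution. *)
- rewrite (_ : e' %/ (d' - e') = n)%N; last first.
    rewrite de' addKn (_ : e' = n * (k + l) + k)%N; last by rewrite /e'; ring.
    by rewrite divnMDl ?addn_gt0 ?k0 // divn_small ?addn0 // -[X in (X < _)%N]addn0 ltn_add2l.
  have z1 : ((n + 2) * K + (n + 1) * L = d)%N by apply: toZ; rewrite !(PoszD, PoszM) EK EL; ring.
  have z2 : ((n + 1) * K + n * L = e)%N by apply: toZ; rewrite !(PoszD, PoszM) EK EL; ring.
  have z3 : ((n + 1) * e' - n * d' = k)%N.
    by rewrite (_ : (n + 1) * e' = n * d' + k)%N ?addKn //; rewrite /e' /d'; ring.
  have z4 : ((n + 1) * d' - (n + 2) * e' = l)%N.
    by rewrite (_ : (n + 1) * d' = (n + 2) * e' + l)%N ?addKn //; rewrite /e' /d'; ring.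
  by rewrite z1 z2 z3 z4.
(* The product is 1 exactly when 4 divides a - b, written a + 3b to avoid subtraction. As d' - e' =
   k + l, and exactly one of d - e and k + l is divisible by 4, the sign changes. *)
have chiE a b : odd a -> odd b -> chi4 a * chi4 b = if ((a + 3 * b) %% 4 == 0)%N then 1 else -1.
  move=> oa ob; rewrite /chi4 -modnDm -modnMmr.
  have : (a %% 4 = 1 \/ a %% 4 = 3)%N by lia.
  have : (b %% 4 = 1 \/ b %% 4 = 3)%N by lia.
  by case=> -> [] ->.
rewrite !chiE //.
have res a : odd a -> (a %% 4 = 1 \/ a %% 4 = 3)%N by lia.
have key : ((d + 3 * e + (k + l)) %% 4 = 2)%N.
  have : ((d %% 4 * (k %% 4) + e %% 4 * (l %% 4)) %% 4 = 2)%N.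
    have e2 : ((2 * M) %% 4 = 2)%N by move: oM; clear; lia.
    by rewrite -[RHS]e2 -E -[LHS]modnDm (modnMm d k) (modnMm e l) modnDm.
  move: (res d od) (res e oe) (res k ok) (res l ol); clear.
  by case=> hd [] he [] hk [] hl; rewrite ?hd ?he ?hk ?hl; lia.
have -> : ((d' + 3 * e') %% 4 = (k + l) %% 4)%N.
  by rewrite de' (_ : e' + (k + l) + 3 * e' = e' * 4 + (k + l))%N ?modnMDl //; ring.
have : (~~ odd (d + 3 * e))%N by rewrite oddD oddM od oe.
have : (~~ odd (k + l))%N by rewrite oddD ok ol.
by move: key; move: (d + 3 * e)%N (k + l)%N => a b; do 2!case: eqP; rewrite ?opprK //; lia.
Qed.

Definition qd (x : nat * nat * nat * nat) := x.1.1.1.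
Definition qe (x : nat * nat * nat * nat) := x.1.2.

Lemma sum_flip (M : nat) : odd M ->
  \sum_(x <- quads M | (qe x < qd x)%N) chi4 (qd x) * chi4 (qe x) = 0.
Proof.
move=> oM; rewrite -big_filter; set s := [seq x <- _ | _].
have us : uniq s by rewrite filter_uniq ?quads_uniq.
have ms x : (x \in s) = (qe x < qd x)%N && quad_ok M x by rewrite mem_filter mem_quads.
have H x : x \in s -> [/\ flip x \in s, flip (flip x) = x &
    chi4 (qd (flip x)) * chi4 (qe (flip x)) = - (chi4 (qd x) * chi4 (qe x))].
  rewrite ms; case: x => [[[d k] e] l] /andP[ed ok]; rewrite /qe /qd /= in ed.
  have [d' [k' [e' [l' [-> ok' lt' inv' c']]]]] := flipP ok oM ed.
  by split=> //; rewrite ms ok' andbT.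
set S := LHS; have : S = - S.
  rewrite {1}/S (perm_big [seq flip x | x <- s]) /=; last first.
    rewrite perm_sym; apply: uniq_perm => //.
      by rewrite map_inj_in_uniq // => x y /H[_ hx _] /H[_ hy _] e; rewrite -hx e.
    move=> x; apply/mapP/idP => [[y /H[hy _ _] -> //]|/H[h1 h2 _]].
    by exists (flip x).
  rewrite big_map -sumrN !big_seq; apply: eq_bigr => x /H[_ _ ->] //.
by move/eqP; rewrite -subr_eq0 opprK -mulr2n mulrn_eq0 /= => /eqP.
Qed.

Definition twist (x : nat * nat * nat * nat) : nat * nat * nat * nat :=
  let: (d, k, e, l) := x in (e, l, d, k).

(** The quadruples with d > e cancel under [flip], those with d < e by symmetry. On the diagonal d
    (k + l) = 2M, so each divisor d of M allows the M / d odd values of k below 2M / d, and the M /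
    d add up to the divisor sum. *)
Lemma dirichlet_quads (M : nat) : odd M ->
  \sum_(x <- quads M) chi4 (qd x) * chi4 (qe x) = (\sum_(d <- divisors M) d)%N%:Z.
Proof.
move=> oM; have M0 : (0 < M)%N by apply: odd_gt0.
rewrite (bigID (fun x => qe x < qd x)%N) /= sum_flip // add0r.
rewrite (bigID (fun x => qd x < qe x)%N) /=.
have -> : \sum_(x <- quads M | ~~ (qe x < qd x)%N && (qd x < qe x)%N) chi4 (qd x) * chi4 (qe x) = 0.
  rewrite -[RHS](sum_flip oM) (perm_big [seq twist x | x <- quads M]) /=; last first.
    have tK : involutive twist by move=> [[[d k] e] l].
    apply: uniq_perm; rewrite ?quads_uniq ?(map_inj_uniq (inv_inj tK)) ?quads_uniq //.
    have tok x : quad_ok M (twist x) = quad_ok M x.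
      by case: x => [[[d k] e] l] /=; rewrite [(e * l + _)%N]addnC; do 4!case: odd.
    move=> x; rewrite mem_quads; apply/idP/mapP => [ok|[y hy ->]]; last by rewrite tok -mem_quads.
    by exists (twist x); rewrite ?tK // mem_quads tok.
  rewrite big_map; apply: eq_big => [[[[d k] e] l]|[[[d k] e] l] _]; rewrite /twist /qd /qe /=; last by rewrite mulrC.
  by case: ltngtP.
rewrite add0r.
transitivity (\sum_(x <- quads M | qd x == qe x) 1%:Z).
  rewrite big_seq_cond [RHS]big_seq_cond /=.
  apply: eq_big => [x|[[[d k] e] l]]; first by case: ltngtP; rewrite ?andbF ?andbT //.
  rewrite mem_quads /qd /qe /= => /andP[/and5P[od _ oe _ _] ] /andP[h1 h2].
  have -> : e = d by apply/eqP; move: h1 h2; rewrite -!leqNgt => h1 h2; rewrite eqn_leq h1 h2.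
  rewrite /chi4; have : (d %% 4 = 1 \/ d %% 4 = 3)%N by lia.
  by case=> ->.
have -> : \sum_(x <- quads M | qd x == qe x) 1%:Z = (size [seq x <- quads M | qd x == qe x])%:Z.
  by rewrite -big_filter big_const_seq count_predT iter_addr addr0 natz.
congr Posz.
pose t := [seq (d, k.*2.+1, d, 2 * (M %/ d) - k.*2.+1)%N | d <- divisors M, k <- iota 0 (M %/ d)].
have -> : (\sum_(d <- divisors M) d = size t)%N.
  rewrite size_allpairs_dep sumnE big_map (perm_big [seq (M %/ d)%N | d <- divisors M]) /=.
    by rewrite big_map; apply: eq_bigr => d _; rewrite size_iota.
  apply: uniq_perm; rewrite ?divisors_uniq //.
    rewrite map_inj_in_uniq ?divisors_uniq // => d d'; rewrite -!dvdn_divisors // => h h' e.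
    have q0 : (0 < M %/ d')%N by rewrite divn_gt0 ?(dvdn_gt0 M0 h') // dvdn_leq.
    by have a := divnK h; rewrite e in a; apply/eqP; rewrite -(eqn_pmul2l q0) a divnK.
  move=> d; apply/idP/mapP => [|[d' hd ->]].
    rewrite -dvdn_divisors // => hd; exists (M %/ d)%N; last by rewrite divnA ?mulKn // ?mulnC.
    by rewrite -dvdn_divisors // dvdn_div.
  by move: hd; rewrite -!dvdn_divisors // => /dvdn_div.
apply: perm_size; apply: uniq_perm; first by rewrite filter_uniq ?quads_uniq.
  apply: allpairs_uniq_dep => [|d _|]; [exact: divisors_uniq|exact: iota_uniq|].
  by move=> [d k] [d' k'] _ _ /= [-> /double_inj -> _].
move=> x; rewrite mem_filter mem_quads; apply/andP/allpairsPdep => [[]|[d [k [hd hk ->]]]].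
  case: x => [[[d k] e] l]; rewrite /qd /qe /= => /eqP <- /and5P[od ok _ ol /eqP E].
  have E2 : (d * (k + l) = 2 * M)%N by rewrite mulnDr.
  have kl : (2 %| k + l)%N by rewrite dvdn2 oddD ok ol.
  have dM : (d %| M)%N.
    apply/dvdnP; exists ((k + l) %/ 2)%N; apply/eqP; rewrite -(eqn_pmul2l (isT : 0 < 2)%N) -E2 mulnA.
    by rewrite [(2 * (_ %/ _))%N]mulnC divnK // mulnC.
  have d0 := dvdn_gt0 M0 dM.
  have kl2 : (k + l = 2 * (M %/ d))%N.
    by apply/eqP; rewrite -(eqn_pmul2l d0) E2 mulnCA [(d * (M %/ d))%N]mulnC divnK.
  exists d, k./2; rewrite -dvdn_divisors // dM mem_iota.
  have kE : (k./2.*2.+1 = k)%N by rewrite -[RHS]odd_double_half ok add1n.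
  split=> //; first by move: kl2 (odd_gt0 ol) kE; rewrite -mul2n; move: (M %/ d)%N; clear; lia.
  by rewrite kE -kl2 addKn.
move: hd hk; rewrite -dvdn_divisors // mem_iota add0n => dM /andP[_ hk].
have od : odd d by apply: dvdn_odd dM oM.
have hk2 : (k.*2.+1 <= 2 * (M %/ d))%N by rewrite -mul2n; move: hk; clear; lia.
rewrite /qd /qe /= eqxx od /= !odd_double /= oddB // oddM /= odd_double /=.
by rewrite -mulnDr subnKC // mulnCA [(d * _)%N]mulnC divnK // eqxx.
Qed.

(** * Jacobi's two squares theorem for odd numbers *)

Definition zr (m : nat) : seq int := [seq i%:Z - m%:Z | i <- iota 0 (2 * m).+1].

Definition nz (z : int * int) : int := z.1 ^+ 2 + z.2 ^+ 2.

(** The Gaussian integers of norm [m]; a box of radius [m] contains them all. *)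
Definition pts (m : nat) : seq (int * int) :=
  [seq z <- [seq (a, b) | a <- zr m, b <- zr m] | nz z == m%:Z].

Lemma uniq_pts m : uniq (pts m).
Proof.
rewrite filter_uniq // allpairs_uniq; last by move=> [a b] [c d] _ _.
  by [].
- by rewrite map_inj_uniq ?iota_uniq // => i j /addIr [].
by rewrite map_inj_uniq ?iota_uniq // => i j /addIr [].
Qed.

Lemma mem_zr m (a : int) : (a \in zr m) = (- m%:Z <= a <= m%:Z).
Proof.
apply/mapP/idP => [[i]|h]; first by rewrite mem_iota => hi ->; lia.
exists (absz (a + m%:Z)); last by lia.
by rewrite mem_iota; lia.
Qed.

Lemma mem_pts m z : (z \in pts m) = (nz z == m%:Z).
Proof.
rewrite mem_filter; apply/andP/idP => [[]//|/eqP e]; split; first exact/eqP.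
apply/allpairsP; exists z.
have h (a b : int) : a ^+ 2 + b ^+ 2 = m%:Z -> a \in zr m.
  rewrite mem_zr => E; have : 0 <= b ^+ 2 by apply: sqr_ge0.
  have : a <= a ^+ 2 /\ - a <= a ^+ 2 by split; nia.
  by move=> [] *; apply/andP; split; lia.
split; last by case: (z).
  exact: h e.
by apply: (h _ z.1); rewrite addrC.
Qed.

Lemma count_pts m k (P : pred (int * int)) (f : int * int -> int * int) :
  injective f -> (forall w, nz w = k%:Z -> nz (f w) = m%:Z /\ P (f w)) ->
  (forall z, nz z = m%:Z -> P z -> exists2 w, nz w = k%:Z & f w = z) ->
  count P (pts m) = size (pts k).
Proof.
move=> fi h1 h2; rewrite -size_filter -[RHS](size_map f); apply: perm_size.
apply: uniq_perm => [||z].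
- exact/filter_uniq/uniq_pts.
- by rewrite map_inj_uniq // uniq_pts.
rewrite mem_filter mem_pts; apply/andP/mapP => [[Pz /eqP ez]|[w]].
  by have [w ew <-] := h2 z ez Pz; exists w; rewrite // mem_pts ew.
by rewrite mem_pts => /eqP /h1 [hw Pw] ->; split; rewrite ?hw.
Qed.

Lemma dvdz_sqr_prime (p : nat) (x : int) : prime p -> (p %| x ^+ 2)%Z -> (p %| x)%Z.
Proof.
by move=> pp; rewrite !dvdzE abszX /= Euclid_dvdX // => /andP[].
Qed.

(** In Gaussian integers [f] is multiplication by w = u + iv, and the congruence says that p divides
    the real part of z times the conjugate of w. The product of the norms of z and w is divisible by
    p^2, so p divides the imaginary part too, and the condition means that w divides z. *)
Lemma count_gauss (p k : nat) (u v : int) : prime p -> u ^+ 2 + v ^+ 2 = p%:Z ->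
  count (fun z : int * int => (p %| z.1 * u + z.2 * v)%Z) (pts (p * k)) = size (pts k).
Proof.
move=> pp uv; have p0 : p%:Z != 0 by rewrite eqz_nat -lt0n prime_gt0.
pose f (w : int * int) := (w.1 * u - w.2 * v, w.1 * v + w.2 * u).
have f1 w : (f w).1 * u + (f w).2 * v = w.1 * p%:Z by rewrite -uv /f /=; ring.
have f2 w : (f w).2 * u - (f w).1 * v = w.2 * p%:Z by rewrite -uv /f /=; ring.
apply: (count_pts (f := f)).
- move=> w w' e; have := f1 w; have := f2 w; rewrite e f1 f2.
  by move=> /(mulIf p0) e2 /(mulIf p0) e1; case: w w' e1 e2 {e} => [? ?] [? ?] /= -> ->.
- move=> w ew; split; last by rewrite f1 dvdz_mull.
  by rewrite PoszM -ew -uv /nz /f /=; ring.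
move=> z ez /dvdzP[c hc].
have : (p %| (z.2 * u - z.1 * v) ^+ 2)%Z.
  have -> : (z.2 * u - z.1 * v) ^+ 2 = p%:Z * (p%:Z * k%:Z - c ^+ 2 * p%:Z).
    transitivity (nz z * (u ^+ 2 + v ^+ 2) - (z.1 * u + z.2 * v) ^+ 2); first by rewrite /nz; ring.
    by rewrite ez uv hc PoszM; ring.
  by rewrite dvdz_mulr.
move/(dvdz_sqr_prime pp)/dvdzP=> [d hd].
exists (c, d).
  apply: (mulIf (mulf_neq0 p0 p0)).
  transitivity ((z.1 * u + z.2 * v) ^+ 2 + (z.2 * u - z.1 * v) ^+ 2); first by rewrite hc hd /nz /=; ring.
  transitivity (nz z * (u ^+ 2 + v ^+ 2)); first by rewrite /nz; ring.
  by rewrite ez uv PoszM; ring.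
apply/eqP; rewrite /f /= -pair_eqE /=; apply/andP; split; apply/eqP; apply: (mulIf p0).
  by rewrite -[in RHS]uv [LHS](_ : _ = (c * p%:Z) * u - (d * p%:Z) * v); [rewrite -hc -hd; ring | ring].
by rewrite -[in RHS]uv [LHS](_ : _ = (c * p%:Z) * v + (d * p%:Z) * u); [rewrite -hc -hd; ring | ring].
Qed.

Definition rq (p k : nat) : nat := if (p %| k)%N then size (pts (k %/ p)) else 0.

Lemma count_both (p k : nat) : prime p ->
  count (fun z : int * int => (p %| z.1)%Z && (p %| z.2)%Z) (pts (p * k)) = rq p k.
Proof.
move=> pp; have p0 : p%:Z != 0 by rewrite eqz_nat -lt0n prime_gt0.
have key (z : int * int) : nz z = (p * k)%N%:Z -> (p %| z.1)%Z -> (p %| z.2)%Z ->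
    exists w, [/\ z = (w.1 * p%:Z, w.2 * p%:Z) & nz w * p%:Z = k%:Z].
  move=> ez /dvdzP[a ha] /dvdzP[b hb]; exists (a, b); split; first by rewrite -ha -hb; case: (z).
  apply: (mulIf p0); rewrite [RHS]mulrC -PoszM -ez /nz ha hb /=; ring.
rewrite /rq; case: ifP => pk.
  apply: (count_pts (f := fun w => (w.1 * p%:Z, w.2 * p%:Z))).
  - by move=> [a b] [c d] [/= /(mulIf p0) -> /(mulIf p0) ->].
  - move=> w ew; split; last by rewrite /= !dvdz_mull.
    by rewrite PoszM -[in k%:Z](divnK pk) PoszM -ew /nz /=; ring.
  move=> z ez /andP[h1 h2]; have [w [-> ew]] := key z ez h1 h2; exists w => //.
  by apply: (mulIf p0); rewrite ew -PoszM divnK.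
apply/eqP; rewrite -leqn0 leqNgt -has_count; apply/hasPn => z; rewrite mem_pts => /eqP ez.
apply/negP => /andP[h1 h2]; have [w [_ ew]] := key z ez h1 h2.
by move/negP: pk; apply; rewrite -[(p %| k)%N]/(p %| k%:Z)%Z -ew dvdz_mull.
Qed.

(** Inclusion-exclusion: an element of norm p k is divisible by u + iv or by its conjugate, and by
    both exactly when it is divisible by p, in which case the quotient has norm k / p. *)
Lemma r_split (p k : nat) (u v : int) : prime p -> odd p -> u ^+ 2 + v ^+ 2 = p%:Z ->
  (size (pts (p * k)) + rq p k = 2 * size (pts k))%N.
Proof.
move=> pp po uv; have uv' : u ^+ 2 + (- v) ^+ 2 = p%:Z by rewrite sqrrN.
pose A (z : int * int) := (p %| z.1 * u + z.2 * v)%Z.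
pose B (z : int * int) := (p %| z.1 * u + z.2 * (- v))%Z.
have cp2 : coprime p 2 by rewrite coprimen2.
have pM (x y : int) : (p %| x * y)%Z = (p %| x)%Z || (p %| y)%Z.
  by rewrite !dvdzE abszM /= Euclid_dvdM.
have p2 : (p %| 2)%Z = false.
  have -> : (p %| 2)%Z = (p %| 2)%N by [].
  by rewrite dvdn_prime2 //; apply/eqP => e; rewrite e in po.
have nuv (x y : int) : x ^+ 2 + y ^+ 2 = p%:Z -> (p %| x)%Z = false.
  move=> e; apply/negP => px.
  have py : (p %| y)%Z.
    apply: (dvdz_sqr_prime pp); rewrite (_ : y ^+ 2 = p%:Z - x * x); last by rewrite -e; ring.
    by rewrite rpredB // dvdz_mulr.
  have : ((p * p)%N %| p%:Z)%Z.
    by rewrite -e !expr2 PoszM rpredD // dvdz_mul.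
  rewrite -[(_ %| _)%Z]/(p * p %| p)%N => /(dvdn_leq (prime_gt0 pp)).
  by rewrite leqNgt ltn_Pmull ?prime_gt1 ?prime_gt0.
have pu := nuv _ _ uv; have pv : (p %| v)%Z = false by apply: (nuv _ u); rewrite addrC.
have := count_predUI A B (pts (p * k)); rewrite !count_gauss // addnn -mul2n => <-; congr addn.
  rewrite -count_predT; apply: eq_in_count => z; rewrite mem_pts => /eqP ez.
  rewrite /= -[_ || _]/(A z || B z) /A /B -pM; apply/esym.
  have -> : (z.1 * u + z.2 * v) * (z.1 * u + z.2 * - v) = nz z * u ^+ 2 - z.2 ^+ 2 * (u ^+ 2 + v ^+ 2).
    by rewrite /nz; ring.
  rewrite ez uv PoszM; apply: rpredB; last by rewrite dvdz_mull.
  by rewrite -mulrA dvdz_mulr.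
rewrite -(count_both k pp); apply: eq_count => z; rewrite /= -[RHS]/(A z && B z) /A /B.
apply/andP/andP => [[h1 h2]|[h1 h2]]; first by split; apply: rpredD; rewrite dvdz_mulr.
have e1 : 2 * (z.1 * u) = (z.1 * u + z.2 * v) + (z.1 * u + z.2 * - v) by ring.
have e2 : 2 * (z.2 * v) = (z.1 * u + z.2 * v) - (z.1 * u + z.2 * - v) by ring.
have g1 : (p %| 2 * (z.1 * u))%Z by rewrite e1; apply: rpredD; [exact: h1|exact: h2].
have g2 : (p %| 2 * (z.2 * v))%Z by rewrite e2; apply: rpredB; [exact: h1|exact: h2].
by move: g1 g2; rewrite !pM p2 pu pv !orbF.
Qed.

Lemma dvdz_Fp (p : nat) (x : int) : prime p -> (p %| x)%Z = (x%:~R == 0 :> 'F_p).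
Proof.
move=> pp; have ch := pchar_Fp pp; case: x => n; first by rewrite -(dvdn_pcharf ch).
by rewrite NegzE mulrNz oppr_eq0 -pmulrn -(dvdn_pcharf ch).
Qed.

Lemma Fp_fermat (p : nat) (x : 'F_p) : prime p -> x != 0 -> x ^+ p.-1 = 1.
Proof.
move=> pp x0; apply: (mulfI x0); rewrite -exprS prednK ?prime_gt0 // mulr1.
have := @expf_card 'F_p x; rewrite card_Fp //.
Qed.

(** A nonzero solution of a^2 + b^2 = 0 modulo p would make -1 a square; raising it to the odd power
    (p - 1) / 2 contradicts Fermat. So every element of norm p k is a multiple of p. *)
Lemma r_inert (p k : nat) : prime p -> (p %% 4 = 3)%N -> size (pts (p * k)) = rq p k.
Proof.
move=> pp p3; rewrite -(count_both k pp) -count_predT; apply: eq_in_count => z.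
rewrite mem_pts => /eqP ez /=; apply/esym.
have : (z.1%:~R ^+ 2 + z.2%:~R ^+ 2 : 'F_p) = 0.
  rewrite -!rmorphXn -rmorphD -[_ + _]/(nz z) ez; apply/eqP; rewrite -dvdz_Fp //.
  by rewrite PoszM dvdz_mulr.
rewrite !dvdz_Fp //; move: (_%:~R) (_%:~R) => b a e.
case: (eqVneq b 0) => [b0|b0].
  have b2 : b ^+ 2 = 0 by rewrite b0 expr0n.
  have : a ^+ 2 = 0 by move: e; rewrite b2 addr0.
  by move/eqP; rewrite sqrf_eq0 => ->.
have x2 : (a / b) ^+ 2 = -1.
  by rewrite exprMn exprVn; apply: (mulIf (expf_neq0 2 b0)); rewrite divfK ?expf_neq0 // mulN1r; apply/eqP; rewrite -addr_eq0 e.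
have x0 : a / b != 0 by apply/eqP => h; move/eqP: x2; rewrite h expr0n /= eq_sym oppr_eq0 oner_eq0.
have := Fp_fermat pp x0.
have -> : p.-1 = (2 * (p./2))%N by lia.
have -> : p./2 = (p %/ 4).*2.+1 by lia.
rewrite exprM x2 exprS -mul2n exprM sqrrN !expr1n mulr1 => /eqP.
rewrite eq_sym -subr_eq0 opprK -[1 + 1]/(2%:R) -(dvdn_pcharf (pchar_Fp pp)).
by rewrite dvdn_prime2 // => /eqP e2; rewrite e2 in p3.
Qed.

(** With p - 1 = 4k, either some x^(2k) is not 1, hence is -1 and x^k is the root, or the polynomial
    X^(2k) - 1 has 4k roots. *)
Lemma sqrt_minus1 (p : nat) : prime p -> (p %% 4 = 1)%N -> exists s : 'F_p, s ^+ 2 = -1.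
Proof.
move=> pp p1; pose k := (p %/ 4)%N; have pk : (p.-1 = 4 * k)%N by rewrite /k; lia.
have k0 : (0 < k)%N by have := prime_gt1 pp; lia.
case: (pickP (fun x : 'F_p => (x != 0) && (x ^+ (2 * k) != 1))) => [x /andP[x0 x1]|no].
  exists (x ^+ k); rewrite -exprM mulnC; apply/eqP; rewrite -addr_eq0.
  have : (x ^+ (2 * k) - 1) * (x ^+ (2 * k) + 1) == 0.
    rewrite -subr_sqr_1 -exprM (_ : 2 * k * 2 = p.-1)%N ?Fp_fermat ?subrr //.
    by rewrite pk; ring.
  by rewrite mulf_eq0 subr_eq0 (negPf x1).
pose q : {poly 'F_p} := 'X^(2 * k) - 1; pose rs := [seq x <- enum 'F_p | x != 0].
have sq : size q = (2 * k).+1 by rewrite size_XnsubC // muln_gt0.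
have : (size rs < size q)%N.
  apply: max_poly_roots; first by rewrite -size_poly_gt0 sq.
    apply/allP => x; rewrite mem_filter => /andP[x0 _]; have := no x; rewrite x0 /= => /negbFE.
    by rewrite /root !hornerE subr_eq0.
  by rewrite filter_uniq // enum_uniq.
rewrite sq ltnS /rs size_filter => h.
have := count_predC (fun x : 'F_p => x != 0) (enum 'F_p).
rewrite -cardE card_Fp //.
have -> : count (predC (fun x : 'F_p => x != 0)) (enum 'F_p) = count (pred1 0) (enum 'F_p).
  by apply: eq_count => x /=; case: eqP.
rewrite count_uniq_mem ?enum_uniq // mem_enum; move: h pk k0 (prime_gt0 pp).
move: (count _ _) => c; rewrite inE /=; lia.
Qed.

(** Thue's argument: with K^2 < p < (K + 1)^2, two of the (K + 1)^2 values x + s y agree modulo p.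
    The difference has norm divisible by p, positive and at most 2 K^2 < 2p. *)
Lemma two_squares_prime (p : nat) : prime p -> (p %% 4 = 1)%N ->
  exists u v : int, u ^+ 2 + v ^+ 2 = p%:Z.
Proof.
move=> pp p1; have [s hs] := sqrt_minus1 pp p1.
have [K [K1 K2]] : exists K, (K ^ 2 < p /\ p < K.+1 ^ 2)%N.
  have [N hN] : exists N, (p < N.+1 ^ 2)%N by exists p; rewrite -mulnn; nia.
  elim: N hN => [|N IH] hN; first by have := prime_gt1 pp; rewrite exp1n in hN; lia.
  case: (ltngtP p (N.+1 ^ 2)) => h; [exact: IH|by exists N.+1|exfalso].
  have : (N.+1 %| p)%N by rewrite h expnS dvdn_mulr.
  have p2 := prime_gt1 pp; move/primeP: (pp) => [_ H] /H /orP[] /eqP e; rewrite e -mulnn in h; move: h p2; clear; nia.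
pose g (x : 'I_K.+1 * 'I_K.+1) : 'F_p := x.1%:R + s * x.2%:R.
have : ~~ injectiveb g.
  apply/negP => /injectiveP gi; have := leq_card _ gi.
  by rewrite card_prod !card_ord Fp_cast // leqNgt mulnn K2.
move=> /injectivePn[x [y xy e]].
pose a : int := x.1%:Z - y.1%:Z; pose b : int := x.2%:Z - y.2%:Z.
exists a, b.
have ab : (p %| a ^+ 2 + b ^+ 2)%Z.
  rewrite dvdz_Fp // rmorphD !rmorphXn /= !intrB -!pmulrn.
  have -> : x.1%:R - y.1%:R = - (s * (x.2%:R - y.2%:R)) :> 'F_p.
    have : x.1%:R + s * x.2%:R - (y.1%:R + s * y.2%:R) = 0 :> 'F_p by rewrite -/(g x) e subrr.
    by move=> h; apply/eqP; rewrite -subr_eq0 -h; apply/eqP; ring.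
  by rewrite sqrrN exprMn hs mulN1r addNr.
have lt (c : int) (i j : 'I_K.+1) : c = i%:Z - j%:Z -> c ^+ 2 <= (K ^ 2)%N%:Z.
  move=> ->; have := ltn_ord i; have := ltn_ord j; rewrite -mulnn PoszM.
  move: (i : nat) (j : nat) => m n; rewrite !ltnS => h1 h2; nia.
have ha := lt a _ _ erefl; have hb := lt b _ _ erefl.
have pos : 0 < a ^+ 2 + b ^+ 2.
  rewrite lt_neqAle eq_sym addr_ge0 ?sqr_ge0 // andbT paddr_eq0 ?sqr_ge0 // !sqrf_eq0 !subr_eq0 !eqz_nat.
  by apply: contra xy => /andP[h1 h2]; rewrite -pair_eqE /= -!val_eqE /= h1 h2.
case/dvdzP: ab pos => c e2; rewrite e2 pmulr_lgt0 ?ltz_nat ?prime_gt0 // => c0.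
have pR : 0 < p%:Z by rewrite ltz_nat prime_gt0.
have hc : c * p%:Z < 2 * p%:Z.
  rewrite -e2 mulr_natl mulr2n; apply: le_lt_trans (lerD ha hb) _.
  by rewrite -!PoszD ltz_nat; move: K1; move: (K ^ 2)%N => m; clear; lia.
have -> : c = 1 by move: hc; rewrite (ltr_pM2r pR); move: c0; clear; lia.
by rewrite mul1r.
Qed.

Definition fchi (m : nat) : int := \sum_(d <- divisors m) chi4 d.

Lemma chi4M (a b : nat) : chi4 (a * b) = chi4 a * chi4 b.
Proof.
rewrite /chi4 -modnMm.
have : [\/ a %% 4 = 0, a %% 4 = 1, a %% 4 = 2 | a %% 4 = 3]%N.
  by have := ltn_pmod a (isT : 0 < 4)%N; case: (a %% 4)%N => [|[|[|[|]]]] // _; constructor.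
have : [\/ b %% 4 = 0, b %% 4 = 1, b %% 4 = 2 | b %% 4 = 3]%N.
  by have := ltn_pmod b (isT : 0 < 4)%N; case: (b %% 4)%N => [|[|[|[|]]]] // _; constructor.
by case=> -> [] ->.
Qed.

Definition fq (p k : nat) : int := if (p %| k)%N then fchi (k %/ p) else 0.

(** The divisor side of the recursions [r_split] and [r_inert]: the divisors of p k that do not
    divide k are the p e with e dividing k and p e not dividing k. *)
Lemma fchi_split (p k : nat) : prime p -> (0 < k)%N ->
  fchi (p * k) = (1 + chi4 p) * fchi k - chi4 p * fq p k.
Proof.
move=> pp k0; have p0 := prime_gt0 pp; have pk0 : (0 < p * k)%N by rewrite muln_gt0 p0.
have hf : \sum_(e <- divisors k | (p * e %| k)%N) chi4 e = fq p k.
  rewrite /fq; case: ifP => pk.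
    have kp0 : (0 < k %/ p)%N by rewrite divn_gt0 // dvdn_leq.
    rewrite -big_filter /fchi; apply: perm_big; apply: uniq_perm.
    - by rewrite filter_uniq ?divisors_uniq.
    - exact: divisors_uniq.
    move=> e; rewrite mem_filter -(dvdn_divisors e k0) -(dvdn_divisors e kp0) dvdn_divRL // mulnC.
    by apply/andP/idP => [[]//|h]; split=> //; apply: dvdn_trans h; rewrite dvdn_mulr.
  rewrite big_seq_cond big1 // => e /andP[_ /(dvdn_trans _) h].
  by move/negP: pk => []; apply: h; rewrite dvdn_mulr.
rewrite {1}/fchi (bigID (fun d => d %| k)%N) /=.
have -> : \sum_(d <- divisors (p * k) | (d %| k)%N) chi4 d = fchi k.
  rewrite -big_filter; apply: perm_big; apply: uniq_perm.
  - by rewrite filter_uniq ?divisors_uniq.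
  - exact: divisors_uniq.
  move=> d; rewrite mem_filter -!dvdn_divisors //; apply/andP/idP => [[]//|h]; split=> //.
  by rewrite dvdn_mull.
have -> : \sum_(d <- divisors (p * k) | ~~ (d %| k)%N) chi4 d =
    \sum_(e <- divisors k | ~~ (p * e %| k)%N) chi4 p * chi4 e.
  rewrite -big_filter -[RHS]big_filter.
  under [RHS]eq_bigr => e _ do rewrite -chi4M.
  rewrite -(big_map (fun e => p * e)%N xpredT (fun d => chi4 d)); apply: perm_big; apply: uniq_perm.
  - by rewrite filter_uniq ?divisors_uniq.
  - rewrite map_inj_uniq ?filter_uniq ?divisors_uniq // => a b /eqP; rewrite eqn_pmul2l // => /eqP.
    by [].
  move=> d; rewrite mem_filter -dvdn_divisors //; apply/andP/mapP => [[h1 h2]|[e]].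
    have pd : (p %| d)%N.
      apply/negPn/negP => npd; move/negP: h1; apply; rewrite -(Gauss_dvdr k (_ : coprime d p)) //.
      by rewrite coprime_sym prime_coprime.
    exists (d %/ p)%N; last by rewrite mulnC divnK.
    rewrite mem_filter mulnC divnK // h1 -dvdn_divisors //=.
    by rewrite -(dvdn_pmul2l p0) mulnC divnK.
  rewrite mem_filter -dvdn_divisors // => /andP[h1 h2] ->; split=> //.
  by rewrite dvdn_pmul2l.
rewrite -mulr_sumr.
have h : fchi k = fq p k + \sum_(e <- divisors k | ~~ (p * e %| k)%N) chi4 e.
  by rewrite /fchi (bigID (fun e => p * e %| k)%N) /= hf.
have -> : \sum_(e <- divisors k | ~~ (p * e %| k)%N) chi4 e = fchi k - fq p k by rewrite h addrC addKr.
by move: (fchi k) (fq p k) (chi4 p) => x y z; ring.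
Qed.

(** Both sides are 4 at m = 1, and [fchi_split] matches [r_split] at primes 1 modulo 4 and [r_inert]
    at primes 3 modulo 4. *)
Theorem jacobi_two_squares (m : nat) : odd m -> (size (pts m))%:Z = 4 * fchi m.
Proof.
elim/ltn_ind: m => m IH om.
have [m1|m1] := leqP m 1.
  have -> : m = 1%N by case: m om m1 {IH} => [|[]].
  by rewrite /fchi (_ : divisors 1 = [:: 1%N]) // big_seq1.
pose p := pdiv m; have pp : prime p by apply: pdiv_prime.
pose k := (m %/ p)%N; have mE : (m = p * k)%N by rewrite mulnC divnK // pdiv_dvd.
have [op ok] : odd p /\ odd k by move: om; rewrite mE oddM => /andP[].
have k0 : (0 < k)%N by apply: odd_gt0.
have km : (k < m)%N by rewrite mE ltn_Pmull ?prime_gt1.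
have rf : (rq p k)%:Z = 4 * fq p k.
  rewrite /rq /fq; case: ifP => pk; last by rewrite mulr0.
  apply: IH; last by apply: dvdn_odd ok; rewrite dvdn_div.
  by apply: leq_ltn_trans km; rewrite leq_div.
rewrite mE fchi_split //.
have : (p %% 4 = 1 \/ p %% 4 = 3)%N by move: op; clear; lia.
case=> p4.
  have [u [v uv]] := two_squares_prime pp p4.
  have h := r_split k pp op uv.
  have -> : (size (pts (p * k)))%:Z = 2 * (size (pts k))%:Z - (rq p k)%:Z.
    by apply/eqP; rewrite -subr_eq opprK -PoszD h PoszM.
  by rewrite rf IH // /chi4 p4 /=; ring.
by rewrite r_inert // rf /chi4 p4 /=; ring.
Qed.

(** * From two squares to four triangular numbers *)

Definition opairs (m : nat) : seq (nat * nat) :=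
  [seq z <- [seq (x, y) | x <- iota 0 (2 * m).+1, y <- iota 0 (2 * m).+1] |
     [&& odd z.1, odd z.2 & z.1 ^ 2 + z.2 ^ 2 == 2 * m]%N].

Lemma uniq_opairs m : uniq (opairs m).
Proof. by rewrite filter_uniq // allpairs_uniq ?iota_uniq // => -[? ?] [? ?] _ _ [-> ->]. Qed.

Lemma mem_opairs m z : (z \in opairs m) = [&& odd z.1, odd z.2 & z.1 ^ 2 + z.2 ^ 2 == 2 * m]%N.
Proof.
rewrite mem_filter; apply/andP/idP => [[]//|h]; split=> //; case/and3P: h => _ _ /eqP e.
apply/allpairsP; exists z; split; last by case: (z).
  by rewrite mem_iota add0n ltnS -e; apply: leq_trans (leq_addr _ _); case: (z.1) => // a; rewrite leq_pmulr.
by rewrite mem_iota add0n ltnS -e; apply: leq_trans (leq_addl _ _); case: (z.2) => // a; rewrite leq_pmulr.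
Qed.

(** Multiplication by 1 + i is a bijection from norm m onto norm 2m. *)
Lemma pts_double m : size (pts (2 * m)) = size (pts m).
Proof.
rewrite -(count_predT (pts (2 * m))); apply: (count_pts (f := fun w => (w.1 - w.2, w.1 + w.2))).
- move=> [a b] [c d] [h1 h2]; congr (_, _); lia.
- by move=> w ew; split=> //; rewrite PoszM -ew /nz /=; ring.
move=> [a b] e _; rewrite /nz /= PoszM in e.
have ev : (2 %| a + b)%Z.
  have : (2 %| (a + b) ^+ 2)%Z.
    have -> : (a + b) ^+ 2 = 2 * (m%:Z + a * b) by rewrite mulrDr -e; ring.
    by rewrite dvdz_mulr.
  exact: dvdz_sqr_prime.
case/dvdzP: ev => c hc; exists (c, b - c); rewrite /nz /=; last by congr (_, _); lia.
have aE : a = c * 2 - b by lia.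
rewrite aE in e; apply: (mulfI (_ : 2 != 0 :> int)) => //; rewrite -e; ring.
Qed.

(** As 2m is 2 modulo 4, both coordinates are odd, hence nonzero, and the four choices of signs are
    distinct. *)
Lemma pts_signs m : odd m -> size (pts (2 * m)) = (4 * size (opairs m))%N.
Proof.
move=> om; pose sgs : seq (int * int) := [:: (1, 1); (1, -1); (-1, 1); (-1, -1)].
rewrite -[4%N]/(size sgs) -(size_allpairs (fun s (z : nat * nat) => (s.1 * z.1%:Z, s.2 * z.2%:Z))).
apply: perm_size; apply: uniq_perm; first exact: uniq_pts.
  apply: allpairs_uniq; [by []|exact: uniq_opairs|].
  move=> [[s1 t1] [x1 y1]] [[s2 t2] [x2 y2]] /allpairsP[[u v] [hu hv [eu ev]]].
  move=> /allpairsP[[u' v'] [hu' hv' [eu' ev']]] [h1 h2].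
  rewrite -eu -eu' -ev -ev' in hu hu' hv hv' *; move: hu hu' hv hv'.
  rewrite /= !mem_opairs => H1 H2 /and3P[/odd_gt0 p1 /odd_gt0 p2 _] /and3P[/odd_gt0 p3 /odd_gt0 p4 _].
  rewrite /= in p1 p2 p3 p4; move: h1 h2 => /= h1 h2.
  suff [-> [-> [-> ->]]] : s1 = s2 /\ t1 = t2 /\ x1 = x2 /\ y1 = y2 by [].
  move: H1 H2; rewrite !inE -!pair_eqE /= => H1 H2.
  case/or4P: H1 => /andP[/eqP e1 /eqP e2]; case/or4P: H2 => /andP[/eqP e3 /eqP e4];
    rewrite e1 e2 e3 e4 in h1 h2 *; repeat split; lia.
move=> [a b]; rewrite mem_pts; apply/eqP/allpairsP => [e|[[[s t] [x y]] [hs]]]; last first.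
  rewrite /nz /= mem_opairs => /and3P[_ _ /eqP e] [-> ->]; rewrite -e PoszD -!mulnn !PoszM.
  by move: hs; rewrite !inE -!pair_eqE /= => /or4P[] /andP[/eqP -> /eqP ->]; ring.
rewrite /nz /= in e.
have eN : (`|a| ^ 2 + `|b| ^ 2 = 2 * m)%N.
  by apply/eqP; rewrite -eqz_nat PoszD -!mulnn !PoszM -!expr2 !abszE !real_normK ?num_real // e PoszM.
exists ((Num.sg a, Num.sg b), (absz a, absz b)).
have par : odd `|a| /\ odd `|b|.
  move: eN om; rewrite -!mulnn; move: `|a|%N `|b|%N => x y.
  rewrite -(odd_double_half x) -(odd_double_half y) -!muln2.
  by case: (odd x); case: (odd y); move: (x./2) (y./2) => i j; rewrite ?add0n ?add1n => h om; split=> //; nia.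
case: par => oa ob; split=> /=.
- have a0 : a != 0 by apply: contraTneq oa => ->.
  have b0 : b != 0 by apply: contraTneq ob => ->.
  by move: a0 b0; case: (sgrP a) => // _ _; case: (sgrP b).
- by rewrite mem_opairs /= oa ob eN eqxx.
by congr (_, _); rewrite abszE -numEsg.
Qed.

Lemma opairs_fchi m : odd m -> (size (opairs m))%:Z = fchi m.
Proof.
move=> om; apply: (mulfI (_ : 4 != 0 :> int)) => //.
by rewrite -jacobi_two_squares // -pts_double pts_signs // PoszM.
Qed.

Definition tri (k : nat) : nat := (k * k.+1)./2.

Lemma tri2 k : (2 * tri k = k * k.+1)%N.
Proof. by rewrite mul2n /tri halfK oddM /= andbN subn0. Qed.

(** An integer stand-in for the logarithm: it bounds harmonic sums. *)
Definition ell (q : nat) : nat := (trunc_log 2 q).+1.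

Lemma dirichlet_conv (M : nat) :
  \sum_(x <- quads M) chi4 (qd x) * chi4 (qe x) =
  \sum_(u <- iota 0 (2 * M) | odd u) fchi u * fchi (2 * M - u).
Proof.
pose h (u : nat) (z : nat * nat) : nat * nat * nat * nat := (z.1, u %/ z.1, z.2, (2 * M - u) %/ z.2)%N.
pose us := [seq u <- iota 0 (2 * M) | odd u].
pose ds u := [seq (d, e) | d <- divisors u, e <- divisors (2 * M - u)].
rewrite (perm_big [seq h u z | u <- us, z <- ds u]) /=.
  rewrite big_allpairs_dep big_filter; apply: eq_bigr => u _.
  rewrite big_allpairs /fchi mulr_suml; apply: eq_bigr => d _.
  by rewrite mulr_sumr.
have usP u : u \in us -> [/\ odd u, (0 < u)%N & (u < 2 * M)%N].
  by rewrite mem_filter mem_iota => /and3P[o _ lt]; split=> //; apply: odd_gt0.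
have dsP u z : u \in us -> z \in ds u -> (z.1 %| u)%N /\ (z.2 %| 2 * M - u)%N.
  move=> /usP[o u0 lt] /allpairsP[[d e] [/= hd he ->]] /=.
  by move: hd he; rewrite -!dvdn_divisors ?subn_gt0.
apply: uniq_perm; first exact: quads_uniq.
  apply: allpairs_uniq_dep => [|u _|]; first by rewrite filter_uniq ?iota_uniq.
    by rewrite allpairs_uniq ?divisors_uniq // => -[? ?] [? ?] _ _ [-> ->].
  move=> [u z] [u' z'] /allpairsPdep[a [b [ha hb]]] e1 /allpairsPdep[a' [b' [ha' hb']]] e2.
  move=> /= [f1 f2 f3 f4].
  have ez : z = z' by apply/eqP; rewrite -pair_eqE /= f1 f3 !eqxx.
  have [ea eb] : u = a /\ z = b by case: e1.
  have [ea' eb'] : u' = a' /\ z' = b' by case: e2.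
  rewrite -ea -eb in ha hb; rewrite -ea' -eb' in ha' hb'.
  have [d1 _] := dsP _ _ ha hb; have [d2 _] := dsP _ _ ha' hb'.
  have eu : u = u' by rewrite -[LHS](divnK d1) -[RHS](divnK d2) f2 f1.
  by rewrite eu ez.
move=> x; rewrite mem_quads; apply/idP/allpairsPdep => [|[u [z [hu hz ->]]]].
  case: x => [[[d k] e] l] /and5P[od ok oe ol /eqP E].
  exists (d * k)%N, (d, e); have el0 : (0 < e * l)%N by rewrite muln_gt0 !odd_gt0.
  have dk0 : (0 < d * k)%N by rewrite muln_gt0 !odd_gt0.
  have E2 : (2 * M - d * k = e * l)%N by rewrite -E addKn.
  split; first by rewrite mem_filter oddM od ok mem_iota /= -E -[X in (X < _)%N]addn0 ltn_add2l.
    apply/allpairsP; exists (d, e); split=> //=; first by rewrite -dvdn_divisors // dvdn_mulr.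
    by rewrite E2 -dvdn_divisors // dvdn_mulr.
  by rewrite /h /= E2 !mulKn ?odd_gt0.
have [o u0 lt] := usP _ hu; have [d1 d2] := dsP _ _ hu hz.
have o2 : odd (2 * M - u) by rewrite oddB ?(ltnW lt) // oddM /= o.
have e1 : (z.1 * (u %/ z.1) = u)%N by rewrite mulnC divnK.
have e2 : (z.2 * ((2 * M - u) %/ z.2) = 2 * M - u)%N by rewrite mulnC divnK.
have := o; rewrite -{1}e1 oddM => /andP[p1 p2]; have := o2; rewrite -{1}e2 oddM => /andP[p3 p4].
by rewrite /quad_ok /h p1 p2 p3 p4 e1 e2 subnKC ?(ltnW lt) ?eqxx.
Qed.

Lemma opairs_mod3 u : (u %% 4 = 3)%N -> opairs u = [::].
Proof.
move=> u3; apply/eqP; rewrite -size_eq0 -leqn0 leqNgt; apply/negP => s0.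
have := mem_nth (0%N, 0%N) s0; rewrite mem_opairs => /and3P[]; move: (nth _ _ _) => [x y] /= ox oy /eqP.
rewrite -(odd_double_half x) -(odd_double_half y) ox oy !add1n -!muln2; move: (x./2) (y./2) => a b.
have e c : ((c * 2).+1 ^ 2 = 4 * (c * c.+1) + 1)%N by rewrite -mulnn -addn1 -[c.+1]addn1; ring.
rewrite !e -!tri2 => h; move: u3 h; clear; lia.
Qed.

(** Since (2a + 1)^2 = 8 tri a + 1, the equation reads (2a + 1)^2 + (2b + 1)^2 = 2 (4m + 1). The
    hypothesis on [T] ensures that the truncation misses no solution. *)
Lemma size_tri_pairs (m T : nat) : (2 * m < T ^ 2)%N ->
  (\sum_(0 <= a < T) \sum_(0 <= b < T) (tri a + tri b == m) = size (opairs (4 * m + 1)))%N.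
Proof.
move=> mT; pose s := [seq z <- [seq (a, b) | a <- iota 0 T, b <- iota 0 T] | (tri z.1 + tri z.2 == m)%N].
have -> : (\sum_(0 <= a < T) \sum_(0 <= b < T) (tri a + tri b == m) = size s)%N.
  rewrite size_filter -sum1_count [RHS]big_mkcond [RHS]big_allpairs /index_iota subn0.
  by apply: eq_bigr => a _; apply: eq_bigr => b _ /=; case: eqP.
rewrite -(size_map (fun z : nat * nat => (z.1.*2.+1, z.2.*2.+1)) s); apply: perm_size.
have sq a : (a.*2.+1 ^ 2 = 8 * tri a + 1)%N.
  by have t := tri2 a; rewrite -muln2 -mulnn; move: t; move: (tri a) => u; clear; nia.
apply: uniq_perm.
- rewrite map_inj_uniq; last by move=> [a b] [c d] [/double_inj -> /double_inj ->].
  by rewrite filter_uniq // allpairs_uniq ?iota_uniq // => -[? ?] [? ?] _ _ [-> ->].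
- exact: uniq_opairs.
move=> [x y]; rewrite mem_opairs /=; apply/mapP/and3P => [[[a b]]|[ox oy /eqP e]].
  rewrite mem_filter /= => /andP[/eqP e _] [-> ->]; rewrite /= !odd_double !sq; split=> //.
  by rewrite -e; apply/eqP; ring.
have xE : x = (x./2).*2.+1 by rewrite -[LHS]odd_double_half ox.
have yE : y = (y./2).*2.+1 by rewrite -[LHS]odd_double_half oy.
exists (x./2, y./2); last by rewrite /= -xE -yE.
rewrite xE yE !sq in e; have e' : (tri x./2 + tri y./2 = m)%N by move: e; clear; lia.
have lt c : (tri c <= m)%N -> (c < T)%N.
  move=> h; rewrite ltnNge; apply/negP => Tc; have := tri2 c; rewrite -mulnn in mT.
  by have := leq_mul Tc (leqW Tc); move: mT h; clear; nia.
rewrite mem_filter /= e' eqxx; apply/allpairsP; exists (x./2, y./2); split=> //=.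
  by rewrite mem_iota lt // -e' leq_addr.
by rewrite mem_iota lt // -e' leq_addl.
Qed.

(** In the convolution for M = 2n + 1 the odd u = 3 modulo 4 vanish, and for u = 4m + 1 the other
    argument is 4 (n - m) + 1: the convolution splits n into two sums of two triangular numbers. *)
Lemma four_triangulars (n T : nat) : (2 * n < T ^ 2)%N ->
  (\sum_(0 <= a < T) \sum_(0 <= b < T) \sum_(0 <= c < T) \sum_(0 <= d < T)
     (tri a + tri b + (tri c + tri d) == n) = \sum_(d <- divisors (2 * n + 1)) d)%N.
Proof.
move=> nT; have oM : odd (2 * n + 1) by rewrite addn1 /= oddM.
apply/eqP; rewrite -eqz_nat -(dirichlet_quads oM) dirichlet_conv; apply/eqP.
pose C m := (\sum_(0 <= a < T) \sum_(0 <= b < T) (tri a + tri b == m))%N.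
pose G u : int := fchi u * fchi (2 * (2 * n + 1) - u).
have -> : \sum_(u <- iota 0 (2 * (2 * n + 1)) | odd u) G u = \sum_(0 <= m < n.+1) G (4 * m + 1)%N.
  have G3 u : (u %% 4 = 3)%N -> G u = 0.
    by move=> u3; rewrite /G -opairs_fchi ?opairs_mod3 ?mul0r //; move: u3; clear; lia.
  rewrite -[X in iota 0 X]subn0 -/(index_iota 0 _).
  have K j : \sum_(0 <= u < 4 * j | odd u) G u = \sum_(0 <= m < j) G (4 * m + 1)%N.
    elim: j => [|j IH]; first by rewrite muln0 !big_geq.
    rewrite mulnS addnC (addnS _ 3) (addnS _ 2) (addnS _ 1) (addnS _ 0) addn0 big_mkcond !big_nat_recr //= -big_mkcond /= IH.
    by rewrite !oddM /= addn1 (G3 (4 * j).+3) ?addr0 //; clear; lia.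
  rewrite (_ : 2 * (2 * n + 1) = (4 * n).+2)%N; last by clear; lia.
  by rewrite big_mkcond !big_nat_recr //= -big_mkcond K /= !oddM /= addr0 addn1.
have CE m : (m <= n)%N -> (C m)%:Z = fchi (4 * m + 1).
  move=> mn; rewrite /C size_tri_pairs ?opairs_fchi //; first by rewrite addn1 /= oddM.
  by apply: leq_ltn_trans nT; rewrite leq_mul2l mn orbT.
rewrite (eq_big_nat _ _ (F2 := fun m => (C m * C (n - m))%N%:Z)); last first.
  move=> m /andP[_ mn]; rewrite PoszM !CE ?leq_subr // /G; congr (_ * fchi _); move: mn; clear; lia.
rewrite -(big_morph Posz PoszD (erefl 0%:Z)); congr Posz.
transitivity (\sum_(0 <= a < T) \sum_(0 <= b < T) \sum_(0 <= c < T) \sum_(0 <= d < T)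
   \sum_(0 <= m < n.+1) (tri a + tri b == m) * (tri c + tri d == n - m))%N.
  apply: eq_bigr => a _; apply: eq_bigr => b _; apply: eq_bigr => c _; apply: eq_bigr => d _.
  case: (leqP (tri a + tri b) n) => h.
    rewrite big_mkord (bigD1 (Ordinal (h : tri a + tri b < n.+1)%N)) //= eqxx mul1n big1 ?addn0.
      by congr nat_of_bool; apply/eqP/eqP; move: h; clear; lia.
    by move=> i ne; case: eqP => // e; case/eqP: ne; apply: val_inj.
  rewrite big_nat big1 => [|m /andP[_ mn]]; last by case: eqP => // e; move: h; rewrite e ltnNge -ltnS mn.
  by apply/eqP; rewrite eqb0; apply/eqP; move: h; clear; lia.
under eq_bigr => a _ do under eq_bigr => b _ do under eq_bigr => c _ do rewrite exchange_big /=.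
under eq_bigr => a _ do under eq_bigr => b _ do rewrite exchange_big /=.
under eq_bigr => a _ do rewrite exchange_big /=.
rewrite exchange_big /=; apply: eq_bigr => m _; rewrite /C big_distrl /=; apply: eq_bigr => a _.
rewrite big_distrl /=; apply: eq_bigr => b _; rewrite big_distrr /=; apply: eq_bigr => c _.
by rewrite big_distrr.
Qed.

(** * The divisor bound *)

Lemma leq_pow (a b k : nat) : (a <= b)%N -> (a ^ k <= b ^ k)%N.
Proof. by move=> h; case: k => // k; rewrite leq_exp2r. Qed.

Lemma pow_le_exp2 (k v : nat) : (0 < k)%N -> (v.+1 ^ k <= k ^ k * 2 ^ v)%N.
Proof.
move=> k0; have h : (v.+1 <= k * 2 ^ (v %/ k))%N.
  apply: (@leq_trans (k * (v %/ k).+1)); first by rewrite mulnC ltn_ceil.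
  by rewrite leq_mul2l ltn_expl ?orbT.
apply: leq_trans (leq_pow k h) _; rewrite expnMn leq_mul2l -expnM leq_exp2l // leq_trunc_div orbT.
by [].
Qed.

Lemma tau_part (p m : nat) : prime p -> (0 < m)%N ->
  (tau m <= (logn p m).+1 * tau ((m`_p^')%N))%N.
Proof.
move=> pp m0; have q0 : (0 < (m`_p^')%N)%N by apply: part_gt0.
rewrite -[(logn p m).+1](size_iota 0) -(size_allpairs (fun i d => p ^ i * d)%N).
apply: uniq_leq_size; first exact: divisors_uniq.
move=> d; rewrite -dvdn_divisors // => dm; have d0 := dvdn_gt0 m0 dm.
apply/allpairsP; exists (logn p d, (d`_p^')%N); split.
- by rewrite mem_iota /= add0n ltnS dvdn_leq_log.
- by rewrite -dvdn_divisors // partn_dvd.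
by rewrite -p_part partnC.
Qed.

(** A prime p >= 2^k with exponent v contributes (v + 1)^k <= 2^(kv) <= p^v. *)
Lemma tau_big_primes (k m : nat) : (0 < k)%N -> (0 < m)%N ->
  (forall p, p \in primes m -> (2 ^ k <= p)%N) -> (tau m ^ k <= m)%N.
Proof.
move=> k0; elim/ltn_ind: m => m IH m0 hp.
have [m1|m1] := leqP m 1.
  have -> : m = 1%N by apply/eqP; rewrite eqn_leq m1.
  by rewrite (_ : divisors 1 = [:: 1%N]) // exp1n.
pose p := pdiv m; have pp : prime p by apply: pdiv_prime.
have pm : p \in primes m by rewrite mem_primes pp m0 pdiv_dvd.
have q0 : (0 < (m`_p^')%N)%N by apply: part_gt0.
have mE : (m = p ^ logn p m * (m`_p^')%N)%N by rewrite -p_part partnC.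
have v0 : (0 < logn p m)%N by rewrite logn_gt0.
apply: leq_trans (leq_pow k (tau_part pp m0)) _; rewrite expnMn {3}mE; apply: leq_mul.
  apply: (@leq_trans ((2 ^ k) ^ logn p m)); last by apply: leq_pow; apply: hp.
  by rewrite -expnM mulnC expnM; apply: leq_pow; rewrite ltn_expl.
apply: IH => //.
  by rewrite {2}mE ltn_Pmull // (leq_trans (prime_gt1 pp)) // -{1}[p]expn1 leq_exp2l ?prime_gt1.
move=> r; rewrite primes_part mem_filter => /andP[_]; exact: hp.
Qed.

(** Lowering the threshold 2^k of [tau_big_primes] past one prime costs a factor [k ^ k], by
    [pow_le_exp2], and there are finitely many primes below it. *)
Lemma tau_pow_le (k : nat) : (0 < k)%N -> exists C : nat, forall m : nat, (0 < m)%N -> (tau m ^ k <= C * m)%N.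
Proof.
move=> k0.
have H j : (j <= 2 ^ k)%N -> exists C : nat, (0 < C)%N /\ forall m, (0 < m)%N ->
    (forall p, p \in primes m -> (2 ^ k - j <= p)%N) -> (tau m ^ k <= C * m)%N.
  elim: j => [|j IH] jk.
    by exists 1%N; split=> // m m0 hp; rewrite mul1n tau_big_primes // => p /hp; rewrite subn0.
  have [C [C0 HC]] := IH (ltnW jk).
  exists (k ^ k * C)%N; split; first by rewrite muln_gt0 expn_gt0 k0.
  move=> m m0 hp; pose q := (2 ^ k - j.+1)%N.
  have [pq|npq] := boolP (prime q); last first.
    apply: leq_trans (HC m m0 _) _; last by rewrite leq_mul2r leq_pmull ?orbT // expn_gt0 k0.
    move=> p pm; have := hp p pm; rewrite leq_eqVlt => /orP[/eqP e|]; last by rewrite /q; move: jk; clear; lia.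
    by move: pm npq; rewrite mem_primes /q e => /and3P[->].
  have q0 : (0 < (m`_q^')%N)%N by apply: part_gt0.
  have mE : (m = q ^ logn q m * (m`_q^')%N)%N by rewrite -p_part partnC.
  apply: leq_trans (leq_pow k (tau_part pq m0)) _; rewrite expnMn {3}mE.
  rewrite (_ : k ^ k * C * (q ^ logn q m * (m`_q^')%N) = (k ^ k * q ^ logn q m) * (C * (m`_q^')%N))%N; last by ring.
  apply: leq_mul.
    apply: leq_trans (pow_le_exp2 _ k0) _; rewrite leq_mul2l leq_pow ?orbT ?prime_gt1 //.
  apply: HC => // p; rewrite primes_part mem_filter => /andP[pq' pm].
  have := hp p pm; rewrite leq_eqVlt => /orP[/eqP e|]; last by move: jk; clear; lia.
  by move: pq'; rewrite !inE -e eqxx.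
have [C [_ HC]] := H _ (leqnn (2 ^ k)%N).
by exists C => m m0; apply: HC => // p _; rewrite subnn.
Qed.

From mathcomp Require Import all_classical all_reals all_analysis complex.
Import Order.TTheory GRing.Theory Num.Theory.
Import numFieldNormedType.Exports.
Local Open Scope classical_set_scope.
Local Open Scope ring_scope.
Local Open Scope complex_scope.

(** * Gauss sums and arcs *)

Section Characters.
Context (R : realType).

Definition expi (t : R) : R[i] := (cos (2 * pi * t) +i* sin (2 * pi * t))%C.

Lemma expiD s t : expi (s + t) = expi s * expi t.
Proof.
rewrite /expi mulrDr cosD sinD; apply/eqP; rewrite eq_complex /=.
by rewrite eqxx /= addrC eqxx.
Qed.

Lemma norm_expi t : `|expi t| = 1.
Proof.
by rewrite normc_def /= cos2Dsin2 sqrtr1.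
Qed.

Lemma expi0 : expi 0 = 1.
Proof. by rewrite /expi mulr0 cos0 sin0. Qed.

Lemma expi1 : expi 1 = 1.
Proof. by rewrite /expi mulr1 mulr_natl cos2pi sin2pi. Qed.

Lemma expi_nat (n : nat) : expi n%:R = 1.
Proof. by elim: n => [|n IH]; rewrite ?expi0 // -natr1 expiD IH expi1 mulr1. Qed.

Lemma expiX t (n : nat) : expi (n%:R * t) = expi t ^+ n.
Proof.
elim: n => [|n IH]; first by rewrite mul0r expi0.
by rewrite -natr1 mulrDl mul1r expiD IH exprSr.
Qed.

(* Doubling t until it lands in [1/4, 1/2], where the real part is <= 0. *)
Lemma norm_1expi (t : R) : 0 < t <= 2^-1 -> (2 * t)%:C <= `|1 - expi t|.
Proof.
have base s : 4^-1 <= s <= 2^-1 -> 1 <= `|1 - expi s|.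
  move=> /andP[s1 s2]; apply: le_trans (normc_ge_Re _).
  rewrite -[1]/(1%:C) lecR /=; apply: le_trans (ler_norm _).
  rewrite lerDl oppr_ge0 -[2 * pi * s](subrK (pi / 2)) cosDpihalf oppr_le0.
  have p0 := @pi_gt0 R.
  apply: sin_ge0_pi; apply/andP; split; nra.
move=> /andP[t0 t1].
have [n hn] : exists n : nat, 4^-1 <= 2 ^+ n * t.
  exists (Num.bound t^-1); apply: (@le_trans _ _ 1); first by lra.
  rewrite -ler_pdivrMr // mul1r; apply: ltW.
  apply: lt_trans (archi_boundP _) _; first by rewrite invr_ge0 ltW.
  by rewrite -natrX ltr_nat ltn_expl.
elim: n t t0 t1 hn => [|n IH] t t0 t1 hn.
  apply: le_trans (base t _); rewrite -?[1]/(1%:C) ?lecR; first by lra.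
  by rewrite t1 andbT -[t]mul1r.
case: (leP t 4^-1) => h2; last first.
  apply: le_trans (base t _); rewrite -?[1]/(1%:C) ?lecR; first by lra.
  by rewrite t1 ltW.
have := IH (2 * t) _ _ _; rewrite mulrA -exprSr => /(_ _ _ hn) IH'.
have {IH'} : (2 * (2 * t))%:C <= `|1 - expi (2 * t)| by apply: IH'; lra.
rewrite -[2 * t]/(2%:R * t) expiX -[1 - _](_ : (1 - expi t) * (1 + expi t) = _); last by ring.
rewrite normrM => h.
have h3 : `|1 + expi t| <= 2.
  by apply: le_trans (ler_normD _ _) _; rewrite normr1 norm_expi.
have : (2 * (2%:R * t))%:C <= `|1 - expi t| * 2.
  by apply: le_trans h _; apply: ler_wpM2l.
have -> : (2 * (2%:R * t))%:C = (2 * t)%:C * 2 :> R[i].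
  by rewrite mulrC [LHS]rmorphM /= rmorph_nat.
by rewrite ler_pM2r // ltr0n.
Qed.

End Characters.

(** * Additive characters modulo q and the Dirichlet kernel *)

Section BoxSums.
Context (R : realType).

Lemma harmonic_le (q : nat) :
  \sum_(1 <= h < q) (h%:R : R)^-1 <= (trunc_log 2 q).+1%:R.
Proof.
have H k : \sum_(1 <= h < 2 ^ k) (h%:R : R)^-1 <= k%:R.
  elim: k => [|k IH]; first by rewrite big_geq.
  have lek : (2 ^ k <= 2 ^ k.+1)%N by rewrite leq_exp2l.
  rewrite (big_cat_nat _ (n := 2 ^ k)) ?expn_gt0 //= -natr1; apply: lerD => //.
  rewrite big_nat; apply: (@le_trans _ _ (\sum_(2 ^ k <= h < 2 ^ k.+1) (2 ^ k)%:R^-1)).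
    rewrite [leRHS]big_nat; apply: ler_sum => h /andP[h1 _].
    have k0 : (0 < (2 ^ k)%:R :> R) by rewrite ltr0n expn_gt0.
    by rewrite lef_pV2 ?ler_nat // posrE ltr0n (leq_trans _ h1) // expn_gt0.
  rewrite sumr_const_nat expnS mul2n -addnn addnK -[_^-1]mulr1 -mulrnAr.
  by rewrite mulVf // pnatr_eq0 expn_eq0.
apply: le_trans (H _); rewrite [leRHS](big_cat_nat _ (n := maxn 1 q)) ?leq_maxl //=; last first.
  by rewrite geq_max expn_gt0 /=; apply: ltnW; apply: trunc_log_ltn.
have -> : \sum_(1 <= h < maxn 1 q) (h%:R : R)^-1 = \sum_(1 <= h < q) (h%:R : R)^-1.
  by case: q => [|q]; [rewrite !big_geq | rewrite (maxn_idPr _)].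
by rewrite lerDl sumr_ge0 // => i _; rewrite invr_ge0.
Qed.

Context (q : nat) (q1 : (1 < q)%N).

Definition ezq (x : 'Z_q) : R[i] := expi (x%:R / q%:R).

Let q0 : (0 < q%:R :> R). Proof. by rewrite ltr0n ltnW. Qed.

Lemma ezq_nat (n : nat) : ezq n%:R = expi (n%:R / q%:R).
Proof.
rewrite /ezq val_Zp_nat // {2}(divn_eq n q) natrD natrM mulrDl mulfK ?gt_eqF //.
by rewrite expiD expi_nat mul1r.
Qed.

Lemma ezqD x y : ezq (x + y) = ezq x * ezq y.
Proof.
by rewrite -[x]natr_Zp -[y]natr_Zp -natrD !ezq_nat -expiD -mulrDl -natrD.
Qed.

Lemma norm_ezq x : `|ezq x| = 1. Proof. exact: norm_expi. Qed.

Lemma ezq0 : ezq 0 = 1. Proof. by rewrite /ezq mul0r expi0. Qed.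

Lemma norm_1ezqN x : `|1 - ezq (- x)| = `|1 - ezq x|.
Proof.
rewrite (_ : 1 - ezq (- x) = - (ezq (- x) * (1 - ezq x))).
  by rewrite normrN normrM norm_ezq mul1r.
by rewrite mulrBr mulr1 -ezqD addNr ezq0 opprB.
Qed.

(** Only the smaller of h and q - h matters; adding both reciprocals replaces the minimum by an
    expression that sums directly to harmonic sums. *)
Lemma norm_1ezq (h : 'Z_q) : h != 0 ->
  2 <= `|1 - ezq h| * (q%:R / h%:R + q%:R / (q - h)%:R)%:C.
Proof.
have H (x : 'Z_q) : x != 0 -> (2 * x <= q)%N -> 2 <= `|1 - ezq x| * (q%:R / x%:R)%:C.
  move=> x0 xq; have x0' : (0 < x)%N by rewrite lt0n.
  have x0R : (0 < x%:R :> R) by rewrite ltr0n.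
  have hx : 0 < (x%:R / q%:R : R) <= 2^-1.
    apply/andP; split; first by rewrite divr_gt0.
    by rewrite ler_pdivrMr // mulrC ler_pdivlMr // -natrM ler_nat mulnC.
  have le1 := norm_1expi hx; rewrite -/(ezq x) in le1.
  have p0 : 0 <= (q%:R / x%:R)%:C :> R[i] by rewrite ler0c divr_ge0.
  apply: le_trans (ler_wpM2r p0 le1).
  rewrite -rmorphM /= (_ : _ * _ = 2%:R) ?rmorph_nat //.
  by field; rewrite !gt_eqF.
move=> h0; have h0' : (0 < h)%N by rewrite lt0n.
have hq : (h < q)%N := ltn_Zq q1 h.
case: (leqP (2 * h) q) => hh.
  by apply: le_trans (H h h0 hh) _; rewrite ler_wpM2l // lecR lerDl divr_ge0.
have hN : (- h : 'Z_q) = (q - h)%N :> nat.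
  have e : (q - h)%:R + h = 0.
    rewrite -[X in _ + X]natr_Zp -natrD (subnK (ltnW hq)).
    by apply/eqP; rewrite natr_Zp_eq0.
  have -> : - h = (q - h)%:R by apply: (addIr h); rewrite addNr e.
  by rewrite val_Zp_nat // modn_small // ltn_subrL h0' ltnW.
have hh' : (2 * (- h : 'Z_q) <= q)%N.
  by rewrite hN mulnBr leq_subLR (mul2n q) -addnn leq_add2r ltnW.
have nh0 : - h != 0 by rewrite oppr_eq0.
have {}H := H (- h) nh0 hh'; rewrite norm_1ezqN hN in H.
by apply: le_trans H _; rewrite ler_wpM2l // lecR lerDr divr_ge0.
Qed.

Lemma ezq_neq1 (h : 'Z_q) : h != 0 -> 1 - ezq h != 0.
Proof.
move=> /norm_1ezq; apply: contraTneq => ->.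
by rewrite normr0 mul0r lern0.
Qed.

Lemma ezq_orth (a : 'Z_q) : \sum_x ezq (a * x) = (q * (a == 0%R))%:R.
Proof.
case: eqP => [->|/eqP a0].
  by rewrite muln1 -[in RHS](card_Zq q1) -sum1_card natr_sum; apply: eq_bigr => x _; rewrite mul0r ezq0.
rewrite muln0; set S := LHS; have : (1 - ezq a) * S = 0.
  rewrite mulrBl mul1r mulr_sumr {1}/S (reindex_inj (addrI 1)) /=.
  by apply/eqP; rewrite subr_eq0; apply/eqP; apply: eq_bigr => x _; rewrite -ezqD mulrDr mulr1.
by move/eqP; rewrite mulf_eq0 (negPf (ezq_neq1 a0)) => /eqP.
Qed.

Definition dir (h : 'Z_q) (n : nat) : R[i] := \sum_(0 <= b < n) ezq (h * b%:R).

Lemma dir_le (n : nat) :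
  \sum_(h : 'Z_q | h != 0) `|dir h n| <= (2 * q%:R * (trunc_log 2 q).+1%:R)%:C.
Proof.
apply: (@le_trans _ _ (\sum_(h : 'Z_q | h != 0) (q%:R / h%:R + q%:R / (q - h)%:R)%:C)).
  apply: ler_sum => h h0; have n0 := ezq_neq1 h0.
  have p0 : 0 < `|1 - ezq h| by rewrite normr_gt0.
  rewrite -(ler_pM2l p0); apply: le_trans (norm_1ezq h0); rewrite -normrM.
  have -> : (1 - ezq h) * dir h n = 1 - ezq (h * n%:R).
    elim: n => [|n IH]; first by rewrite /dir big_geq // mulr0 mulr0 ezq0 subrr.
    rewrite /dir big_nat_recr //= mulrDr -/(dir h n) IH -natr1 mulrDr mulr1 ezqD; ring.
  by apply: le_trans (ler_normB _ _) _; rewrite normr1 norm_ezq.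
rewrite -(rmorph_sum (real_complex R)) lecR.
rewrite (eq_bigl (fun h : 'Z_q => (h : nat) != 0)) // big_mkcond /=.
rewrite (big_Zq q1 _ (fun h => if h != 0%N then q%:R / h%:R + q%:R / (q - h)%:R else 0)).
rewrite big_ltn ?(ltnW q1) //= add0r big_nat.
rewrite (eq_bigr (fun h => q%:R / h%:R + q%:R / (q - h)%:R)); last by move=> h /andP[]; case: h.
rewrite -big_nat big_split /= [X in _ + X]big_nat_rev /= add1n.
rewrite [X in _ + X](_ : _ = \sum_(1 <= h < q) q%:R / h%:R); last first.
  by apply: eq_big_nat => h /andP[h1 h2]; congr (_ / _%:R); lia.
rewrite -mulr_sumr -mulr2n -[_ *+ 2]mulr_natl mulrA.
by rewrite ler_wpM2l ?mulr_ge0 // harmonic_le.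
Qed.

End BoxSums.

Lemma big_odd (V : nmodType) (F : nat -> V) (n : nat) :
  \sum_(0 <= x < n.*2 | odd x) F x = \sum_(0 <= k < n) F k.*2.+1.
Proof.
elim: n => [|n IH]; first by rewrite !big_geq.
by rewrite doubleS big_mkcond !big_nat_recr //= -big_mkcond /= IH odd_double addr0.
Qed.

Section GaussSums.
Context (R : realType) (q : nat) (q0 : (0 < q)%N).

(** As 8 tri k + 1 = (2k + 1)^2, the phase a tri k / q is a square over 8q up to a constant. Modulo
    [q] the number 2 may fail to be a unit, so Gauss sums are taken modulo [8 * q] over one parity
    class. *)
Let m := (8 * q)%N.
Let m1 : (1 < m)%N. Proof. by rewrite /m; lia. Qed.
Local Notation psi := (@ezq R m).
Let psiD := @ezqD R m m1.

Lemma odd_Zp8 (k : nat) : odd (k%:R : 'Z_m) = odd k.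
Proof. by rewrite val_Zp_nat // odd_mod // oddM. Qed.

Lemma odd_unit8 (b : 'Z_m) : b \is a GRing.unit -> odd b.
Proof.
rewrite -{1}[b]natr_Zp unitZpE // /m; apply: contraTT => eb.
rewrite coprimeMl negb_and -[coprime 8 b]/(coprime (2 ^ 3) b) coprime_pexpl // coprime2n.
by rewrite (negPf eb).
Qed.

Lemma odd_D8 (x y : 'Z_m) : odd (x + y)%R = odd x (+) odd y.
Proof. by rewrite -{1}[x]natr_Zp -{1}[y]natr_Zp -natrD odd_Zp8 oddD. Qed.

Lemma odd_M8 (x y : 'Z_m) : odd (x * y)%R = odd x && odd y.
Proof. by rewrite -{1}[x]natr_Zp -{1}[y]natr_Zp -natrM odd_Zp8 oddM. Qed.

Definition gam (p : bool) (b : 'Z_m) : R[i] :=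
  \sum_(y : 'Z_m | odd y == p) psi (b * y ^+ 2).

(** Units modulo 8q are odd, so scaling by [u] keeps the parity class. This makes the Gauss sums
    admissible weights in [klo_le]. *)
Lemma gam_sqr p b u : u \is a GRing.unit -> gam p (b * u ^+ 2) = gam p b.
Proof.
move=> uu; rewrite [RHS]/gam (reindex (fun x => u * x)) /=; last first.
  by exists (fun x => u^-1 * x) => x _; rewrite ?mulKr ?mulVKr.
apply: eq_big => [y|y _]; first by rewrite odd_M8 (odd_unit8 uu).
by congr ezq; ring.
Qed.

(** The sign (-1)^y is the character of frequency 4q, so restricting the parity averages the
    frequencies c and c + 4q. *)
Lemma sum_psi_parity (p : bool) (c : 'Z_m) :
  `|\sum_(y : 'Z_m | odd y == p) psi (c * y)| <=
  (4 * q * ((c == 0%R) + (c == (4 * q)%:R)))%:R.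
Proof.
have m0 : m%:R = 0 :> 'Z_m by apply/eqP; rewrite natr_Zp_eq0.
have psi4 (y : 'Z_m) : psi ((4 * q)%:R * y) = (-1) ^+ odd y.
  rewrite -[y in LHS]natr_Zp -natrM ezq_nat //.
  have -> : (4 * q * y)%:R / m%:R = (y : nat)%:R * 2^-1 :> R.
    rewrite /m !natrM; field; by rewrite !pnatr_eq0 -lt0n q0.
  rewrite expiX (_ : expi (2^-1 : R) = -1) ?signr_odd // /expi mulrC mulrA mulVf // mul1r.
  by rewrite cospi sinpi; apply/eqP; rewrite eq_complex /= oppr0 !eqxx.
have -> : \sum_(y : 'Z_m | odd y == p) psi (c * y) =
   2^-1 * (\sum_y psi (c * y) + (-1) ^+ p * \sum_y psi ((c + (4 * q)%:R) * y)).
  rewrite big_mkcond /= [X in _ * X]addrC mulr_sumr -big_split /= mulr_sumr.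
  apply: eq_bigr => y _; rewrite mulrDl psiD psi4.
  by move: (psi _) => z; case: (odd y); case: p; rewrite /= ?expr0 ?expr1; field.
rewrite !ezq_orth // normrM normfV normr_nat mulrC ler_pdivrMr ?ltr0n //.
apply: le_trans (ler_normD _ _) _; rewrite normrM normrX normrN1 expr1n mul1r !normr_nat.
have -> : (c + (4 * q)%:R == 0) = (c == (4 * q)%:R).
  rewrite -[0](_ : (4 * q)%:R + (4 * q)%:R = 0 :> 'Z_m) ?(inj_eq (addIr _)) //.
  by rewrite -natrD -m0 /m; congr (_%:R); lia.
by rewrite -natrD -natrM ler_nat /m; apply: eq_leq; ring.
Qed.

(** Squaring and setting y' = y + t leaves a linear sum in y, which vanishes unless 2bt is 0 or 4q.
    Each value is taken by at most two t, and each such t contributes at most 4q. *)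
Lemma gam_norm p b : b \is a GRing.unit -> `|gam p b| ^+ 2 <= (16 * q)%:R.
Proof.
move=> ub; have E : `|gam p b| ^+ 2 =
   \sum_(t : 'Z_m | ~~ odd t) psi (b * t ^+ 2) *
     \sum_(y : 'Z_m | odd y == p) psi (2 * b * t * y).
  rewrite normCK /gam rmorph_sum /= mulrC big_distrlr /=.
  under [RHS]eq_bigr => t _ do rewrite mulr_sumr.
  rewrite [RHS]exchange_big /=; apply: eq_bigr => y /eqP py.
  rewrite (reindex_inj (addIr y)) /=; apply: eq_big => [t|t _].
    by rewrite odd_D8 py; case: (odd t); case: (p).
  rewrite -(psiN psiD (@norm_ezq R m)) // -!psiD; congr ezq; ring.
rewrite -[leLHS]ger0_norm ?exprn_ge0 // E; apply: le_trans (ler_norm_sum _ _ _) _.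
apply: (@le_trans _ _ (\sum_(t : 'Z_m) (4 * q * ((2 * (b * t) == 0)%R + (2 * (b * t) == (4 * q)%:R)%R))%:R)).
  rewrite [leLHS]big_mkcond /=; apply: ler_sum => t _; case: ifP => // _.
  rewrite normrM norm_ezq mul1r mulrA; exact: sum_psi_parity.
rewrite -natr_sum ler_nat -big_distrr /= (_ : 16 * q = 4 * q * 4)%N; last by lia.
rewrite leq_mul2l; apply/orP; right; rewrite big_split /=.
have H c : (\sum_(t : 'Z_m) (2 * (b * t) == c)%R <= 2)%N.
  rewrite (reindex (fun x => b^-1 * x)) /=; last first.
    by exists (fun x => b * x) => x _; rewrite ?mulKr ?mulVKr.
  apply: leq_trans (count_two m1 c); rewrite -sum1_card [leqRHS]big_mkcond /=.
  by apply: leq_sum => x _; rewrite mulVKr // inE /=; case: eqP.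
exact: leq_add (H _) (H _).
Qed.

(** Since 4k (k + 1) = 8 tri k, the phase is b tri k / q + h k / (2q): the complete Gauss sum at the
    dual frequency [h], with its coefficient lifted modulo 8q. *)
Definition Gz (b : 'Z_m) (h : nat) : R[i] :=
  \sum_(0 <= k < 2 * q) psi (b * (4 * (k * k.+1))%:R + (4 * h * k)%:R).

(** With x = 2k + 1, the odd residues modulo 8q run twice over the period 2q of k, hence the factor
    2. Completing the square shifts x by h / b, so the parity of [h] selects the class. *)
Lemma GzE b h : b \is a GRing.unit ->
  2 * Gz b h = psi (- b - (2 * h)%:R - (h ^ 2)%:R * b^-1) * gam (~~ odd h) b.
Proof.
move=> ub; pose F (k : nat) := psi (b * (k%:R ^+ 2 - 1) + 2 * h%:R * (k%:R - 1)).
have m0 : m%:R = 0 :> 'Z_m by apply/eqP; rewrite natr_Zp_eq0.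
have FE k : psi (b * (4 * (k * k.+1))%:R + (4 * h * k)%:R) = F k.*2.+1.
  rewrite /F -[k.*2.+1]addn1 -muln2; congr ezq; rewrite natrD !natrM -[k.+1]addn1 natrD; ring.
have per k : F (k + 2 * q).*2.+1 = F k.*2.+1.
  rewrite -!FE; congr ezq; apply/eqP; rewrite -subr_eq0; apply/eqP.
  transitivity (m%:R * (b * (2 * k + 1 + 2 * q)%:R + h%:R)); last by rewrite m0 mul0r.
  by rewrite /m -[(k + 2 * q).+1]addn1 -[k.+1]addn1 !(natrM, natrD); ring.
have -> : 2 * Gz b h = \sum_(x : 'Z_m | odd x) F x.
  rewrite big_mkcond /= (big_Zq m1 _ (fun x => if odd x then F x else 0)) -big_mkcond /=.
  rewrite (_ : m = (2 * q + 2 * q).*2)%N; last by rewrite /m; lia.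
  rewrite big_odd (big_cat_nat (n := (2 * q)%N)) ?leq_addr //=.
  rewrite [X in _ + X](_ : _ = \sum_(0 <= k < 2 * q) F (k + 2 * q)%N.*2.+1); last first.
    by rewrite -{1}[(2 * q)%N]add0n big_addn addnK.
  rewrite mulr_natl mulr2n; congr (_ + _).
    by apply: eq_bigr => k _; rewrite FE.
  by apply: eq_bigr => k _; rewrite per FE.
rewrite /gam [RHS]mulrC mulr_suml [RHS](reindex_inj (addIr (h%:R * b^-1))).
have bb : b * b^-1 = 1 by rewrite divrr.
have ob : odd (b^-1 : 'Z_m) by rewrite odd_unit8 // unitrV.
apply: eq_big => [y|y _].
  rewrite odd_D8 odd_M8 ob andbT odd_Zp8.
  by case: (odd y); case: (odd h).
rewrite /F -psiD natr_Zp; congr ezq; rewrite natrM natrX.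
move: (b^-1) bb => ib bb; apply/eqP; rewrite -subr_eq0; apply/eqP.
transitivity ((b * ib - 1) * (- (h%:R ^+ 2 * ib) - 2 * y * h%:R)); first by ring.
by rewrite bb subrr mul0r.
Qed.

(* The reflection k -> -1 - k preserves k (k + 1) and flips (-1)^k. *)
Lemma Gz_half b : Gz b q = 0.
Proof.
have m0 : m%:R = 0 :> 'Z_m by apply/eqP; rewrite natr_Zp_eq0.
have psi4 : psi ((4 * q)%:R) = -1.
  rewrite ezq_nat //.
  have -> : (4 * q)%:R / m%:R = 2^-1 :> R.
    rewrite /m !natrM; field; by rewrite !pnatr_eq0 -lt0n q0.
  rewrite /expi mulrC mulrA mulVf // mul1r.
  by rewrite cospi sinpi; apply/eqP; rewrite eq_complex /= oppr0 !eqxx.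
have : Gz b q = - Gz b q.
  rewrite {1}/Gz big_nat_rev /= add0n -mulN1r -psi4 mulr_sumr.
  apply: eq_big_nat => k /andP[_ hk]; rewrite -psiD; congr ezq.
  apply/eqP; rewrite -subr_eq0; apply/eqP.
  have e : (2 * q - k.+1)%:R = 2 * q%:R - (k%:R + 1) :> 'Z_m by rewrite natrB // -[k.+1]addn1 natrD natrM.
  transitivity (m%:R * (b * (2 * q%:R - 2 * k%:R - 1) + (q%:R - k%:R - 1))); last by rewrite m0 mul0r.
  rewrite -[(2 * q - k.+1).+1]addn1 {1 2}/m !natrM natrD e -[k.+1]addn1 natrD; ring.
move/eqP; rewrite -subr_eq0 opprK -mulr2n mulrn_eq0 /= => /eqP //.
Qed.

End GaussSums.

(** * Completing the sums over an interval of neighbours *)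

Section ArcSums.
Context (R : realType).

Lemma ezq_int (q : nat) (n : int) : (1 < q)%N ->
  ezq R (n%:~R : 'Z_q) = expi (n%:~R / q%:R : R).
Proof.
move=> q1; case: n => n; first exact: ezq_nat.
rewrite NegzE !mulrNz mulNr; apply: (mulfI (_ : ezq R (n.+1%:R : 'Z_q) != 0)).
  by rewrite -normr_eq0 norm_ezq oner_eq0.
by rewrite -ezqD // subrr ezq0 ezq_nat // -expiD subrr expi0.
Qed.

Lemma Zp_mul_int (q : nat) (a : 'Z_q) (n : int) :
  a * n%:~R = ((a : nat)%:Z * n)%:~R.
Proof. by rewrite intrM; congr (_ * _); rewrite -[RHS]/((a : nat)%:R) natr_Zp. Qed.

Lemma sum_expi_frac (d : nat) (n : int) : (0 < d)%N ->
  \sum_(0 <= a < d) expi (a%:R * n%:~R / d%:R : R) = (d * (d %| `|n|)%N)%:R.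
Proof.
case: d => [//|[_|d _]]; first by rewrite big_nat1 !mul0r expi0 dvd1n.
have q1 : (1 < d.+2)%N by [].
rewrite -(big_Zq q1 _ (fun a => expi (a%:R * n%:~R / d.+2%:R : R))).
rewrite (eq_bigr (fun a => ezq R (n%:~R * a))) ?ezq_orth //; last first.
  by move=> a _; rewrite [X in ezq R X]mulrC Zp_mul_int ezq_int // intrM.
congr (_ * _)%:R; congr nat_of_bool; rewrite -natr_Zp_eq0 //.
by case: n => n //; rewrite NegzE mulrNz oppr_eq0 abszN.
Qed.

Lemma expi_mod (q a b : nat) : (0 < q)%N -> a = b %[mod q] ->
  expi (a%:R / q%:R : R) = expi (b%:R / q%:R).
Proof.
move=> q0 e; rewrite (divn_eq a q) (divn_eq b q) e !natrD !natrM.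
by rewrite !mulrDl !mulfK ?pnatr_eq0 -?lt0n // !expiD !expi_nat.
Qed.

Lemma expiN (t : R) : expi (- t) = (expi t)^-1.
Proof.
apply: (mulfI (_ : expi t != 0)); first by rewrite -normr_eq0 norm_expi oner_eq0.
by rewrite -expiD subrr expi0 divff // -normr_eq0 norm_expi oner_eq0.
Qed.

Lemma sum_residue (V : nmodType) (f : nat -> V) (q x k : nat) : (0 < q)%N ->
  \sum_(0 <= z < k * q | z == x %[mod q]) f z = \sum_(0 <= j < k) f (j * q + x %% q)%N.
Proof.
move=> q0; elim: k => [|k IH]; first by rewrite !big_geq.
rewrite mulSnr (big_cat_nat (n := (k * q)%N)) ?leq_addr //= IH big_nat_recr //=; congr (_ + _).
rewrite -{1}[(k * q)%N]add0n big_addn addKn big_mkord.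
rewrite (big_pred1 (Ordinal (ltn_pmod x q0))) /= ?[(_ + k * q)%N]addnC // => i.
by rewrite addnC modnMDl (modn_small (ltn_ord i)).
Qed.

Definition gauss (q a h : nat) : R[i] :=
  \sum_(0 <= k < 2 * q) expi ((a * tri k)%:R / q%:R + (h * k)%:R / (2 * q)%:R).

Section Fixed.
Context (q : nat) (q0 : (0 < q)%N).
Let m := (8 * q)%N.
Let m1 : (1 < m)%N. Proof. by rewrite /m; lia. Qed.
Local Notation psi := (@ezq R m).

(** By [gam_norm] four Gauss sums have product at most (16 q)^2 / 16 = 16 q^2; the fourth power of
    this multiplies the bound of [klo_le] for modulus 8q. *)
Definition kbound (n : nat) : nat :=
  (16 ^ 4 * q ^ 8 * (4 * gcdn (8 * n + 4) m * tau m ^ 4 * m ^ 3))%N.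

(** Here [k] is the frequency of the completion. With b = -1 / x, completing four squares leaves the
    phase -4b - (sum of h^2) / b, and the whole is a Kloosterman sum whose coefficient of b is -(8n
    + 4), whatever [h] and [k] are. The bound is therefore uniform in both. *)
Lemma quad_sum (n k : nat) (h : 'I_4 -> nat) :
  `|\sum_(x : 'Z_m | x \is a GRing.unit) psi ((8 * k)%:R * x) *
     (\prod_(i < 4) @Gz R q (- x^-1) (h i) * psi ((8 * n)%:R * x^-1))| ^+ 4 <=
  (kbound n)%:R.
Proof.
have psiD := @ezqD R m m1.
pose H2 := \sum_(i < 4) (2 * h i)%:R : 'Z_m.
pose HH := \sum_(i < 4) (h i ^ 2)%:R : 'Z_m.
pose pg (b : 'Z_m) := \prod_(i < 4) @gam R q (~~ odd (h i)) b.
pose eps (b : 'Z_m) := if b \is a GRing.unit then pg b / (16 * q)%:R ^+ 2 else 0.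
have Q0 : 0 < (16 * q)%:R :> R[i] by rewrite ltr0n muln_gt0.
have pgE b : b \is a GRing.unit -> \prod_(i < 4) @Gz R q b (h i) =
    psi (- (4 * b) - H2 - HH * b^-1) * pg b / 16%:R.
  move=> ub; apply: (mulfI (_ : 2 ^+ 4 != 0 :> R[i])); first by rewrite expf_neq0 // pnatr_eq0.
  have -> : (2 ^+ 4 : R[i]) = \prod_(i < 4) 2 by rewrite prodr_const card_ord.
  rewrite -big_split /= (eq_bigr _ (fun i _ => GzE R q0 (h i) ub)) big_split /= -/(pg b).
  rewrite prodr_const card_ord -natrX mulrCA divff ?pnatr_eq0 // mulr1; congr (_ * _).
  have -> : \prod_(i < 4) psi (- b - (2 * h i)%:R - (h i ^ 2)%:R * b^-1) =
     psi (\sum_(i < 4) (- b - (2 * h i)%:R - (h i ^ 2)%:R * b^-1)).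
    by elim/big_ind2: _ => [|x y z t -> ->|//]; rewrite ?ezq0 ?psiD.
  congr ezq; rewrite !sumrB sumrN mulr_suml sumr_const card_ord.
  by rewrite [b *+ 4](_ : _ = 4 * b) // mulr_natl.
have eps1 b : `|eps b| <= 1.
  rewrite /eps; case: ifP => ub; last by rewrite normr0.
  rewrite normrM normfV ler_pdivrMr ?mul1r ?normr_gt0 ?expf_neq0 ?gt_eqF //.
  rewrite normrX normr_nat -(@ler_pXn2r _ 2) ?nnegrE ?exprn_ge0 // -exprM.
  rewrite /pg normr_prod -prodrXl.
  apply: le_trans (_ : \prod_(i < 4) (16 * q)%:R <= _); last by rewrite prodr_const card_ord.
  by apply: ler_prod => i _; rewrite exprn_ge0 //= gam_norm.
have epsi b u : u \is a GRing.unit -> eps (b * u ^+ 2) = eps b.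
  move=> uu; rewrite /eps unitrM [u ^+ 2 \is a _]unitrX // andbT; case: ifP => // _.
  by congr (_ / _); apply: eq_bigr => i _; rewrite gam_sqr.
pose n0 := (m.-1 * (8 * n + 4))%N.
have n0E : n0%:R = - (8 * n + 4)%:R :> 'Z_m.
  have m0 : m%:R = 0 :> 'Z_m by apply/eqP; rewrite natr_Zp_eq0.
  by rewrite /n0 natrM -subn1 natrB ?(ltnW m1) // m0 sub0r mulN1r.
have := klo_le m1 n0 (- ((8 * k)%:R + HH)) psiD (@norm_ezq R m) (ezq_orth R m1) eps1 epsi.
have -> : gcdn n0 m = gcdn (8 * n + 4) m.
  rewrite /n0 gcdnC Gauss_gcdr 1?gcdnC // -{1}[m]prednK ?(ltnW m1) //.
  exact: coprimeSn.
move=> le1.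
have -> : \sum_(x : 'Z_m | x \is a GRing.unit) psi ((8 * k)%:R * x) *
     (\prod_(i < 4) @Gz R q (- x^-1) (h i) * psi ((8 * n)%:R * x^-1)) =
   psi (- H2) * (16 * q ^ 2)%:R * klo psi eps n0%:R (- ((8 * k)%:R + HH)).
  rewrite /klo mulr_sumr (reindex (fun b => - b^-1)) /=; last first.
    by exists (fun b => - b^-1) => x _; rewrite invrN opprK invrK.
  apply: eq_big => [b|b ub]; first by rewrite unitrN unitrV.
  rewrite unitrN unitrV in ub.
  rewrite invrN opprK invrK pgE // /eps ub n0E.
  have -> : psi (- (8 * n + 4)%:R * b + - ((8 * k)%:R + HH) * b^-1) =
     psi ((8 * k)%:R * - b^-1) * psi (- (4 * b) - HH * b^-1) * psi ((8 * n)%:R * - b).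
    by rewrite -!psiD natrD; congr ezq; ring.
  have -> : psi (- (4 * b) - H2 - HH / b) = psi (- H2) * psi (- (4 * b) - HH / b).
    by rewrite -psiD; congr ezq; ring.
  rewrite (_ : (16 * q ^ 2)%:R = (16 * q)%:R ^+ 2 / 16%:R); last first.
    by rewrite !natrM; field.
  have Q2 : (16 * q)%:R ^+ 2 != 0 :> R[i] by rewrite expf_neq0 // gt_eqF.
  move: ((16 * q)%:R ^+ 2) Q2 => Z Z0; by field; rewrite ?Z0.
have -> : kbound n = ((16 * q ^ 2) ^ 4 * (4 * gcdn (8 * n + 4) m * tau m ^ 4 * m ^ 3))%N.
  by rewrite /kbound expnMn -expnM.
rewrite !normrM norm_ezq mul1r normr_nat exprMn -natrX [leRHS]natrM.
by apply: ler_wpM2l.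
Qed.

Context (n X0 r : nat) (h : 'I_4 -> nat) (a : nat -> nat).
Hypothesis rq : (r <= q)%N.
Hypothesis ha : forall x, coprime x q -> (q %| a x * x + 1)%N.

Definition arc_term (x : nat) : R[i] :=
  \prod_(i < 4) gauss q (a x) (h i) * expi (- ((a x * n)%:R / q%:R)).

(** All coefficients of 1 / z are multiples of 8, so the term depends on z only modulo q. A sum over
    x modulo q can thus be lifted to 8q, where the squares are completed. *)
Lemma lift_term (x : nat) (z : 'Z_m) : coprime x q -> z \is a GRing.unit ->
  z = x %[mod q] ->
  \prod_(i < 4) @Gz R q (- z^-1) (h i) * psi ((8 * n)%:R * z^-1) = arc_term x.
Proof.
move=> cx uz zx; set b : 'Z_m := - z^-1.
have q0R : q%:R != 0 :> R by rewrite pnatr_eq0 -lt0n.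
have ba : b = a x %[mod q].
  have : (m %| b * z + 1)%N.
    rewrite -natr_Zp_eq0 // natrD natrM !natr_Zp /b mulNr mulVr //.
    by rewrite addNr.
  move=> /(dvdn_trans (_ : q %| m)%N); rewrite dvdn_mull // => /(_ isT).
  rewrite /dvdn -modnDml -modnMmr zx modnMmr modnDml -/(dvdn _ _) => h1.
  have h2 := ha cx; apply/eqP.
  wlog le : / (a x <= b)%N.
    move: h1; move: (b : nat) (a x) h2 => u v h2 h1 H.
    case: (leqP v u) => [|/ltnW] le; last rewrite eq_sym; rewrite eqn_mod_dvd // -(Gauss_dvdl _ (_ : coprime q x)) 1?coprime_sym // mulnBl.
      by rewrite -(subnDr 1) dvdn_sub.
    by rewrite -(subnDr 1) dvdn_sub.
  rewrite eqn_mod_dvd // -(Gauss_dvdl _ (_ : coprime q x)) 1?coprime_sym // mulnBl.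
  by rewrite -(subnDr 1) dvdn_sub.
have eb (k : nat) : expi ((b * k)%:R / q%:R) = expi ((a x * k)%:R / q%:R) :> R[i].
  by apply: expi_mod => //; rewrite -modnMml ba modnMml.
congr (_ * _).
  apply: eq_bigr => i _; rewrite /Gz /gauss; apply: eq_bigr => k _.
  rewrite -[b]natr_Zp -natrM -natrD ezq_nat // expiD -eb -expiD; congr expi.
  rewrite -tri2 /m !(natrD, natrM); field.
  by rewrite q0R.
have -> : (8 * n)%:R * z^-1 = - ((8 * n)%:R * b) by rewrite /b mulrN opprK.
rewrite expiN -eb -[b in LHS]natr_Zp -natrM.
apply: (mulfI (_ : psi (8 * n * b)%:R != 0)); first by rewrite -normr_eq0 norm_ezq oner_eq0.
rewrite -ezqD // subrr ezq0 ezq_nat //.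
have -> : (8 * n * b)%:R / m%:R = (b * n)%:R / q%:R :> R.
  by rewrite /m !natrM; field; rewrite q0R.
by rewrite divff // -normr_eq0 norm_expi oner_eq0.
Qed.

(** The total mass of the Fourier coefficients of an interval modulo q; the 1 is the frequency
    zero. *)
Lemma dir_sum_le (X : nat) :
  \sum_(0 <= k < q) `|\sum_(0 <= y < r) expi (- ((k * (X + y))%:R / q%:R) : R)| <=
  (q * (1 + 2 * ell q))%:R.
Proof.
have trivial_le (k : nat) :
    `|\sum_(0 <= y < r) expi (- ((k * (X + y))%:R / q%:R) : R)| <= q%:R.
  apply: le_trans (ler_norm_sum _ _ _) _.
  rewrite (eq_bigr (fun=> 1)) => [|y _]; last exact: norm_expi.
  by rewrite sumr_const_nat subn0 ler_nat.
have [q1|q1] := leqP q 1.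
  have e : q = 1%N by apply/eqP; rewrite eqn_leq q1.
  rewrite [X in \sum_(0 <= k < X) _]e big_nat1; apply: le_trans (trivial_le 0) _.
  by rewrite ler_nat; nia.
rewrite big_ltn // mulnDr muln1 natrD; apply: lerD; first exact: trivial_le.
have := dir_le R q1 r; rewrite -natrM -natrM -/(ell q) rmorph_nat => le1.
rewrite (_ : q * (2 * ell q) = 2 * q * ell q)%N; last by lia.
apply: le_trans le1; rewrite [leRHS]big_mkcond /=.
rewrite (eq_bigr (fun k : 'Z_q => if (k : nat) != 0%N then `|dir R k r| else 0)) //.
rewrite (eq_bigr (fun k : 'Z_q => (fun k : nat => if k != 0%N then `|dir R (k%:R : 'Z_q) r| else 0) k)); last first.
  by move=> k _; rewrite natr_Zp.
rewrite (big_Zq q1 _ (fun k : nat => if k != 0%N then `|dir R (k%:R : 'Z_q) r| else 0)) [leRHS]big_ltn //= add0r big_nat [leRHS]big_nat.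
apply: ler_sum => k /andP[k0 kq]; rewrite -lt0n k0.
have E y : expi (- ((k * (X + y))%:R / q%:R) : R) =
    expi (- ((k * X)%:R / q%:R)) * (ezq R ((k%:R : 'Z_q) * y%:R))^*.
  rewrite -natrM -(psiN (ezqD R q1) (@norm_ezq R q)).
  apply: (mulfI (_ : ezq R ((k * y)%:R : 'Z_q) != 0)); first by rewrite -normr_eq0 norm_ezq oner_eq0.
  rewrite mulrCA -ezqD // subrr ezq0 mulr1 ezq_nat // -expiD; congr expi.
  by rewrite mulnDr natrD; ring.
rewrite (eq_bigr _ (fun y _ => E y)) -mulr_sumr normrM norm_expi mul1r.
by rewrite -rmorph_sum norm_conjC.
Qed.

(** Completion: the interval is expanded in additive characters modulo q, of total mass given by
    [dir_sum_le], and each complete sum is at most [B] by [quad_sum]. *)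
Lemma arc_sum_le (B : R) : 0 <= B -> (kbound n)%:R <= B ^+ 4 ->
  `|\sum_(0 <= y < r | coprime (X0 + y) q) arc_term (X0 + y)| <= (B * (1 + 2 * ell q)%:R)%:C.
Proof.
(* [c] is the number of units modulo 8q above a unit modulo q: of the eight candidates half are odd
   if [q] is odd, and all are if [q] is even. *)
move=> B0 hB; pose c := if odd q then 4%N else 8%N.
pose Fx (x : 'Z_m) := \prod_(i < 4) @Gz R q (- x^-1) (h i) * psi ((8 * n)%:R * x^-1).
have psiD := @ezqD R m m1.
have q0C : q%:R != 0 :> R[i] by rewrite pnatr_eq0 -lt0n.
have TB k : `|\sum_(x : 'Z_m | x \is a GRing.unit) psi ((8 * k)%:R * x) * Fx x| <= B%:C.
  rewrite -(@ler_pXn2r _ 4) ?nnegrE ?normr_ge0 ?ler0c //.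
  by apply: le_trans (quad_sum n k h) _; rewrite -rmorphXn /= -(rmorph_nat (real_complex R)) lecR.
have lifts x : coprime x q -> \sum_(z : 'Z_m | (z \is a GRing.unit) && (z == x %[mod q])) Fx z = c%:R * arc_term x.
  move=> cx; rewrite (eq_bigr (fun=> arc_term x)); last first.
    by move=> z /andP[uz /eqP]; apply: lift_term.
  rewrite sumr_const mulr_natl; congr (_ *+ _).
  rewrite -sum1_card big_mkcond /=.
  rewrite (eq_bigr (fun z : 'Z_m => if (z : nat) == x %[mod q] then coprime m z : nat else 0%N)); last first.
    move=> z _; have uz : (z \is a GRing.unit) = coprime m z by rewrite -{1}[z]natr_Zp unitZpE.
    by rewrite -[z \in _]/((z \is a GRing.unit) && (z == x %[mod q])) uz; case: coprime; case: (_ == _).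
  rewrite (big_Zq m1 _ (fun z => if z == x %[mod q] then coprime m z : nat else 0%N)) -big_mkcond /=.
  rewrite sum_residue // (eq_bigr (fun j => odd (j * q + x %% q) : nat)); last first.
    move=> j _; rewrite /m coprimeMl -[coprime 8 _]/(coprime (2 ^ 3) _) coprime_pexpl // coprime2n.
    by rewrite [coprime q _](_ : _ = true) ?andbT // -coprime_modr modnMDl modn_mod coprime_modr coprime_sym.
  have xo : ~~ odd q -> odd (x %% q).
    move=> qe; rewrite odd_mod ?(negPf qe) //; move: cx; rewrite -(odd_double_half q) (negPf qe) add0n.
    by rewrite -mul2n coprimeMr coprimen2 => /andP[].
  rewrite /c; do 8!rewrite big_nat_recr //=; rewrite big_geq // !oddD !oddM /=.
  by case: (odd q) xo => [_|/(_ isT) ->] //; case: (odd _).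
have key : (q%:R * c%:R) * \sum_(0 <= y < r | coprime (X0 + y) q) arc_term (X0 + y) =
   \sum_(0 <= k < q) (\sum_(0 <= y < r) expi (- ((k * (X0 + y))%:R / q%:R) : R)) *
     (\sum_(x : 'Z_m | x \is a GRing.unit) psi ((8 * k)%:R * x) * Fx x).
  transitivity (\sum_(0 <= y < r) \sum_(x : 'Z_m | x \is a GRing.unit)
      (q * ((x : nat) == X0 + y %[mod q]))%:R * Fx x).
    rewrite mulr_sumr [LHS]big_mkcond /=; apply: eq_bigr => y _; case: ifP => cy.
      rewrite -mulrA -lifts // mulr_sumr [LHS]big_mkcondr /=; apply: eq_bigr => z _.
      by case: eqP; rewrite ?muln1 // muln0 mul0r.
    rewrite big1 // => z uz; case: eqP => [e|_]; last by rewrite muln0 mul0r.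
    have : coprime q z by move: uz; rewrite -{1}[z]natr_Zp unitZpE // /m coprimeMl => /andP[].
    by rewrite -coprime_modr e coprime_modr coprime_sym cy.
  under [RHS]eq_bigr => k _ do rewrite mulr_suml.
  rewrite [RHS]exchange_big /=; apply: eq_bigr => y _.
  under [RHS]eq_bigr => k _ do rewrite mulr_sumr.
  rewrite [RHS]exchange_big /=; apply: eq_bigr => z _.
  under [RHS]eq_bigr => k _ do rewrite mulrA.
  rewrite -mulr_suml; congr (_ * _).
  have E k : expi (- ((k * (X0 + y))%:R / q%:R) : R) * psi ((8 * k)%:R * z) =
      expi (k%:R * (z%:R - (X0 + y)%:R) / q%:R).
    rewrite -[z in LHS]natr_Zp -natrM ezq_nat // -expiD; congr expi.
    rewrite /m !natrM; field; by rewrite pnatr_eq0 -lt0n q0.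
  rewrite (eq_bigr _ (fun k _ => E k)).
  have := sum_expi_frac ((z : nat)%:Z - (X0 + y)%:Z) q0; rewrite intrB -!pmulrn => ->.
  congr (_ * _)%:R; congr nat_of_bool.
  case: (leqP (X0 + y) z) => le.
    by rewrite eqn_mod_dvd // distnEl.
  by rewrite eq_sym eqn_mod_dvd ?(ltnW le) // distnEr ?(ltnW le).
have qc : `|q%:R * c%:R : R[i]| = (q * c)%:R by rewrite -natrM normr_nat.
have qc0 : 0 < (q * c)%:R :> R[i] by rewrite ltr0n muln_gt0 q0 /c; case: ifP.
rewrite -(ler_pM2l qc0) -{1}qc -normrM key; apply: le_trans (ler_norm_sum _ _ _) _.
apply: (@le_trans _ _ (\sum_(0 <= k < q) `|\sum_(0 <= y < r) expi (- ((k * (X0 + y))%:R / q%:R) : R)| * B%:C)).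
  by apply: ler_sum => k _; rewrite normrM ler_wpM2l.
rewrite -mulr_suml; apply: le_trans (ler_wpM2r _ (dir_sum_le X0)) _; first by rewrite ler0c.
rewrite -(rmorph_nat (real_complex R)) -(rmorph_nat (real_complex R) (q * c)) -!rmorphM /= lecR.
rewrite (natrM _ q) (natrM _ q) (_ : _ * (B * _) = q%:R * (1 + 2 * ell q)%:R * B * c%:R); last by ring.
rewrite ler_peMr ?mulr_ge0 // ler1n.
by rewrite /c; case: ifP.
Qed.

End Fixed.
End ArcSums.

(** * The dual sum *)

Section KusminLandau.
Context (R : realType).

(** The norm on [R[i]] takes its values in [R[i]]; this is the same modulus as a real number. *)
Definition cabs (z : R[i]) : R := complex.Re `|z|.

Lemma cabsE z : `|z| = (cabs z)%:C.
Proof. by rewrite /cabs normc_def. Qed.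

Lemma cabs_ge0 z : 0 <= cabs z.
Proof. by rewrite -ler0c -cabsE. Qed.

Lemma cabs_leE z x : (`|z| <= x%:C) = (cabs z <= x).
Proof. by rewrite cabsE lecR. Qed.

Lemma cabsM z w : cabs (z * w) = cabs z * cabs w.
Proof. by apply: (@complexI R); rewrite rmorphM /= -!cabsE normrM. Qed.

Lemma cabsV z : cabs z^-1 = (cabs z)^-1.
Proof. by apply: (@complexI R); rewrite fmorphV /= -!cabsE normfV. Qed.

Lemma cabsD z w : cabs (z + w) <= cabs z + cabs w.
Proof. by rewrite -lecR rmorphD /= -!cabsE ler_normD. Qed.

Lemma cabsB z w : cabs (z - w) <= cabs z + cabs w.
Proof. by rewrite -lecR rmorphD /= -!cabsE ler_normB. Qed.

Lemma cabsC z w : cabs (z - w) = cabs (w - z).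
Proof. by apply: (@complexI R); rewrite -!cabsE distrC. Qed.

Lemma cabs_sum (I : Type) (r : seq I) (P : pred I) (F : I -> R[i]) :
  cabs (\sum_(i <- r | P i) F i) <= \sum_(i <- r | P i) cabs (F i).
Proof.
rewrite -lecR -cabsE rmorph_sum /=; apply: le_trans (ler_norm_sum _ _ _) _.
by rewrite (eq_bigr _ (fun i _ => cabsE (F i))).
Qed.

Lemma cabs_prod (I : Type) (r : seq I) (P : pred I) (F : I -> R[i]) :
  cabs (\prod_(i <- r | P i) F i) = \prod_(i <- r | P i) cabs (F i).
Proof.
apply: (@complexI R); rewrite -cabsE rmorph_prod normr_prod.
by apply: eq_bigr => i _; rewrite cabsE.
Qed.

Lemma cabs_expi t : cabs (expi t) = 1.
Proof. by apply: (@complexI R); rewrite -cabsE norm_expi. Qed.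

Lemma cabs0 : cabs 0 = 0.
Proof. by apply: (@complexI R); rewrite -cabsE normr0. Qed.

Lemma cabs_nat n : cabs n%:R = n%:R.
Proof. by apply: (@complexI R); rewrite -cabsE normr_nat rmorph_nat. Qed.

(** The mean value theorem in each coordinate; the constant is twice 8, where 8 is an upper bound
    for 2 pi. *)
Lemma expi_lip_pos (t : R) : 0 <= t -> cabs (1 - expi t) <= 16 * t.
Proof.
move=> t0; set u := 2 * pi * t.
have u0 : 0 <= u by rewrite mulr_ge0 // mulr_ge0 // pi_ge0.
have u8 : u <= 8 * t.
  rewrite ler_wpM2r //; have [/andP[_ h] _] := @pihalf_02_cos_pihalf R; lra.
have [c1 _ /= e1] : exists2 c, c \in `[0, u]%R & sin u - sin 0 = cos c * (u - 0).
  apply: MVT_segment => //.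
  by apply: continuous_subspaceT => x; apply: continuous_sin.
have [c2 _ /= e2] : exists2 c, c \in `[0, u]%R & cos u - cos 0 = - sin c * (u - 0).
  apply: MVT_segment => //.
  by apply: continuous_subspaceT => x; apply: continuous_cos.
rewrite sin0 !subr0 in e1; rewrite cos0 subr0 in e2.
have hs : `|sin u| <= u by rewrite e1 normrM (ger0_norm u0) ler_piMl // cos_max.
have hc : `|1 - cos u| <= u.
  by rewrite distrC e2 normrM normrN (ger0_norm u0) ler_piMl // sin_max.
rewrite /cabs normc_def /= -/u; apply: (@le_trans _ _ (`|1 - cos u| + `|0 - sin u|)).
  rewrite -[leRHS]ger0_norm ?addr_ge0 // -sqrtr_sqr ler_wsqrtr //.
  rewrite [leRHS]sqrrD !real_normK ?num_real // addrAC lerDl.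
  by rewrite mulrn_wge0 // mulr_ge0.
by rewrite sub0r normrN; lra.
Qed.

Lemma expi_lip (s t : R) : cabs (expi s - expi t) <= 16 * `|s - t|.
Proof.
wlog st : s t / s <= t.
  by move=> H; case: (leP s t) => [|/ltW] h; [apply: H | rewrite cabsC distrC; apply: H].
have -> : expi s - expi t = expi s * (1 - expi (t - s)).
  by rewrite mulrBr mulr1 -expiD addrCA subrr addr0.
rewrite cabsM cabs_expi mul1r distrC ger0_norm ?subr_ge0 //.
by apply: expi_lip_pos; rewrite subr_ge0.
Qed.

Lemma cabs_1expi_ge (t x : R) : 0 < x -> x <= t -> t <= 1 - x -> 2 * x <= cabs (1 - expi t).
Proof.
move=> x0 xt tx; case: (leP t 2^-1) => ht.
  have := @norm_1expi R t; rewrite cabsE lecR => H.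
  by apply: le_trans (H _); [lra | apply/andP; split; lra].
have -> : cabs (1 - expi t) = cabs (1 - expi (1 - t)).
  rewrite expiD expi1 mul1r expiN.
  have e0 : expi t != 0 by rewrite -normr_eq0 norm_expi oner_eq0.
  have -> : 1 - (expi t)^-1 = (expi t)^-1 * (expi t - 1) by rewrite mulrBr mulr1 mulVf.
  by rewrite cabsM cabsV cabs_expi invr1 mul1r cabsC.
have := @norm_1expi R (1 - t); rewrite cabsE lecR => H.
by apply: le_trans (H _); [lra | apply/andP; split; lra].
Qed.

(** Summation by parts for Kusmin-Landau: each term is a difference times a slowly varying [w], so
    only the end values and the total variation of [w] remain. *)
Lemma abel_cabs (z w : nat -> R[i]) (T : nat) :
  (forall k, cabs (z k) <= 1) -> (forall k, (k <= T)%N -> z k = (z k - z k.+1) * w k) ->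
  cabs (\sum_(0 <= k < T.+1) z k) <=
  cabs (w 0) + cabs (w T) + \sum_(0 <= k < T) cabs (w k.+1 - w k).
Proof.
move=> z1 zw.
have E : forall n, (n <= T)%N -> \sum_(0 <= k < n.+1) z k =
    z 0 * w 0 - z n.+1 * w n + \sum_(0 <= k < n) z k.+1 * (w k.+1 - w k).
  elim=> [|n IH] nT; first by rewrite big_nat1 big_geq // addr0 [in LHS]zw // mulrBl.
  by rewrite big_nat_recr //= IH 1?ltnW // [X in _ + X = _](zw n.+1) // [in RHS]big_nat_recr //=; ring.
have H k c : cabs (z k * c) <= cabs c by rewrite cabsM ler_piMl // cabs_ge0.
rewrite E //; apply: le_trans (cabsD _ _) _; apply: lerD.
  by apply: le_trans (cabsB _ _) _; apply: lerD; apply: H.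
by apply: le_trans (cabs_sum _ _ _) _; apply: ler_sum => k _; apply: H.
Qed.

(** Take w = 1 / (1 - e(th)); its variation is the change of e(th), at most 16 d, over the product
    of two consecutive denominators. *)
Lemma abel_expi (f th lo : nat -> R) (T : nat) (d : R) :
  (forall k, f k.+1 = f k + th k) -> (forall k, `|th k.+1 - th k| = d) ->
  (forall k, 0 < lo k) ->
  (forall k, (k <= T)%N -> lo k <= cabs (1 - expi (th k))) ->
  cabs (\sum_(0 <= k < T.+1) expi (f k)) <=
  (lo 0%N)^-1 + (lo T)^-1 + 16 * d * \sum_(0 <= k < T) ((lo k)^-1 * (lo k.+1)^-1).
Proof.
move=> fE thd lo0 loth.
pose w k := (1 - expi (th k))^-1.
have n0 k : (k <= T)%N -> 1 - expi (th k) != 0.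
  move=> kT; apply/eqP => e; have := loth k kT; rewrite e cabs0 leNgt lo0 //.
have wle k : (k <= T)%N -> cabs (w k) <= (lo k)^-1.
  by move=> kT; rewrite cabsV lef_pV2 ?posrE ?lo0 ?loth // (lt_le_trans (lo0 k)) ?loth.
apply: le_trans (abel_cabs (w := w) _ _) _.
- by move=> k; rewrite cabs_expi.
- move=> k kT; rewrite fE expiD -[X in X - _]mulr1 -mulrBr -mulrA mulfV ?mulr1 //; exact: n0.
apply: lerD; first by apply: lerD; apply: wle.
rewrite mulr_sumr !big_nat; apply: ler_sum => k /andP[_ kT].
have -> : w k.+1 - w k = w k * w k.+1 * (expi (th k.+1) - expi (th k)).
  rewrite /w; have := n0 k (ltnW kT); have := n0 k.+1 kT.
  move: (expi _) (expi _) => a b ha hb; by field; rewrite ha hb.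
rewrite cabsM mulrC; apply: ler_pM; rewrite ?cabs_ge0 //.
  by apply: le_trans (expi_lip _ _) _; rewrite thd.
rewrite cabsM; apply: ler_pM; rewrite ?cabs_ge0 ?wle //; exact: ltnW.
Qed.

Lemma tri_rec k : tri k.+1 = (tri k + k.+1)%N.
Proof. by apply/eqP; rewrite -(eqn_pmul2l (isT : 0 < 2)%N) mulnDr !tri2; apply/eqP; lia. Qed.

Context (q T : nat) (beta : R) (q0 : (0 < q)%N).
(** The quadratic part moves the phase increment by at most 1 / (4q), half the spacing 1 / (2q) of
    the dual frequencies, so only the frequency 0 has a stationary point. *)
Hypotheses (b0 : 0 <= beta) (bT : beta * T%:R * (4 * q)%:R <= 1).

Definition inc (h : nat) : R[i] :=
  \sum_(0 <= k < T) expi (beta * (tri k)%:R - (h * k)%:R / (2 * q)%:R).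

Let q0R : 0 < q%:R :> R. Proof. by rewrite ltr0n. Qed.

Lemma inc_le (h : nat) : (0 < h < 2 * q)%N ->
  cabs (inc h) <= 20 * q%:R * (h%:R^-1 + (2 * q - h)%:R^-1).
Proof.
move=> /andP[h0 hq]; rewrite /inc; case: T bT => [|T'] bT'.
  by rewrite big_geq // cabs0 !mulr_ge0 ?addr_ge0.
have h0R : 1 <= h%:R :> R by rewrite ler1n.
have hqR : (2 * q - h)%:R = 2 * q%:R - h%:R :> R by rewrite natrB ?natrM // ltnW.
have h1R : 1 <= (2 * q - h)%:R :> R by rewrite ler1n subn_gt0.
(* h / (2q) is displaced by at most 1 / (4q) towards 0, so the increments stay at distance at least
   [mn] / (4q) from the integers. *)
pose mn : R := Num.min h%:R (2 * q - h)%:R.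
have mn1 : 1 <= mn by rewrite le_min h0R.
have mh : mn <= h%:R by rewrite ge_min lexx.
have mq : mn <= 2 * q%:R - h%:R by rewrite -hqR ge_min lexx orbT.
have bk k : (k <= T')%N -> 0 <= beta * k.+1%:R /\ beta * k.+1%:R * (4 * q%:R) <= 1.
  move=> kT; split; first by rewrite mulr_ge0.
  apply: le_trans bT'; rewrite natrM ler_wpM2r ?mulr_ge0 // ler_wpM2l // ler_nat.
  by rewrite ltnS.
pose th k : R := beta * k.+1%:R - h%:R / (2 * q%:R).
have qn0 : q%:R != 0 :> R by rewrite gt_eqF.
apply: le_trans (abel_expi (th := th) (lo := fun=> mn / (2 * q%:R)) (d := beta) _ _ _ _) _.
- move=> k; rewrite /th tri_rec !natrM natrD -[k.+1]addn1 natrD; by field.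
- move=> k; rewrite /th -[k.+2]addn1 natrD; rewrite (_ : _ - _ = beta) ?ger0_norm //; ring.
- by move=> k; rewrite divr_gt0 ?mulr_gt0 //; lra.
- move=> k kT; have [b1 b2] := bk k kT.
  have b3 : 0 <= beta * k.+1%:R * (4 * q%:R) by rewrite !mulr_ge0.
  have -> : cabs (1 - expi (th k)) = cabs (1 - expi (- th k)).
    rewrite expiN; have e0 : expi (th k) != 0 by rewrite -normr_eq0 norm_expi oner_eq0.
    have -> : 1 - (expi (th k))^-1 = (expi (th k))^-1 * (expi (th k) - 1).
      by rewrite mulrBr mulr1 mulVf.
    by rewrite cabsM cabsV cabs_expi invr1 mul1r cabsC.
  apply: le_trans (cabs_1expi_ge (x := mn / (4 * q%:R)) _ _ _).
  + rewrite le_eqVlt; apply/orP; left; apply/eqP; by field.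
  + by rewrite divr_gt0 ?mulr_gt0 //; lra.
  + rewrite /th opprB ler_pdivrMr ?mulr_gt0 // mulrBl (_ : h%:R / _ * _ = 2 * h%:R); last by field.
    lra.
  + rewrite /th opprB -(ler_pM2r (_ : 0 < 4 * q%:R)) ?mulr_gt0 // !mulrBl divfK ?mulf_neq0 //.
    rewrite (_ : h%:R / _ * _ = 2 * h%:R); last by field.
    lra.
rewrite sumr_const_nat subn0.
have bT2 : beta * T'%:R <= (4 * q%:R)^-1.
  rewrite -[leRHS]mul1r ler_pdivlMr ?mulr_gt0 //; apply: le_trans bT'.
  by rewrite natrM ler_wpM2r ?mulr_ge0 // ler_wpM2l // ler_nat.
have mn0 : 0 < mn by lra.
have i1 : mn^-1 <= h%:R^-1 + (2 * q - h)%:R^-1.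
  have v1 : 0 <= h%:R^-1 :> R by rewrite invr_ge0.
  have v2 : 0 <= (2 * q - h)%:R^-1 :> R by rewrite invr_ge0.
  by rewrite /mn; case: (leP (h%:R : R) (2 * q - h)%:R) => _; [rewrite lerDl | rewrite lerDr].
have i2 : mn^-1 <= 1 by rewrite invf_le1.
have i0 : 0 < mn^-1 by rewrite invr_gt0.
apply: (@le_trans _ _ (20 * q%:R * mn^-1)); last by rewrite ler_wpM2l // mulr_ge0.
rewrite invf_div -[_ *+ T']mulr_natr.
rewrite (_ : _ + _ = 4 * q%:R * mn^-1 + 64 * (beta * T'%:R) * q%:R ^+ 2 * mn^-1 * mn^-1); last by ring.
apply: (@le_trans _ _ (4 * q%:R * mn^-1 + 64 * (4 * q%:R)^-1 * q%:R ^+ 2 * mn^-1 * 1)).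
  rewrite lerD2l; apply: ler_pM => //; rewrite ?mulr_ge0 ?sqr_ge0 ?(ltW i0) //.
  rewrite !ler_wpM2r ?sqr_ge0 ?(ltW i0) //; lra.
by rewrite le_eqVlt; apply/orP; left; apply/eqP; field; rewrite qn0 gt_eqF.
Qed.

Lemma inc0_le_T : cabs (inc 0) <= T%:R.
Proof.
apply: le_trans (cabs_sum _ _ _) _; rewrite (eq_bigr (fun=> 1)) => [|k _]; last exact: cabs_expi.
by rewrite sumr_const_nat subn0.
Qed.

(** At frequency 0 the phase is stationary at the start of the range. The first [K] terms are
    bounded trivially; after them the increments grow linearly and the variation in [abel_expi]
    telescopes. *)
Lemma inc0_le (K : nat) : (0 < K)%N -> 0 < beta -> cabs (inc 0) <= K%:R + 5 / (beta * K%:R).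
Proof.
move=> K0 bp; have K0R : 0 < K%:R :> R by rewrite ltr0n.
case: (leqP T K) => TK.
  apply: le_trans inc0_le_T _; apply: (@le_trans _ _ K%:R); first by rewrite ler_nat.
  by rewrite lerDl divr_ge0 // mulr_ge0.
rewrite /inc (big_cat_nat (n := K)) ?(ltnW TK) //=; apply: le_trans (cabsD _ _) _.
apply: lerD.
  apply: le_trans (cabs_sum _ _ _) _; rewrite (eq_bigr (fun=> 1)) => [|k _]; last exact: cabs_expi.
  by rewrite sumr_const_nat subn0.
rewrite -{1}[K]add0n big_addn.
have [T' TE] : exists T', (T - K = T'.+1)%N by exists (T - K).-1; rewrite prednK // subn_gt0.
rewrite TE.
apply: le_trans (abel_expi (th := fun k => beta * (k + K).+1%:R)
   (lo := fun k => 2 * (beta * (k + K).+1%:R)) (d := beta) _ _ _ _) _.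
- by move=> k; rewrite addSn tri_rec natrD; rewrite !mul0n !mul0r; ring.
- move=> k; rewrite addSn -[(k + K).+2]addn1 natrD (_ : _ - _ = beta) ?ger0_norm //; ring.
- by move=> k; rewrite !mulr_gt0.
- move=> k kT; have kK : 0 < beta * (k + K).+1%:R by rewrite mulr_gt0.
  have bk : beta * (k + K).+1%:R * 4 <= 1.
    apply: le_trans bT; apply: ler_pM => //; first exact: ltW.
      by rewrite ler_wpM2l // ler_nat; lia.
    by rewrite ler_nat; lia.
  by move: (beta * _) kK bk => t t0 t4; apply: cabs_1expi_ge => //; lra.
have tele n : \sum_(0 <= k < n) ((2 * (beta * (k + K).+1%:R))^-1 * (2 * (beta * (k.+1 + K).+1%:R))^-1)
    = (4 * beta ^+ 2)^-1 * (K.+1%:R^-1 - (n + K).+1%:R^-1).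
  elim: n => [|n IH]; first by rewrite big_geq // subrr mulr0.
  rewrite big_nat_recr //= IH !addSn -[(n + K).+2]addn1 natrD.
  have a0 : (n + K).+1%:R != 0 :> R by rewrite pnatr_eq0.
  have a1 : (n + K).+1%:R + 1 != 0 :> R by rewrite natr1 pnatr_eq0.
  have c0 : K.+1%:R != 0 :> R by rewrite pnatr_eq0.
  have be : beta != 0 by rewrite gt_eqF.
  move: (n + K).+1%:R K.+1%:R a0 a1 c0 => a c a0 a1 c0; field.
  by rewrite a0 a1 c0 be.
rewrite tele.
have K1 : K.+1%:R^-1 <= K%:R^-1 :> R by rewrite lef_pV2 ?posrE // ler_nat.
have K2 : (T' + K).+1%:R^-1 <= K%:R^-1 :> R by rewrite lef_pV2 ?posrE // ler_nat; lia.
have K3 : 0 <= (T' + K).+1%:R^-1 :> R by rewrite invr_ge0.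
rewrite add0n !invfM.
have bi : 0 < beta^-1 by rewrite invr_gt0.
rewrite (_ : 16 * beta * _ = 4 * beta^-1 * (K.+1%:R^-1 - (T' + K).+1%:R^-1)); last first.
  by field; rewrite ?pnatr_eq0 ?gt_eqF.
move: K1 K2 K3; move: K.+1%:R^-1 K%:R^-1 (T' + K).+1%:R^-1 => c k d K1 K2 K3.
have h1 : beta^-1 * c <= beta^-1 * k by rewrite ler_pM2l.
have h2 : beta^-1 * d <= beta^-1 * k by rewrite ler_pM2l.
have h3 : 0 <= beta^-1 * d by rewrite pmulr_rge0.
move: h1 h2 h3; move: (beta^-1) => B h1 h2 h3; lra.
Qed.

End KusminLandau.

(** * Finite Poisson summation on an arc *)

Section ArcBound.
Context (R : realType).

Definition sg (e : bool) (k : nat) : R[i] := (-1) ^+ (e && odd k).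

(** The truncation of Theta for [e = false], of E for [e = true]. *)
Definition tsum (e : bool) (T : nat) (t : R) : R[i] :=
  \sum_(0 <= k < T) sg e k * expi (t * (tri k)%:R).

Context (q T : nat) (beta : R) (q0 : (0 < q)%N).
Hypotheses (b0 : 0 <= beta) (bT : beta * T%:R * (4 * q)%:R <= 1).

Let q20 : (0 < 2 * q)%N. Proof. by rewrite muln_gt0. Qed.

Lemma expi_half : expi (2^-1 : R) = -1.
Proof.
rewrite /expi mulrC mulrA mulVf // mul1r.
by rewrite cospi sinpi; apply/eqP; rewrite eq_complex /= oppr0 !eqxx.
Qed.

Lemma tri_mod k : tri (k %% (2 * q)) = tri k %[mod q].
Proof.
have e : (k %% (2 * q)).+1 = k.+1 %[mod 2 * q] by rewrite -addn1 modnDml addn1.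
apply/eqP; rewrite -(eqn_pmul2l (isT : 0 < 2)%N) (muln_modr 2 (tri k)) (muln_modr 2 (tri _)) !tri2.
by rewrite modnMml -modnMmr e modnMmr.
Qed.

Definition einc (e : bool) (h : nat) : R[i] :=
  \sum_(0 <= k < T) sg e k * expi (beta * (tri k)%:R - (h * k)%:R / (2 * q)%:R).

(** A finite and exact Poisson formula: tri modulo q has period 2q, and the residue j of k modulo 2q
    is detected by the characters e(h (j - k) / (2q)). *)
Lemma tsumE e a : tsum e T (a%:R / q%:R + beta) =
  (2 * q)%:R^-1 * \sum_(0 <= h < 2 * q) gauss R q a h * einc e h.
Proof.
have n0 : (2 * q)%:R != 0 :> R[i] by rewrite pnatr_eq0 -lt0n.
have q0R : q%:R != 0 :> R by rewrite pnatr_eq0 -lt0n.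
apply: (mulfI n0); rewrite mulrA divff // mul1r.
transitivity (\sum_(0 <= k < T) \sum_(0 <= j < 2 * q) \sum_(0 <= h < 2 * q)
   sg e k * expi (beta * (tri k)%:R) * expi ((a * tri j)%:R / q%:R) *
   expi (h%:R * (j%:Z - k%:Z)%:~R / (2 * q)%:R)).
  rewrite mulr_sumr; apply: eq_bigr => k _.
  under eq_bigr => j _ do rewrite -mulr_sumr sum_expi_frac //.
  have dvE j : (2 * q %| `|j%:Z - k%:Z|)%N = (j == k %[mod 2 * q]).
    case: (leqP k j) => [|/ltnW] le; first by rewrite distnEl // eqn_mod_dvd.
    by rewrite distnEr // eq_sym eqn_mod_dvd.
  under eq_bigr => j _ do rewrite dvE.
  rewrite big_mkord (bigD1 (Ordinal (ltn_pmod k q20))) //= modn_mod eqxx muln1.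
  rewrite big1 ?addr0 => [|j jk]; last first.
    case: eqP => [e1|_]; last by rewrite muln0 mulr0.
    by case/eqP: jk; apply: val_inj => /=; rewrite -e1 modn_small.
  have -> : expi ((a * tri (k %% (2 * q)))%:R / q%:R) = expi ((a * tri k)%:R / q%:R) :> R[i].
    by apply: expi_mod => //; rewrite -modnMmr tri_mod modnMmr.
  rewrite [RHS]mulrC; congr (_ * _); rewrite -[RHS]mulrA -expiD; congr (_ * expi _).
  by rewrite natrM; field.
rewrite exchange_big_nat /=; under eq_bigr => j _ do rewrite exchange_big_nat /=.
rewrite exchange_big_nat /=; apply: eq_bigr => h _.
rewrite /gauss mulr_suml; apply: eq_bigr => j _; rewrite mulr_sumr; apply: eq_bigr => k _.
rewrite -!mulrA [RHS]mulrCA; congr (_ * _); rewrite -!expiD; congr expi.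
by rewrite intrB -!pmulrn !natrM; field.
Qed.

(** The sign (-1)^k is the character of frequency q modulo 2q, so it shifts the dual frequency by
    q. *)
Definition rot (e : bool) (h : nat) : nat :=
  if e then (if (h < q)%N then h + q else h - q)%N else h.

Lemma einc_rot e h : einc e h = inc q T beta (rot e h).
Proof.
have q0R : q%:R != 0 :> R by rewrite pnatr_eq0 -lt0n.
apply: eq_bigr => k _; rewrite /sg /rot; case: e => /=; last by rewrite mul1r.
have -> : (-1) ^+ odd k = expi (k%:R * 2^-1 : R) by rewrite expiX expi_half signr_odd.
rewrite -expiD; case: ltnP => hq.
  have -> : k%:R * 2^-1 + (beta * (tri k)%:R - (h * k)%:R / (2 * q)%:R) =
     k%:R + (beta * (tri k)%:R - ((h + q) * k)%:R / (2 * q)%:R) :> R.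
    by rewrite !(natrM, natrD); field.
  by rewrite expiD expi_nat mul1r.
congr expi; rewrite !natrM natrB //; by field.
Qed.

Lemma gaussE a h : gauss R q a h = Gz R (a%:R : 'Z_(8 * q)) h.
Proof.
have m1 : (1 < 8 * q)%N by lia.
have q0R : q%:R != 0 :> R by rewrite pnatr_eq0 -lt0n.
apply: eq_bigr => k _; rewrite -natrM -natrD ezq_nat //; congr expi.
by rewrite -tri2 !(natrD, natrM); field.
Qed.

(** For E the stationary frequency sits at h = q, where the Gauss sum vanishes by [Gz_half]; setting
    the term to 0 removes its large factor before absolute values are taken. *)
Definition einc' e h : R[i] := if e && (h == q) then 0 else einc e h.

Definition big0 (e : bool) : R := if e then 0 else cabs (inc q T beta 0).

Lemma sum_einc_le e :
  \sum_(0 <= h < 2 * q) cabs (einc' e h) <= big0 e + 40 * q%:R * (ell (2 * q))%:R.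
Proof.
pose c (h : nat) := cabs (inc q T beta h).
have S : \sum_(1 <= h < 2 * q) c h <= 40 * q%:R * (ell (2 * q))%:R.
  apply: (@le_trans _ _ (\sum_(1 <= h < 2 * q) 20 * q%:R * (h%:R^-1 + (2 * q - h)%:R^-1))).
    by rewrite !big_nat; apply: ler_sum => h hh; apply: inc_le.
  rewrite -mulr_sumr big_split /= [X in _ + X]big_nat_rev /= add1n.
  rewrite [X in _ + X](_ : _ = \sum_(1 <= h < 2 * q) h%:R^-1); last first.
    by apply: eq_big_nat => h /andP[h1 h2]; congr (_%:R^-1); lia.
  have := @harmonic_le R (2 * q); rewrite -/(ell _) => H.
  have q0R : 0 <= q%:R :> R by [].
  move: (\sum_(1 <= _ < _) _) H => s H; nra.
case: e; last first.
  rewrite big_ltn //; apply: lerD; first by rewrite /einc' /= einc_rot.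
  apply: le_trans S; rewrite le_eqVlt; apply/orP; left; apply/eqP.
  by apply: eq_bigr => h _; rewrite /einc' /= einc_rot.
rewrite /big0 add0r; apply: le_trans S.
rewrite (big_cat_nat (n := q)) //=; last by rewrite leq_pmull.
have -> : \sum_(0 <= h < q) cabs (einc' true h) = \sum_(q <= h < 2 * q) c h.
  rewrite -{2}[q]add0n big_addn mul2n -addnn addnK !big_nat.
  apply: eq_bigr => h /andP[_ hq]; rewrite /einc' (ltn_eqF hq) /= einc_rot /rot hq.
  by rewrite /c.
have -> : \sum_(q <= h < 2 * q) cabs (einc' true h) = \sum_(1 <= h < q) c h.
  rewrite big_ltn ?{1}/einc' ?eqxx /= ?cabs0 ?add0r ?mul2n -?addnn; last by rewrite -{1}[q]addn0 ltn_add2l.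
  rewrite -{1}[q.+1]add1n big_addn addnK !big_nat; apply: eq_bigr => h /andP[h1 hq].
  rewrite /einc' /= einc_rot /rot ltnNge leq_addl /= addnK.
  by rewrite gtn_eqF ?addnK // -{1}[q]add0n ltn_add2r.
by rewrite addrC -(big_cat_nat (n := q)) //= leq_pmull.
Qed.

Context (n X0 r : nat) (a : nat -> nat) (eps : 'I_4 -> bool).
Hypothesis rq : (r <= q)%N.
Hypothesis ha : forall x, coprime x q -> (q %| a x * x + 1)%N.

(** Expanding the four dual sums leaves, for each choice of frequencies, an incomplete sum over the
    neighbours. [arc_sum_le] bounds it uniformly, so the moduli of the dual sums factor out
    again. *)
Lemma arc_bound (B : R) : 0 <= B -> (kbound q n)%:R <= B ^+ 4 ->
  cabs (\sum_(0 <= y < r | coprime (X0 + y) q)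
     \prod_(i < 4) tsum (eps i) T ((a (X0 + y)%N)%:R / q%:R + beta) *
       expi (- ((a (X0 + y) * n)%:R / q%:R))) <=
  (2 * q)%:R ^- 4 * (B * (1 + 2 * ell q)%:R) *
    \prod_(i < 4) (big0 (eps i) + 40 * q%:R * (ell (2 * q))%:R).
Proof.
move=> B0 hB.
pose F (x : nat) (i : 'I_4) (h : 'I_(2 * q)) := gauss R q (a x) h * einc' (eps i) h.
have tE x i : tsum (eps i) T ((a x)%:R / q%:R + beta) = (2 * q)%:R^-1 * \sum_h F x i h.
  rewrite tsumE big_mkord; congr (_ * _); apply: eq_bigr => h _; rewrite /F /einc'.
  by case: ifP => // /andP[_ /eqP ->]; rewrite gaussE Gz_half // !mul0r.
have E x : \prod_(i < 4) tsum (eps i) T ((a x)%:R / q%:R + beta) * expi (- ((a x * n)%:R / q%:R)) =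
   (2 * q)%:R ^- 4 * \sum_(f : {ffun 'I_4 -> 'I_(2 * q)})
     \prod_(i < 4) einc' (eps i) (f i) * arc_term R q n (fun i => f i) a x.
  rewrite (eq_bigr _ (fun i _ => tE x i)) big_split /= prodr_const card_ord exprVn -mulrA.
  congr (_ * _); rewrite bigA_distr_bigA mulr_suml; apply: eq_bigr => f _.
  by rewrite /arc_term /F big_split /= mulrAC [X in X * _ = _]mulrC mulrA [RHS]mulrC mulrAC; ring.
rewrite (eq_bigr _ (fun y _ => E (X0 + y)%N)) -mulr_sumr cabsM.
have -> : cabs ((2 * q)%:R ^- 4 : R[i]) = (2 * q)%:R ^- 4.
  by rewrite cabsV -natrX cabs_nat natrX.
rewrite -[leRHS]mulrA; apply: ler_wpM2l; first by rewrite invr_ge0 exprn_ge0.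
rewrite exchange_big /=; apply: le_trans (cabs_sum _ _ _) _.
apply: (@le_trans _ _ (\sum_(f : {ffun 'I_4 -> 'I_(2 * q)})
   \prod_(i < 4) cabs (einc' (eps i) (f i)) * (B * (1 + 2 * ell q)%:R))).
  apply: ler_sum => f _; rewrite -mulr_sumr cabsM cabs_prod; apply: ler_wpM2l.
    by apply: prodr_ge0 => i _; apply: cabs_ge0.
  by rewrite -cabs_leE; apply: arc_sum_le.
rewrite -mulr_suml mulrC; apply: ler_wpM2l; first by rewrite mulr_ge0.
rewrite -(bigA_distr_bigA (fun i (h : 'I_(2 * q)) => cabs (einc' (eps i) h))).
apply: ler_prod => i _; rewrite sumr_ge0 => [|h _]; last exact: cabs_ge0.
by rewrite -(big_mkord xpredT (fun h => cabs (einc' (eps i) h))) sum_einc_le.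
Qed.

End ArcBound.

(** * The circle method *)

Section Circle.
Context (R : realType).

(** The arithmetic-geometric mean of K / lam^3, lam, lam, lam. It replaces the fourth root of K by
    an expression linear in K, sharp at lam = K^(1/4). *)
Lemma quartic_amgm (K lam : R) : 0 <= K -> 0 < lam -> K <= ((K / lam ^+ 3 + 3 * lam) / 4) ^+ 4.
Proof.
move=> K0 l0; have l3 : 0 < lam ^+ 3 by apply: exprn_gt0.
set u := K / lam ^+ 3; have -> : K = u * lam ^+ 3 by rewrite /u divfK ?gt_eqF.
have u0 : 0 <= u by rewrite /u divr_ge0 // ltW.
rewrite -subr_ge0 (_ : _ - _ = (u - lam) ^+ 2 * (u ^+ 2 + 14 * (u * lam) + 81 * lam ^+ 2) / 256); last by field.
rewrite divr_ge0 // mulr_ge0 ?sqr_ge0 //.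
by rewrite addr_ge0 ?addr_ge0 ?sqr_ge0 // mulr_ge0 ?sqr_ge0 // mulr_ge0 // ltW.
Qed.

Lemma sum_gcd_div_le (m Q : nat) : (0 < m)%N ->
  \sum_(1 <= q < Q.+1) (gcdn m q)%:R / q%:R <= (tau m)%:R * (ell Q.+1)%:R :> R.
Proof.
move=> m0; apply: (@le_trans _ _ (\sum_(1 <= q < Q.+1) \sum_(d <- divisors m) (if (d %| q)%N then d%:R / q%:R else 0))).
  rewrite big_nat [leRHS]big_nat; apply: ler_sum => q /andP[q1 _].
  have h : gcdn m q \in divisors m by rewrite -dvdn_divisors // dvdn_gcdl.
  rewrite (big_rem _ h) /= dvdn_gcdr lerDl sumr_ge0 // => d _.
  by case: ifP => // _; rewrite divr_ge0.
rewrite exchange_big /= -[tau m]muln1 natrM.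
have -> : (tau m)%:R * 1%:R * (ell Q.+1)%:R = \sum_(d <- divisors m) (ell Q.+1)%:R :> R.
  by rewrite mulr1 big_const_seq count_predT iter_addr addr0 mulr_natl.
rewrite big_seq [leRHS]big_seq; apply: ler_sum => d; rewrite -dvdn_divisors // => dm.
have d0 := dvdn_gt0 m0 dm.
apply: le_trans (harmonic_le R Q.+1).
rewrite -big_mkcond /=.
have H N : \sum_(1 <= q < N.+1 | (d %| q)%N) d%:R / q%:R = \sum_(1 <= k < (N %/ d).+1) (k%:R : R)^-1.
  elim: N => [|N IH]; first by rewrite div0n !big_geq.
  rewrite big_mkcond big_nat_recr //= -big_mkcond /= IH divnS //; case: ifP => dN; last by rewrite addr0.
  rewrite add1n [RHS]big_nat_recr //=; congr (_ + _).
  have -> : N.+1%:R = d%:R * (N %/ d).+1%:R :> R.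
    by rewrite -natrM mulnC; congr (_%:R); rewrite -[LHS](divnK dN) divnS // dN.
  have x0 : (N %/ d).+1%:R != 0 :> R by rewrite pnatr_eq0.
  have y0 : d%:R != 0 :> R by rewrite pnatr_eq0 -lt0n.
  by move: (N %/ d).+1%:R d%:R x0 y0 => x y x0 y0; field; rewrite x0 y0.
rewrite H [leRHS](big_cat_nat (n := (Q %/ d).+1)) //= ?ltnS ?leq_div //.
by rewrite lerDl sumr_ge0 // => i _; rewrite invr_ge0.
Qed.

Lemma harmonic_block_le (p0 k : nat) : (0 < p0)%N ->
  \sum_(p0 <= j < p0 * 2 ^ k) (j%:R : R)^-1 <= k%:R.
Proof.
move=> p00; elim: k => [|k IH]; first by rewrite expn0 muln1 big_geq.
have p2 : (0 < p0 * 2 ^ k)%N by rewrite muln_gt0 p00 expn_gt0.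
rewrite (big_cat_nat (n := (p0 * 2 ^ k)%N)) /= ?leq_pmulr ?expn_gt0 //; last by rewrite leq_mul2l leq_exp2l ?leqnSn ?orbT.
rewrite -natr1; apply: lerD => //.
apply: (@le_trans _ _ (\sum_(p0 * 2 ^ k <= j < p0 * 2 ^ k.+1) (p0 * 2 ^ k)%:R^-1)).
  rewrite big_nat [leRHS]big_nat; apply: ler_sum => j /andP[j1 _].
  by rewrite lef_pV2 ?ler_nat // posrE ltr0n // (leq_trans p2).
rewrite sumr_const_nat expnS mulnCA mul2n -addnn addnK -[_^-1 *+ _]mulr_natr mulVf //.
by rewrite pnatr_eq0 -lt0n.
Qed.

Definition wt (P T j : nat) : R := if (j * T ^ 2 < P)%N then (T ^ 2)%:R else P%:R / j%:R.

Lemma sum_wt_le (P T M : nat) : (0 < T)%N -> (0 < P)%N -> (T ^ 2 %| P)%N -> (M * T < P)%N ->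
  \sum_(0 <= j < M.+1) wt P T j <= 2 * P%:R * (ell T)%:R.
Proof.
move=> T0 P0 /dvdnP[p0 PE] MT.
have T2 : (0 < T ^ 2)%N by rewrite expn_gt0 T0.
have p00 : (0 < p0)%N by move: P0; rewrite PE muln_gt0 => /andP[].
have w0 j : 0 <= wt P T j by rewrite /wt; case: ifP => // _; rewrite divr_ge0.
apply: (@le_trans _ _ (\sum_(0 <= j < p0 * 2 ^ ell T) wt P T j)).
  have le : (M.+1 <= p0 * 2 ^ ell T)%N.
    have : (T < 2 ^ ell T)%N by apply: trunc_log_ltn.
    move: MT; rewrite PE -mulnn => MT; have {}MT : (M < p0 * T)%N by nia.
    by move=> h; apply: leq_trans MT _; rewrite leq_mul2l ltnW ?orbT.
  by rewrite [leRHS](big_cat_nat (n := M.+1)) //= lerDl sumr_ge0.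
rewrite (big_cat_nat (n := p0)) /= ?leq_pmulr ?expn_gt0 //.
have -> : 2 * P%:R * (ell T)%:R = P%:R * (ell T)%:R + P%:R * (ell T)%:R :> R by ring.
apply: lerD.
  apply: (@le_trans _ _ P%:R); last by rewrite ler_peMr // ler1n.
  rewrite big_nat (eq_bigr (fun=> (T ^ 2)%:R)) => [|j /andP[_ jp]].
    by rewrite -big_nat sumr_const_nat subn0 -[_ *+ p0]mulr_natr -natrM mulnC -PE.
  by rewrite /wt PE ltn_pmul2r // jp.
apply: le_trans (ler_wpM2l (ler0n _ P) (harmonic_block_le (ell T) p00)).
rewrite mulr_sumr big_nat [leRHS]big_nat; apply: ler_sum => j /andP[jp _].
by rewrite /wt PE ltn_pmul2r // ltnNge jp.
Qed.

Lemma trunc_sqrt (x : R) : 1 <= x -> exists K : nat, (0 < K)%N /\ K%:R ^+ 2 <= x < K.+1%:R ^+ 2.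
Proof.
move=> x1.
have [N hN] : exists N : nat, x < N.+1%:R ^+ 2.
  exists (Num.bound x); have xb := archi_boundP (le_trans ler01 x1).
  apply: lt_le_trans xb _; rewrite -natrX ler_nat.
  by move: (Num.bound x) => b; nia.
elim: N hN => [|N IH] hN; first by exfalso; move: hN; rewrite expr1n ltNge x1.
by case: (leP (N.+1%:R ^+ 2) x) => h; [exists N.+1; rewrite h hN | apply: IH].
Qed.

(** [inc0_le] with K the integer part of beta^(-1/2): as 1 / beta <= 4 K^2, the bound is at most K +
    5 (4 K) = 21 K. *)
Lemma inc0_sqr_le (q T : nat) (beta : R) : (0 < q)%N -> 0 < beta -> beta <= 1 ->
  beta * T%:R * (4 * q)%:R <= 1 -> cabs (inc q T beta 0) ^+ 2 * beta <= 21 ^+ 2.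
Proof.
move=> q0 bp b1 bT.
have bi1 : 1 <= beta^-1 by rewrite invf_ge1.
have [K [K0 /andP[K1 K2]]] := trunc_sqrt bi1.
have K0R : 1 <= K%:R :> R by rewrite ler1n.
have KbK : K%:R ^+ 2 * beta <= 1 by rewrite -ler_pdivlMr // mul1r.
have bK : beta^-1 <= 4 * K%:R ^+ 2.
  apply: le_trans (ltW K2) _; rewrite -natr1; nra.
have Y := inc0_le q0 (ltW bp) bT K0 bp.
have Y2 : cabs (inc q T beta 0) <= 21 * K%:R.
  apply: le_trans Y _; rewrite invfM.
  have k0 : 0 < K%:R^-1 :> R by rewrite invr_gt0; lra.
  have : beta^-1 * K%:R^-1 <= 4 * K%:R.
    apply: le_trans (ler_wpM2r (ltW k0) bK) _.
    by rewrite expr2 mulrA mulfK // gt_eqF //; lra.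
  by move: (beta^-1 * _) => u; lra.
apply: (@le_trans _ _ ((21 * K%:R) ^+ 2 * beta)).
  by rewrite ler_wpM2r ?(ltW bp) // ler_sqr ?nnegrE ?cabs_ge0 ?mulr_ge0.
by rewrite exprMn -mulrA ler_piMr // sqr_ge0.
Qed.

End Circle.

Lemma kbound_le : exists c : nat, forall q n D : nat, (0 < q)%N -> (tau (8 * q) <= D)%N ->
  (kbound q n <= c * (D ^ 4 * gcdn (8 * n + 4) q * q ^ 11))%N.
Proof.
exists (16 ^ 4 * (4 * 8 ^ 3 * 8))%N => q n D q0 tD.
have g8 : (gcdn (8 * n + 4) (8 * q) <= 8 * gcdn (8 * n + 4) q)%N.
  rewrite gcdnC; apply: leq_trans (gcdn_mull_le 8 q _) _; first by rewrite addn4.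
  by rewrite (gcdnC q) leq_mul2r dvdn_leq ?orbT // dvdn_gcdl.
have t4 : (tau (8 * q) ^ 4 <= D ^ 4)%N by rewrite leq_exp2r.
rewrite /kbound (expnMn 8 q); have -> : (q ^ 11 = q ^ 8 * q ^ 3)%N by rewrite -expnD.
move: (16 ^ 4)%N (8 ^ 3)%N (q ^ 8)%N (q ^ 3)%N (tau _ ^ 4)%N (D ^ 4)%N (gcdn _ (8 * q)) (gcdn _ q) t4 g8.
move=> c e a b t d g g' t4 g8.
rewrite [leqLHS](_ : _ = (c * 4 * e * a * b) * (g * t))%N; last by ring.
rewrite [leqRHS](_ : _ = (c * 4 * e * a * b) * (8 * g' * d))%N; last by ring.
by rewrite leq_mul2l leq_mul ?orbT.
Qed.

Section Coefficient.
Context (R : realType) (eps : 'I_4 -> bool) (i0 : 'I_4) (T n : nat).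
Hypotheses (eps0 : eps i0) (T0 : (0 < T)%N) (nT : (n <= 4 * T ^ 2)%N).

(** On the arc around a / q the offset beta is at most 1 / (q Q); with this order beta T (4q) <= 1,
    as Kusmin-Landau requires. *)
Let Q := (4 * T)%N.
Context (P : nat).
Hypothesis dvP : forall q s, (0 < q <= Q)%N -> (q < s <= 2 * Q)%N -> (q * s %| P)%N.
(** [P] exceeds every difference between a sum of four triangular numbers and [n], so congruence
    modulo [P] is equality; [T2P] gives [sum_wt_le] an exact breakpoint. *)
Hypotheses (P_gt : (64 * T ^ 2 <= P)%N) (T2P : (T ^ 2 %| P)%N).

Let P0 : (0 < P)%N.
Proof. by apply: leq_trans P_gt; rewrite muln_gt0 expn_gt0 T0. Qed.

Let PR : P%:R != 0 :> R. Proof. by rewrite pnatr_eq0 -lt0n. Qed.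

Definition signed_count : R[i] :=
  \sum_(f : {ffun 'I_4 -> 'I_T}) (\sum_(i < 4) tri (f i) == n)%N%:R * \prod_(i < 4) sg R (eps i) (f i).

Let gg (j : nat) : R[i] :=
  \prod_(i < 4) tsum (eps i) T (j%:R / P%:R : R) * expi (- (j%:R / P%:R * n%:R)).

Let expi_sum (f : 'I_4 -> R) : \prod_(i < 4) expi (f i) = expi (\sum_(i < 4) f i).
Proof. by elim/big_ind2: _ => [|x y z t -> ->|//]; rewrite ?expi0 ?expiD. Qed.

Lemma tri_lt k : (k < T)%N -> (2 * tri k <= T ^ 2)%N.
Proof. by move=> kT; rewrite tri2 -mulnn leq_mul // ltnW. Qed.

Lemma coef_circle : \sum_(0 <= j < P) gg j = P%:R * signed_count.
Proof.
transitivity (\sum_(f : {ffun 'I_4 -> 'I_T}) \prod_(i < 4) sg R (eps i) (f i) *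
   \sum_(0 <= j < P) expi (j%:R * ((\sum_(i < 4) tri (f i))%:Z - n%:Z)%:~R / P%:R : R)).
  under [RHS]eq_bigr => f _ do rewrite mulr_sumr.
  rewrite exchange_big /=; apply: eq_bigr => j _; rewrite /gg.
  rewrite (eq_bigr (fun i => \sum_(k < T) sg R (eps i) k * expi (j%:R / P%:R * (tri k)%:R))); last first.
    by move=> i _; rewrite /tsum big_mkord.
  rewrite bigA_distr_bigA mulr_suml; apply: eq_bigr => f _.
  rewrite big_split /= -[LHS]mulrA; congr (_ * _); rewrite expi_sum -expiD; congr expi.
  by rewrite intrB -!pmulrn natr_sum -mulr_sumr; field.
rewrite mulr_sumr; apply: eq_bigr => f _; rewrite sum_expi_frac //.
suff -> : (P %| `|(\sum_(i < 4) tri (f i))%:Z - n%:Z|)%N = (\sum_(i < 4) tri (f i) == n)%N.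
  by rewrite natrM; ring.
have s4 : (2 * \sum_(i < 4) tri (f i) <= 4 * T ^ 2)%N.
  rewrite big_distrr /= (_ : 4 * T ^ 2 = \sum_(i < 4) T ^ 2)%N; last by rewrite sum_nat_const card_ord.
  by apply: leq_sum => i _; apply: tri_lt.
move: (\sum_(i < 4) _)%N s4 => s s4.
have T2 : (0 < T ^ 2)%N by rewrite expn_gt0 T0.
have hP := P_gt; move: (T ^ 2)%N T2 s4 hP nT => t t0 s4 hP nt.
case: (ltngtP s n) => [lt|lt|->]; last by rewrite subrr dvdn0.
  by rewrite distnEr ?(ltnW lt) // gtnNdvd //; lia.
by rewrite distnEl ?(ltnW lt) // gtnNdvd //; lia.
Qed.

Let conj_expi (t : R) : (expi t)^* = expi (- t).
Proof.
have e0 : expi t != 0 by rewrite -normr_eq0 norm_expi oner_eq0.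
by apply: (mulfI e0); rewrite -normCK norm_expi expr1n -expiD subrr expi0.
Qed.

(** Left half arcs are thus complex conjugates of right ones, and one estimate serves both. *)
Let gg_reflect j : (j <= P)%N -> gg (P - j) = (gg j)^*.
Proof.
move=> jP; have E (m : nat) : expi ((P - j)%:R / P%:R * m%:R) = (expi (j%:R / P%:R * m%:R : R))^*.
  rewrite conj_expi natrB // (_ : _ * _ = m%:R + - (j%:R / P%:R * m%:R)); last by field.
  by rewrite expiD expi_nat mul1r.
rewrite /gg rmorphM rmorph_prod; congr (_ * _).
  apply: eq_bigr => i _; rewrite /tsum rmorph_sum; apply: eq_bigr => k _.
  by rewrite rmorphM /= E /sg rmorphXn rmorphN1.
rewrite -[RHS]/((expi (- (j%:R / P%:R * n%:R)))^*).
by rewrite expiN E !conj_expi -expiN !opprK.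
Qed.

Section Denominator.
(** [c] is 0 on right half arcs, with offsets i, and 1 on left ones, with offsets i + 1. [L]
    dominates all logarithms. *)
Context (q c L : nat) (B : R).
Hypotheses (q0 : (0 < q)%N) (qQ : (q <= Q)%N) (c1 : (c <= 1)%N).
Hypotheses (B0 : 0 <= B) (hB : (kbound q n)%:R <= B ^+ 4).
Hypotheses (L0 : (0 < L)%N) (Lq : (ell q <= L)%N) (Lq2 : (ell (2 * q) <= L)%N) (LT : (ell T <= L)%N).

Let X0 := (Q.+1 - q)%N.
Let M := (P %/ (q * Q))%N.
(** The offset [i] lies on the half arc of [x] exactly when (i + 1) q (q + x) <= P. So for a fixed
    [i] the neighbours [x] form an interval of length [rr i] starting at [X0], the least x with Q <
    q + x. *)
Let rr (i : nat) := minn q (P %/ (i.+1 * q) - Q).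

Let gg_arc a k : gg (a * (P %/ q) + k) =
  \prod_(i < 4) tsum (eps i) T (a%:R / q%:R + k%:R / P%:R : R) * expi (- ((a * n)%:R / q%:R)) *
  expi (- (k%:R / P%:R * n%:R)).
Proof.
have qP : (q %| P)%N by apply: dvdn_trans (@dvP q q.+1 _ _); rewrite ?dvdn_mulr ?q0 //=; lia.
have qR : q%:R != 0 :> R by rewrite pnatr_eq0 -lt0n.
have E : (a * (P %/ q) + k)%:R / P%:R = a%:R / q%:R + k%:R / P%:R :> R.
  rewrite natrD natrM mulrDl; congr (_ + _); apply: (mulIf PR); rewrite divfK //.
  by rewrite -{2}(divnK qP) natrM; field.
by rewrite /gg E -[RHS]mulrA -expiD natrM; congr (_ * expi _); field; rewrite qR PR.
Qed.

(** The factor [i0] has lost its stationary frequency and costs only 40 q L. Each other factor is at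
    most Y + Z with Y at most T and 21 beta^(-1/2); one of them is bounded through T, the remaining
    square through the weight. *)
Let prod_le (i : nat) : (i + c <= M)%N ->
  \prod_(l < 4) (big0 q T ((i + c)%:R / P%:R : R) (eps l) + 40 * q%:R * (ell (2 * q))%:R) <=
  40 * q%:R * L%:R * (161 ^+ 3 * T%:R * L%:R ^+ 3 * wt R P T (i + c)).
Proof.
set j := (i + c)%N => jM; set beta : R := j%:R / P%:R.
have P0R : 0 < P%:R :> R by rewrite ltr0n.
have q1 : 1 <= q%:R :> R by rewrite ler1n.
have L1 : 1 <= L%:R :> R by rewrite ler1n.
have T1 : 1 <= T%:R :> R by rewrite ler1n.
have qT : q%:R <= 4 * T%:R :> R by rewrite -natrM ler_nat.
have jq : (j * (q * Q) <= P)%N by rewrite -leq_divRL // muln_gt0 q0 /Q muln_gt0 T0.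
have b0 : 0 <= beta by rewrite divr_ge0.
have bE : beta * P%:R = j%:R by rewrite divfK.
have bT : beta * T%:R * (4 * q)%:R <= 1.
  rewrite -(ler_pM2r P0R) mul1r (_ : _ * P%:R = (j * (q * Q))%:R) ?ler_nat //.
  by rewrite /Q !natrM -bE; ring.
set Y := cabs (inc q T beta 0); set Z := 40 * q%:R * L%:R.
have Y0 : 0 <= Y by apply: cabs_ge0.
have Z0 : 0 <= Z by rewrite !mulr_ge0.
have ZL : 40 * q%:R * (ell (2 * q))%:R <= Z by rewrite ler_wpM2l ?mulr_ge0 // ler_nat.
have bg0 l : 0 <= big0 q T beta (eps l) by rewrite /big0; case: ifP => // _; apply: cabs_ge0.
have bgY l : big0 q T beta (eps l) <= Y by rewrite /big0; case: ifP.
apply: (@le_trans _ _ (Z * (Y + Z) ^+ 3)).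
  rewrite (bigD1 i0) //=; apply: ler_pM.
  - by rewrite addr_ge0 ?mulr_ge0.
  - by apply: prodr_ge0 => l _; rewrite addr_ge0 ?mulr_ge0.
  - by rewrite /big0 eps0 add0r.
  apply: (@le_trans _ _ (\prod_(l < 4 | l != i0) (Y + Z))).
    by apply: ler_prod => l _; rewrite addr_ge0 ?mulr_ge0 //= lerD.
  rewrite prodr_const (_ : #|_| = 3%N) //.
  by have := cardC1 i0; rewrite card_ord.
apply: ler_wpM2l => //.
have YT : Y <= T%:R by apply: inc0_le_T.
(* 161 = 1 + 40 * 4, from Y <= T and q <= 4T. *)
have s1 : Y + Z <= 161 * T%:R * L%:R by rewrite /Z; nra.
have s0 : 0 <= Y + Z by rewrite addr_ge0.
have TL : 0 <= 161 * T%:R * L%:R :> R by rewrite !mulr_ge0.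
rewrite /wt; case: ifP => hj.
  apply: (@le_trans _ _ ((161 * T%:R * L%:R) ^+ 3)); first by rewrite lerXn2r ?nnegrE.
  by rewrite natrX le_eqVlt; apply/orP; left; apply/eqP; ring.
have j0 : (0 < j)%N by rewrite lt0n; apply: contraFneq hj => ->.
have bp : 0 < beta by rewrite divr_gt0 ?ltr0n.
have b1 : beta <= 1.
  rewrite ler_pdivrMr // mul1r ler_nat; apply: leq_trans jq.
  by rewrite leq_pmulr // muln_gt0 q0 /Q muln_gt0 T0.
have Y2 := inc0_sqr_le q0 bp b1 bT; rewrite -/Y in Y2.
have q2 : q%:R ^+ 2 * beta <= 1.
  rewrite -(ler_pM2r P0R) mul1r -mulrA bE -natrX -natrM ler_nat.
  by apply: leq_trans jq; rewrite mulnC leq_mul2l -mulnn leq_mul2l qQ !orbT.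
have -> : P%:R / j%:R = beta^-1 by rewrite invf_div.
apply: (@le_trans _ _ (161 * T%:R * L%:R * (161 ^+ 2 * L%:R ^+ 2 * beta^-1))); last first.
  by rewrite le_eqVlt; apply/orP; left; apply/eqP; ring.
rewrite exprS; apply: ler_pM => //; first by rewrite sqr_ge0.
rewrite ler_pdivlMr //.
have h1 : (Y + Z) ^+ 2 <= 2 * Y ^+ 2 + 2 * Z ^+ 2 by have := sqr_ge0 (Y - Z); nra.
apply: le_trans (ler_wpM2r b0 h1) _; rewrite mulrDl /Z.
have -> : 2 * (40 * q%:R * L%:R) ^+ 2 * beta = 2 * (40 * L%:R) ^+ 2 * (q%:R ^+ 2 * beta) by ring.
have L2 : 1 <= L%:R ^+ 2 :> R by rewrite exprn_ege1.
have h2 : 2 * (40 * L%:R) ^+ 2 * (q%:R ^+ 2 * beta) <= 2 * (40 * L%:R) ^+ 2.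
  by apply: ler_piMr => //; apply: mulr_ge0 => //; apply: sqr_ge0.
have -> : 2 * Y ^+ 2 * beta = 2 * (Y ^+ 2 * beta) by rewrite mulrA.
apply: (@le_trans _ _ (82 ^+ 2 * L%:R ^+ 2)); last first.
  by apply: ler_wpM2r; [exact: sqr_ge0 | apply: lerXn2r; rewrite ?nnegrE // ler_nat].
move: h2 Y2 L2; move: (2 * _ * (_ * beta)) (Y ^+ 2 * beta) => u y2.
by rewrite !exprMn; move: (L%:R ^+ 2) => l2 h2 Y2 L2; lra.
Qed.

Lemma denominator_le :
  cabs (\sum_(1 <= x < Q.+1 | coprime x q && (Q < q + x)%N)
    \sum_(0 <= i < farc P q x) gg (alpha q x * (P %/ q) + (i + c))) <=
  15 * 161 ^+ 3 * q%:R ^- 3 * B * T%:R * P%:R * L%:R ^+ 6.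
Proof.
have q1 : 1 <= q%:R :> R by rewrite ler1n.
have L1 : 1 <= L%:R :> R by rewrite ler1n.
have T1 : 1 <= T%:R :> R by rewrite ler1n.
have Q0 : (0 < Q)%N by rewrite /Q muln_gt0 T0.
have qX : (q + X0 = Q.+1)%N by rewrite /X0; lia.
have rE i y : (y < q)%N -> (y < rr i)%N = (i < farc P q (X0 + y))%N.
  move=> yq; rewrite /farc addnA qX leq_divRL ?muln_gt0 ?q0 // /rr leq_min yq /= ltn_subRL.
  rewrite leq_divRL ?muln_gt0 ?q0 //; congr (_ <= _)%N; rewrite addSn; ring.
have farcM y : (farc P q (X0 + y) <= M)%N.
  by rewrite /farc /M addnA qX leq_div2l ?muln_gt0 ?q0 // leq_mul2l addSn (leq_trans (leq_addr y Q)) ?leqnSn ?orbT.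
have -> : \sum_(1 <= x < Q.+1 | coprime x q && (Q < q + x)%N)
      \sum_(0 <= i < farc P q x) gg (alpha q x * (P %/ q) + (i + c)) =
   \sum_(0 <= i < M) \sum_(0 <= y < rr i | coprime (X0 + y) q)
      gg (alpha q (X0 + y) * (P %/ q) + (i + c)).
  rewrite (big_cat_nat (n := X0)) /=; [|by rewrite /X0; lia|by rewrite /X0; lia].
  rewrite big_nat_cond big1 ?add0r => [|x]; last by move=> /andP[/andP[h1 h2] /andP[_ h3]]; move: h2 h3; rewrite /X0; lia.
  rewrite -{1}[X0]add0n big_addn (_ : Q.+1 - X0 = q)%N; last by rewrite -qX addnK.
  transitivity (\sum_(0 <= y < q) \sum_(0 <= i < M)
     if coprime (X0 + y) q && (y < rr i)%N then gg (alpha q (X0 + y) * (P %/ q) + (i + c)) else 0).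
    rewrite big_mkcond /=; apply: eq_big_nat => y /andP[_ yq]; rewrite [(y + X0)%N]addnC addnA qX.
    rewrite (_ : (Q < Q.+1 + y)%N) ?andbT; last by lia.
    case: ifP => cy /=; last by rewrite big1.
    rewrite (big_nat_widen _ _ _ _ _ (farcM y)) big_mkcond /=; apply: eq_bigr => i _.
    by rewrite rE.
  rewrite exchange_big_nat /=; apply: eq_bigr => i _.
  rewrite [RHS](big_nat_widen _ _ q) ?geq_minl // [RHS]big_mkcond /=.
  by [].
apply: le_trans (cabs_sum _ _ _) _.
pose K := (2 * q)%:R ^- 4 * (B * (1 + 2 * ell q)%:R) * (40 * q%:R * L%:R * (161 ^+ 3 * T%:R * L%:R ^+ 3)).
have K0 : 0 <= (2 * q)%:R ^- 4 * (B * (1 + 2 * ell q)%:R).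
  by rewrite mulr_ge0 ?invr_ge0 ?exprn_ge0 // mulr_ge0.
apply: (@le_trans _ _ (\sum_(0 <= i < M) K * wt R P T (i + c))).
  rewrite big_nat [leRHS]big_nat; apply: ler_sum => i /andP[_ iM].
  have icM : (i + c <= M)%N by apply: leq_trans (leq_add (leqnn i) c1) _; rewrite addn1.
  set beta : R := (i + c)%:R / P%:R.
  have b0 : 0 <= beta by rewrite divr_ge0.
  have bT : beta * T%:R * (4 * q)%:R <= 1.
    have P0R : 0 < P%:R :> R by rewrite ltr0n.
    rewrite -(ler_pM2r P0R) mul1r (_ : _ * P%:R = ((i + c) * (q * Q))%:R).
      by rewrite ler_nat -leq_divRL ?muln_gt0 ?q0.
    have bE : beta * P%:R = (i + c)%:R by rewrite divfK.
    by rewrite /Q !natrM -bE; ring.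
  rewrite (eq_bigr _ (fun y _ => gg_arc _ _)) -mulr_suml cabsM cabs_expi mulr1.
  have rq : (rr i <= q)%N by rewrite /rr geq_minl.
  apply: le_trans (arc_bound q0 b0 bT X0 eps rq (fun x => @alphaP q x q0) B0 hB) _.
  rewrite /K -[leRHS]mulrA; apply: ler_wpM2l => //.
  by rewrite -[leRHS]mulrA; apply: prod_le.
rewrite -mulr_sumr.
have wS : \sum_(0 <= i < M) wt R P T (i + c) <= 2 * P%:R * L%:R.
  apply: (@le_trans _ _ (2 * P%:R * (ell T)%:R)); last by rewrite ler_wpM2l ?mulr_ge0 // ler_nat.
  apply: le_trans (sum_wt_le R (M := M) T0 P0 _ _).
  - have w0 j : 0 <= wt R P T j by rewrite /wt; case: ifP => // _; rewrite divr_ge0.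
    case: (c) c1 => [|[|//]] _; first by under eq_bigr => i _ do rewrite addn0; rewrite big_nat_recr //= lerDl.
    by under eq_bigr => i _ do rewrite addn1; rewrite [leRHS]big_nat_recl //= lerDr.
  - by [].
  - have h : (M * T * 4 <= P)%N.
      apply: leq_trans (leq_trunc_div P (q * Q)); rewrite -/M -mulnA leq_mul2l /Q.
      by rewrite (mulnC T) leq_pmull ?orbT.
    by have p0 := P0; move: h p0; move: (M * T)%N (P) => u p; clear; lia.
(* 15 = 3 * 40 * 2 / 2^4: from 1 + 2 [ell q] <= 3 L, from the factor [i0], from the sum of the
   weights, and from (2q)^-4. The [q] in 40 q L turns q^-4 into q^-3. *)
have -> : 15 * 161 ^+ 3 * q%:R ^- 3 * B * T%:R * P%:R * L%:R ^+ 6 =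
   (2 * q)%:R ^- 4 * (B * (3 * L%:R)) * (40 * q%:R * L%:R * (161 ^+ 3 * T%:R * L%:R ^+ 3)) * (2 * P%:R * L%:R).
  by rewrite natrM; field; rewrite gt_eqF //; lra.
have K1 : 0 <= 40 * q%:R * L%:R * (161 ^+ 3 * T%:R * L%:R ^+ 3) :> R.
  by rewrite !mulr_ge0 // exprn_ge0.
apply: ler_pM; [| | |exact: wS].
- by rewrite /K; apply: mulr_ge0; [exact: K0|exact: K1].
- by apply: sumr_ge0 => i _; rewrite /wt; case: ifP => // _; rewrite divr_ge0.
rewrite /K; apply: ler_wpM2r; first exact: K1.
apply: ler_wpM2l; first by rewrite invr_ge0 exprn_ge0.
apply: ler_wpM2l; first exact: B0.
rewrite -natrM ler_nat; have := Lq; move: (ell q) L0; clear; lia.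
Qed.

End Denominator.

Let cabs_conj (z : R[i]) : cabs z^* = cabs z.
Proof. by apply: (@complexI R); rewrite -!cabsE norm_conjC. Qed.

(** With B = q^3 [bq q] the powers of q in [denominator_le] cancel. [bq] is linear in kbound / q^12,
    which is a divisor factor times gcd(8n + 4, q) / q and sums to a logarithm. The 30 is 15 for
    each kind of half arc. *)
Lemma signed_count_le (kc L D : nat) (lam : R) : 0 < lam ->
  (forall q m D : nat, (0 < q)%N -> (tau (8 * q) <= D)%N ->
    (kbound q m <= kc * (D ^ 4 * gcdn (8 * m + 4) q * q ^ 11))%N) ->
  (0 < L)%N -> (forall q, (q <= 2 * Q)%N -> (ell q <= L)%N) ->
  (forall q, (0 < q <= Q)%N -> (tau (8 * q) <= D)%N) -> (tau (8 * n + 4) <= D)%N ->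
  cabs signed_count <= 30 * 161 ^+ 3 * T%:R * L%:R ^+ 6 *
    ((kc * D ^ 5 * L)%:R / lam ^+ 3 + 3 * lam * Q%:R).
Proof.
move=> l0 kcP L0 hL hD hD2.
have Q0 : (0 < Q)%N by rewrite /Q muln_gt0 T0.
have l3 : 0 < lam ^+ 3 by apply: exprn_gt0.
pose Kq q : R := (kbound q n)%:R / q%:R ^+ 12.
pose bq q : R := (Kq q / lam ^+ 3 + 3 * lam) / 4.
have Kq0 q : 0 <= Kq q by rewrite /Kq divr_ge0 // exprn_ge0.
have bq0 q : 0 <= bq q.
  rewrite /bq divr_ge0 // addr_ge0 //; first by rewrite divr_ge0 // ltW.
  by rewrite mulr_ge0 // ltW.
have PR0 : 0 < P%:R :> R by rewrite ltr0n.
pose C1 : R := 15 * 161 ^+ 3.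
have den (c q : nat) : (c <= 1)%N -> (0 < q <= Q)%N ->
   cabs (\sum_(1 <= x < Q.+1 | coprime x q && (Q < q + x)%N)
    \sum_(0 <= i < farc P q x) gg (alpha q x * (P %/ q) + (i + c))) <=
   C1 * bq q * T%:R * P%:R * L%:R ^+ 6.
  move=> c1 /andP[q0 qQ]; have q0R : 0 < q%:R :> R by rewrite ltr0n.
  have B0 : 0 <= q%:R ^+ 3 * bq q by rewrite mulr_ge0 // exprn_ge0 // ltW.
  have hB : (kbound q n)%:R <= (q%:R ^+ 3 * bq q) ^+ 4.
    rewrite exprMn -exprM mulrC -ler_pdivrMr ?exprn_gt0 //.
    exact: quartic_amgm.
  have hq2 : (ell (2 * q) <= L)%N by apply: hL; rewrite leq_mul2l qQ orbT.
  have hq1 : (ell q <= L)%N by apply: hL; apply: leq_trans qQ _; rewrite leq_pmull.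
  have hT : (ell T <= L)%N by apply: hL; rewrite /Q mulnA leq_pmull.
  apply: le_trans (denominator_le q0 qQ c1 B0 hB L0 hq1 hq2 hT) _.
  rewrite le_eqVlt; apply/orP; left; apply/eqP; rewrite /C1.
  by move: (161 ^+ 3) (bq q) => u v; field; rewrite gt_eqF.
have main : cabs (P%:R * signed_count) <=
    \sum_(1 <= q < Q.+1) (C1 * bq q * T%:R * P%:R * L%:R ^+ 6 + C1 * bq q * T%:R * P%:R * L%:R ^+ 6).
  rewrite -coef_circle (farey_dissection gg dvP Q0).
  apply: le_trans (cabs_sum _ _ _) _; rewrite big_nat [leRHS]big_nat.
  apply: ler_sum => q /andP[q0 qQ]; have hq : (0 < q <= Q)%N by rewrite q0.
  rewrite big_split /=; apply: le_trans (cabsD _ _) _; apply: lerD.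
    apply: le_trans (den 0%N q isT hq); rewrite le_eqVlt; apply/orP; left; apply/eqP.
    congr cabs; apply: eq_bigr => x _; apply: eq_bigr => i _; by rewrite addn0.
  apply: le_trans (den 1%N q isT hq); rewrite le_eqVlt; apply/orP; left; apply/eqP.
  rewrite -[RHS]cabs_conj; congr cabs; rewrite rmorph_sum; apply: eq_bigr => x /andP[cx _].
  rewrite rmorph_sum; apply: eq_big_nat => i /andP[_ hi].
  rewrite addn1 -subnDA gg_reflect //.
  have qP : (q %| P)%N by apply: dvdn_trans (@dvP q q.+1 _ _); rewrite ?dvdn_mulr ?q0 //=; lia.
  have h1 : (i.+1 <= P %/ q)%N.
    by apply: leq_trans hi _; rewrite /farc leq_div2l // leq_pmulr // addn_gt0 q0.
  rewrite -[leqRHS](divnK qP) mulnC; have := alpha_lt q0 cx.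
  move: (alpha q x) h1 => a; move: (P %/ q)%N => p; clear; nia.
have S : \sum_(1 <= q < Q.+1) bq q <= ((kc * D ^ 5 * L)%:R / lam ^+ 3 + 3 * lam * Q%:R).
  have kqle q : (0 < q <= Q)%N -> Kq q <= (kc * D ^ 4)%:R * ((gcdn (8 * n + 4) q)%:R / q%:R).
    move=> hq; have /andP[q0 _] := hq; have q0R : 0 < q%:R :> R by rewrite ltr0n.
    rewrite /Kq ler_pdivrMr ?exprn_gt0 //.
    have -> : (kc * D ^ 4)%:R * ((gcdn (8 * n + 4) q)%:R / q%:R) * q%:R ^+ 12 =
       (kc * (D ^ 4 * gcdn (8 * n + 4) q * q ^ 11))%:R :> R.
      rewrite !(natrM, natrX); move: (kc%:R) ((gcdn _ q)%:R) => u v.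
      by field; rewrite gt_eqF.
    by rewrite ler_nat; apply: kcP => //; apply: hD.
  have D0 : 0 <= (kc * D ^ 4)%:R :> R by [].
  have KS : \sum_(1 <= q < Q.+1) Kq q <= (kc * D ^ 5 * L)%:R.
    apply: (@le_trans _ _ ((kc * D ^ 4)%:R * \sum_(1 <= q < Q.+1) (gcdn (8 * n + 4) q)%:R / q%:R)).
      rewrite mulr_sumr big_nat [leRHS]big_nat; apply: ler_sum => q /andP[q0 qQ].
      by apply: kqle; rewrite q0.
    have m0 : (0 < 8 * n + 4)%N by rewrite addn4.
    apply: le_trans (ler_wpM2l D0 (sum_gcd_div_le R Q m0)) _.
    rewrite -!natrM ler_nat (expnS D 4) -mulnA (mulnC D) -!mulnA !leq_mul2l leq_mul ?orbT //.
    by apply: hL; rewrite mul2n -addnn -add1n leq_add2r.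
  rewrite /bq -mulr_suml big_split /= -mulr_suml sumr_const_nat subSS subn0.
  have KS' := ler_wpM2r (ltW (_ : 0 < (lam ^+ 3)^-1)) KS; rewrite invr_gt0 in KS'.
  have {KS'} KS' := KS' l3.
  have X0 : 0 <= (kc * D ^ 5 * L)%:R / lam ^+ 3 by rewrite divr_ge0 // ltW.
  have Y0 : 0 <= lam * Q%:R by rewrite mulr_ge0 // ltW.
  rewrite -[(3 * lam) *+ Q]mulr_natr -[3 * lam * Q%:R]mulrA.
  move: KS' X0 Y0; move: (_ / lam ^+ 3) (_ / lam ^+ 3) (lam * Q%:R) => u v w; lra.
rewrite -(ler_pM2l PR0) -{1}[P%:R](@cabs_nat R) -cabsM; apply: le_trans main _.
have -> : \sum_(1 <= q < Q.+1) (C1 * bq q * T%:R * P%:R * L%:R ^+ 6 + C1 * bq q * T%:R * P%:R * L%:R ^+ 6) =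
   (\sum_(1 <= q < Q.+1) bq q) * (2 * C1 * T%:R * P%:R * L%:R ^+ 6).
  by rewrite mulr_suml; apply: eq_bigr => q _; ring.
have C10 : 0 <= C1 by rewrite /C1 mulr_ge0 // exprn_ge0.
apply: le_trans (ler_wpM2r _ S) _.
  by rewrite !mulr_ge0 // exprn_ge0.
rewrite le_eqVlt; apply/orP; left; apply/eqP; rewrite /C1.
by move: (161 ^+ 3) (_ + _ * Q%:R) => u v; ring.
Qed.

End Coefficient.

(** * Hexagonal numbers *)

Lemma sum_ffun4 (V : nmodType) (T : nat) (F : nat -> nat -> nat -> nat -> V) :
  \sum_(f : {ffun 'I_4 -> 'I_T}) F (f (inord 0)) (f (inord 1)) (f (inord 2)) (f (inord 3)) =
  \sum_(0 <= a < T) \sum_(0 <= b < T) \sum_(0 <= c < T) \sum_(0 <= d < T) F a b c d.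
Proof.
pose g (x : 'I_T * ('I_T * ('I_T * 'I_T))) : {ffun 'I_4 -> 'I_T} :=
  [ffun i : 'I_4 => nth x.1 [:: x.1; x.2.1; x.2.2.1; x.2.2.2] i].
have n0 : (inord 0 : 'I_4) = 0%N :> nat by rewrite inordK.
have n1 : (inord 1 : 'I_4) = 1%N :> nat by rewrite inordK.
have n2 : (inord 2 : 'I_4) = 2%N :> nat by rewrite inordK.
have n3 : (inord 3 : 'I_4) = 3%N :> nat by rewrite inordK.
rewrite (reindex g) /=; last first.
  exists (fun f : {ffun 'I_4 -> 'I_T} => (f (inord 0), (f (inord 1), (f (inord 2), f (inord 3))))).
    by move=> [a [b [c d]]] _; rewrite /g !ffunE n0 n1 n2 n3.
  move=> f _; apply/ffunP => i; rewrite /g !ffunE /=.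
  by case: i => [[|[|[|[|i]]]] lt] //=; congr (f _); apply: val_inj; rewrite /= inordK.
rewrite -(pair_bigA _ (fun a y => F (g (a, y) (inord 0)) (g (a, y) (inord 1)) (g (a, y) (inord 2)) (g (a, y) (inord 3)))) /=.
rewrite big_mkord; apply: eq_bigr => a _.
rewrite -(pair_bigA _ (fun b y => F (g (a, (b, y)) (inord 0)) (g (a, (b, y)) (inord 1)) (g (a, (b, y)) (inord 2)) (g (a, (b, y)) (inord 3)))) /=.
rewrite big_mkord; apply: eq_bigr => b _.
rewrite -(pair_bigA _ (fun c d => F (g (a, (b, (c, d))) (inord 0)) (g (a, (b, (c, d))) (inord 1)) (g (a, (b, (c, d))) (inord 2)) (g (a, (b, (c, d))) (inord 3)))) /=.
rewrite big_mkord; apply: eq_bigr => c _; rewrite big_mkord; apply: eq_bigr => d _.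
by rewrite /g !ffunE n0 n1 n2 n3.
Qed.

Lemma sum_ord4 (f : 'I_4 -> nat) :
  (\sum_(i < 4) f i = f (inord 0) + f (inord 1) + (f (inord 2) + f (inord 3)))%N.
Proof.
rewrite !big_ord_recr big_ord0 /= add0n addnA.
by congr (_ + _ + _ + _)%N; congr f; apply: val_inj; rewrite /= inordK.
Qed.

Definition reps (n T : nat) : pred {ffun 'I_4 -> 'I_T} := fun f => (\sum_(i < 4) tri (f i) == n)%N.

Lemma card_reps (n T : nat) : (2 * n < T ^ 2)%N ->
  (\sum_(f : {ffun 'I_4 -> 'I_T}) reps n f = sigma (2 * n + 1))%N.
Proof.
move=> nT; rewrite /sigma -(four_triangulars nT).
rewrite -(sum_ffun4 T (fun a b c d => (tri a + tri b + (tri c + tri d) == n) : nat)).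
by apply: eq_bigr => f _; rewrite /reps sum_ord4.
Qed.

(** The truncated predecessor sends 0 to 0, the one even index that is needed. *)
Definition hexidx (l : nat) : nat := (2 * l).-1.

Lemma tri_hexidx l : tri (hexidx l) = p6 l.
Proof.
apply/eqP; rewrite -(eqn_pmul2l (isT : 0 < 2)%N) tri2 /hexidx /p6; case: l => [//|l].
by rewrite mulnS /= -mulnn; apply/eqP; nia.
Qed.

Lemma lt_of_tri (n T k : nat) : (2 * n < T ^ 2)%N -> (tri k <= n)%N -> (k < T)%N.
Proof.
move=> nT h; rewrite ltnNge; apply/negP => Tc; have := tri2 k; rewrite -mulnn in nT.
by have := leq_mul Tc (leqW Tc); move: nT h; clear; nia.
Qed.

Definition hexpos (k : nat) : bool := (k == 0)%N || odd k.

Lemma r6_reps (n T : nat) : (2 * n < T ^ 2)%N ->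
  (r6 n = \sum_(f : {ffun 'I_4 -> 'I_T} | reps n f) [forall i, hexpos (f i)])%N.
Proof.
move=> nT.
have T0 : (0 < T)%N by case: T nT.
have lt l : (p6 l <= n)%N -> (hexidx l < T)%N by rewrite -tri_hexidx; apply: lt_of_tri.
pose h (l : 4.-tuple nat) : {ffun 'I_4 -> 'I_T} := [ffun i => insubd (Ordinal T0) (hexidx (tnth l i))].
have hv (l : 4.-tuple nat) (i : 'I_4) : r6_set n l -> h l i = hexidx (tnth l i) :> nat.
  move=> hl; rewrite ffunE val_insubd lt //; move: hl; rewrite /r6_set /= => <-.
  by rewrite (bigD1 i) //= leq_addr.
have -> : (\sum_(f : {ffun 'I_4 -> 'I_T} | reps n f) [forall i, hexpos (f i)] =
   size [seq f <- enum {ffun 'I_4 -> 'I_T} | reps n f && [forall i, hexpos (f i)]])%N.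
  rewrite size_filter -sum1_count [RHS]big_mkcond [RHS]big_enum /= big_mkcond /=.
  by apply: eq_bigr => f _; case: (reps n f) => //=; case: [forall i, _].
have memE (l : 4.-tuple nat) : (l \in fset_set (r6_set n)) = (l \in r6_set n) by apply/in_fset_set/finite_r6_set.
rewrite /r6 -[LHS](size_map h); apply: perm_size; apply: uniq_perm.
- rewrite map_inj_in_uniq ?fset_uniq // => l l' hl hl' e.
  have l1 : r6_set n l by move: hl; rewrite memE => /set_mem.
  have l2 : r6_set n l' by move: hl'; rewrite memE => /set_mem.
  apply: eq_from_tnth => i; have := hv l i l1; rewrite e hv // /hexidx.
  by move: (tnth l i) (tnth l' i) => x y; clear; lia.
- by rewrite filter_uniq // enum_uniq.
move=> f; rewrite mem_filter mem_enum andbT; apply/mapP/andP => [[l hl ->]|[rf /forallP pf]].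
  have l1 : r6_set n l by move: hl; rewrite memE => /set_mem.
  split; last by apply/forallP => i; rewrite hv // /hexpos /hexidx; case: (tnth l i) => // x; rewrite mulnS /= oddM.
  rewrite /reps; apply/eqP; rewrite -[RHS]l1; apply: eq_bigr => i _; by rewrite hv // tri_hexidx.
have hu i : hexidx (uphalf (f i)) = f i.
  by have := pf i; rewrite /hexpos /hexidx; move: (f i : nat) => x; clear; lia.
pose l : 4.-tuple nat := [tuple uphalf (f i) | i < 4].
have hl : r6_set n l.
  rewrite /r6_set /= -(eqP rf); apply: eq_bigr => i _.
  by rewrite tnth_mktuple -tri_hexidx hu.
exists l; first by rewrite memE; apply/mem_set.
by apply/ffunP => i; apply: ord_inj; rewrite (hv l i hl) tnth_mktuple hu.
Qed.

Lemma prod_diff_le (R : realType) (a b : 'I_4 -> R) : (forall i, 0 <= a i <= 1) -> (forall i, 0 <= b i <= 1) ->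
  `|\prod_(i < 4) a i - \prod_(i < 4) b i| <= \sum_(i < 4) `|a i - b i|.
Proof.
move=> ha hb; have step (x1 y1 z1 x2 y2 z2 : R) :
    [/\ 0 <= x1 <= 1, 0 <= y1 <= 1 & `|x1 - y1| <= z1] ->
    [/\ 0 <= x2 <= 1, 0 <= y2 <= 1 & `|x2 - y2| <= z2] ->
    [/\ 0 <= x1 * x2 <= 1, 0 <= y1 * y2 <= 1 & `|x1 * x2 - y1 * y2| <= z1 + z2].
  case=> /andP[p1 p2] /andP[p5 p6] h3 [/andP[p3 p4] /andP[p7 p8] h6].
  split; try by apply/andP; split; [exact: mulr_ge0 | exact: mulr_ile1].
  have -> : x1 * x2 - y1 * y2 = (x1 - y1) * x2 + y1 * (x2 - y2) by ring.
  apply: le_trans (ler_normD _ _) _; apply: lerD; rewrite normrM.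
    by apply: le_trans h3; rewrite ler_piMr // ger0_norm.
  by apply: le_trans h6; rewrite ler_piMl // ger0_norm.
have [_ _ //] : [/\ 0 <= \prod_(i < 4) a i <= 1, 0 <= \prod_(i < 4) b i <= 1 &
   `|\prod_(i < 4) a i - \prod_(i < 4) b i| <= \sum_(i < 4) `|a i - b i| ].
apply: (big_ind3 (fun x y z : R => [/\ 0 <= x <= 1, 0 <= y <= 1 & `|x - y| <= z])).
- by rewrite subrr normr0 lexx ler01 lexx.
- by move=> *; apply: step.
by move=> i _; split.
Qed.

Definition scount (R : realType) (e : 'I_4 -> bool) (n T : nat) : R :=
  \sum_(f : {ffun 'I_4 -> 'I_T} | reps n f) \prod_(i < 4) (-1) ^+ (e i && odd (f i)).

Lemma cabs_signed_count (R : realType) (e : 'I_4 -> bool) (n T : nat) :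
  cabs (signed_count R e T n) = `|scount R e n T|.
Proof.
have -> : signed_count R e T n = (scount R e n T)%:C.
  rewrite /signed_count /scount rmorph_sum /= [RHS]big_mkcond /=; apply: eq_bigr => f _.
  rewrite /reps; case: eqP => _; rewrite ?mul0r // mul1r rmorph_prod.
  by apply: eq_bigr => i _; rewrite /sg rmorphXn rmorphN1.
by apply: (@complexI R); rewrite -cabsE normc_def /= expr0n /= addr0 sqrtr_sqr.
Qed.

(** Given (a, b), the completions (c, d) are counted by Jacobi's theorem as [fchi] of a number 4m +
    1, which is at most its number of divisors. *)
Lemma quad_zero_le (P : nat -> nat -> bool) (n T D : nat) : (2 * n < T ^ 2)%N ->
  (forall m, (m <= n)%N -> (tau (4 * m + 1) <= D)%N) ->
  (\sum_(0 <= a < T) \sum_(0 <= b < T) \sum_(0 <= c < T) \sum_(0 <= d < T)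
     (P a b && (tri a + tri b + (tri c + tri d) == n)) <= D * \sum_(0 <= a < T) \sum_(0 <= b < T) P a b)%N.
Proof.
move=> nT hD; rewrite big_distrr /=; apply: leq_sum => a _; rewrite big_distrr /=; apply: leq_sum => b _.
case: (P a b) => /=; last by rewrite big1 // => c _; rewrite big1.
rewrite muln1; case: (leqP (tri a + tri b) n) => h; last first.
  rewrite big1 // => c _; rewrite big1 // => d _; apply/eqP; rewrite eqb0; apply/eqP.
  by move: h; clear; lia.
apply: (@leq_trans (\sum_(0 <= c < T) \sum_(0 <= d < T) (tri c + tri d == n - (tri a + tri b)))%N).
  apply: leq_sum => c _; apply: leq_sum => d _.
  by case: eqP => // e; rewrite (_ : (_ == _) = true) //; apply/eqP; move: e; clear; lia.
have mn : (n - (tri a + tri b) <= n)%N by apply: leq_subr.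
move: (n - _)%N mn => m mn.
rewrite size_tri_pairs; last by apply: leq_ltn_trans nT; rewrite leq_mul2l mn orbT.
apply: leq_trans (hD m mn); rewrite -(ler_nat int) natz opairs_fchi; last by rewrite addn1 /= oddM.
rewrite /fchi -sum1_size natr_sum; apply: ler_sum => d _.
by rewrite /chi4; case: ifP => // _; case: ifP.
Qed.

Lemma zero_count_le (n T D : nat) (i : 'I_4) : (2 * n < T ^ 2)%N ->
  (forall m, (m <= n)%N -> (tau (4 * m + 1) <= D)%N) ->
  (\sum_(f : {ffun 'I_4 -> 'I_T} | reps n f) ((f i : nat) == 0) <= D * T)%N.
Proof.
move=> nT hD.
have T0 : (0 < T)%N by case: T nT.
have s1 : (\sum_(0 <= a < T) \sum_(0 <= b < T) (a == 0) = T)%N.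
  case: T T0 {nT} => // t _; rewrite big_nat_recl //= sum_nat_const_nat subn0 muln1.
  by rewrite big1 ?addn0 // => a _; rewrite big1.
have s2 : (\sum_(0 <= a < T) \sum_(0 <= b < T) (b == 0) = T)%N by rewrite exchange_big.
have E (G : nat -> nat -> nat -> nat -> bool) :
    (forall f : {ffun 'I_4 -> 'I_T}, ((f i : nat) == 0%N) = G (f (inord 0)) (f (inord 1)) (f (inord 2)) (f (inord 3))) ->
    (\sum_(f : {ffun 'I_4 -> 'I_T} | reps n f) ((f i : nat) == 0) =
     \sum_(0 <= a < T) \sum_(0 <= b < T) \sum_(0 <= c < T) \sum_(0 <= d < T)
       (G a b c d && (tri a + tri b + (tri c + tri d) == n)))%N.
  move=> hG; rewrite -(sum_ffun4 T (fun a b c d => (G a b c d && (tri a + tri b + (tri c + tri d) == n)) : nat)).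
  by rewrite big_mkcond /=; apply: eq_bigr => f _; rewrite /reps sum_ord4 hG; case: eqP; rewrite ?andbT ?andbF.
have I (j : nat) (lt : (j < 4)%N) : i = j :> nat -> i = inord j by move=> e; apply: val_inj; rewrite /= inordK.
have sw (P : nat -> nat -> bool) :
    (\sum_(0 <= a < T) \sum_(0 <= b < T) \sum_(0 <= c < T) \sum_(0 <= d < T)
     (P c d && (tri a + tri b + (tri c + tri d) == n)) = \sum_(0 <= c < T) \sum_(0 <= d < T) \sum_(0 <= a < T) \sum_(0 <= b < T)
     (P c d && (tri c + tri d + (tri a + tri b) == n)))%N.
  under eq_bigr => a _ do rewrite exchange_big /=.
  rewrite exchange_big /=; apply: eq_bigr => c _.
  under eq_bigr => a _ do rewrite exchange_big /=.
  rewrite exchange_big /=; apply: eq_bigr => d _; apply: eq_bigr => a _; apply: eq_bigr => b _.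
  by rewrite [(tri a + tri b + _)%N]addnC.
have : [\/ (i : nat) = 0, (i : nat) = 1, (i : nat) = 2 | (i : nat) = 3]%N.
  by case: i {E I} => [[|[|[|[|]]]] lt] //=; constructor.
have q1 := quad_zero_le (fun a _ => a == 0%N) nT hD.
have q2 := quad_zero_le (fun _ b => b == 0%N) nT hD.
rewrite s1 in q1; rewrite s2 in q2.
case=> e.
- have ei := I 0%N isT e; rewrite (E (fun a _ _ _ => a == 0%N)) => [|f]; [exact: q1 | by rewrite ei].
- have ei := I 1%N isT e; rewrite (E (fun _ b _ _ => b == 0%N)) => [|f]; [exact: q2 | by rewrite ei].
- have ei := I 2%N isT e; rewrite (E (fun _ _ c _ => c == 0%N)) => [|f]; [rewrite (sw (fun c _ => c == 0%N)); exact: q1 | by rewrite ei].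
have ei := I 3%N isT e; rewrite (E (fun _ _ _ d => d == 0%N)) => [|f]; [rewrite (sw (fun _ d => d == 0%N)); exact: q2 | by rewrite ei].
Qed.

Section MainBound.
Context (R : realType).

(** The indicator [hexpos] of hexagonal indices differs from (1 - (-1)^k) / 2 only at k = 0, at a
    cost of [D * T] per coordinate. Expanding the product gives sixteen signed counts over 16: the
    unsigned one is the main term, each of the others contains a factor E. *)
Lemma expansion_le (n T D : nat) (B : R) : (2 * n < T ^ 2)%N ->
  (forall m, (m <= n)%N -> (tau (4 * m + 1) <= D)%N) ->
  (forall (e : 'I_4 -> bool) i0, e i0 -> `|scount R e n T| <= B) ->
  `|(r6 n)%:R - 1 / 16 * (sigma (2 * n + 1))%:R : R| <= B + 4 * (D * T)%:R.
Proof.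
move=> nT hD hB.
have B0 : 0 <= B by apply: le_trans (hB (fun=> true) ord0 isT).
pose s (f : {ffun 'I_4 -> 'I_T}) (i : 'I_4) : R := (-1) ^+ odd (f i).
pose a (f : {ffun 'I_4 -> 'I_T}) (i : 'I_4) : R := (hexpos (f i))%:R.
pose b (f : {ffun 'I_4 -> 'I_T}) (i : 'I_4) : R := (1 - s f i) / 2.
have r6E : (r6 n)%:R = \sum_(f : {ffun 'I_4 -> 'I_T} | reps n f) \prod_(i < 4) a f i.
  rewrite (r6_reps nT) natr_sum; apply: eq_bigr => f _; rewrite /a.
  case: forallP => h; first by rewrite big1 // => i _; rewrite h.
  case: (pickP (fun i => ~~ hexpos (f i))) => [i hi|no].
    by rewrite (bigD1 i) //= (negPf hi) mul0r.
  by case: h => i; apply/negbNE/negbT/no.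
have d1 : `|\sum_(f : {ffun 'I_4 -> 'I_T} | reps n f) \prod_(i < 4) a f i -
    \sum_(f : {ffun 'I_4 -> 'I_T} | reps n f) \prod_(i < 4) b f i| <= 4 * (D * T)%:R.
  rewrite -sumrB; apply: le_trans (ler_norm_sum _ _ _) _.
  apply: (@le_trans _ _ (\sum_(f : {ffun 'I_4 -> 'I_T} | reps n f) \sum_(i < 4) ((f i : nat) == 0%N)%:R)).
    apply: ler_sum => f _; apply: le_trans (prod_diff_le (a := a f) (b := b f) _ _) _.
    - by move=> i; rewrite /a; case: hexpos; rewrite ?lexx ler01.
    - by move=> i; rewrite /b /s; case: (odd _); rewrite ?expr1 ?expr0; apply/andP; split; lra.
    apply: ler_sum => i _; rewrite /a /b /s /hexpos; case: eqP => [->|_] /=.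
      by rewrite expr0 subrr mul0r subr0 normr1.
    case: (odd _); rewrite ?expr1 ?expr0 /=; last by rewrite subrr mul0r subrr normr0.
    by rewrite opprK -mulr2n divff ?subrr ?normr0 // pnatr_eq0.
  rewrite exchange_big /=.
  apply: (@le_trans _ _ (\sum_(i < 4) (D * T)%:R)); last by rewrite sumr_const card_ord mulr_natl.
  by apply: ler_sum => i _; rewrite -natr_sum ler_nat; apply: zero_count_le.
have bE : \sum_(f : {ffun 'I_4 -> 'I_T} | reps n f) \prod_(i < 4) b f i =
   1 / 16 * \sum_(e : {ffun 'I_4 -> bool}) (\prod_(i < 4) (-1) ^+ e i) * scount R e n T.
  transitivity (1 / 16 * \sum_(f : {ffun 'I_4 -> 'I_T} | reps n f) \prod_(i < 4) (1 - s f i)).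
    rewrite mulr_sumr; apply: eq_bigr => f _; rewrite /b big_split /= prodr_const card_ord mulrC.
    by congr (_ * _); field.
  congr (_ * _).
  transitivity (\sum_(f : {ffun 'I_4 -> 'I_T} | reps n f) \sum_(e : {ffun 'I_4 -> bool})
      \prod_(i < 4) ((-1) ^+ e i * (-1) ^+ (e i && odd (f i)) : R)).
    apply: eq_bigr => f _.
    rewrite -(bigA_distr_bigA (fun (i : 'I_4) (x : bool) => (-1) ^+ x * (-1) ^+ (x && odd (f i)) : R)).
    apply: eq_bigr => i _; rewrite big_bool /= /s expr0 mulr1 expr1 mulN1r addrC.
    by [].
  rewrite exchange_big /=; apply: eq_bigr => e _; rewrite /scount mulr_sumr.
  by apply: eq_bigr => f _; rewrite big_split.
pose e0 : {ffun 'I_4 -> bool} := [ffun=> false].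
have s0 : scount R e0 n T = (sigma (2 * n + 1))%:R.
  rewrite -(card_reps nT) /scount natr_sum big_mkcond /=; apply: eq_bigr => f _.
  by case: (reps n f) => //; rewrite big1 // => i _; rewrite ffunE.
have d2 : `|\sum_(e : {ffun 'I_4 -> bool}) (\prod_(i < 4) (-1) ^+ e i) * scount R e n T -
   (sigma (2 * n + 1))%:R| <= 16 * B.
  rewrite (bigD1 e0) //= s0 [X in X * _]big1 ?mul1r => [|i _]; last by rewrite ffunE.
  rewrite addrC addrK; apply: le_trans (ler_norm_sum _ _ _) _.
  apply: (@le_trans _ _ (\sum_(e : {ffun 'I_4 -> bool} | e != e0) B)).
    apply: ler_sum => e ne; rewrite normrM normr_prod big1 ?mul1r => [|i _]; last by rewrite normrX normrN1 expr1n.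
    case: (pickP e) => [i ei|no]; first exact: hB ei.
    by case/eqP: ne; apply/ffunP => i; rewrite ffunE; apply: no.
  rewrite sumr_const -[B *+ _]mulr_natl; apply: ler_wpM2r => //; rewrite ler_nat.
  by apply: leq_trans (max_card _) _; rewrite card_ffun card_bool card_ord.
rewrite bE in d1; rewrite r6E.
move: d1 d2; move: (\sum_(f | _) _) (\sum_e _) (sigma _)%:R ((D * T)%:R) => x y z w.
rewrite !ler_norml => /andP[h1 h2] /andP[h3 h4]; apply/andP; split; lra.
Qed.

Lemma pow_between (k x : nat) : (0 < k)%N -> (0 < x)%N -> exists D : nat, (0 < D)%N /\ (D ^ k <= x < D.+1 ^ k)%N.
Proof.
move=> k0 x0.
have ex : exists d, (d ^ k <= x)%N by exists 1%N; rewrite exp1n.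
have ub d : (d ^ k <= x)%N -> (d <= x)%N.
  by move=> h; apply: leq_trans h; case: d => // d; rewrite -{1}[d.+1]expn1 leq_pexp2l.
case: (ex_maxnP ex ub) => D hD hmax; exists D; split.
  by apply: hmax; rewrite exp1n.
by rewrite hD ltnNge; apply/negP => /hmax; rewrite ltnn.
Qed.

(** Here z = n^(1/16), so T^(7/4) has the size of z^14; one further power of z pays for D^12, which
    collects all divisor functions and logarithms. *)
Lemma main_bound : exists K : R, 0 <= K /\ forall (n : nat) (z : R), (0 < n)%N -> 1 <= z -> z ^+ 16 = n%:R ->
  `|(r6 n)%:R - 1 / 16 * (sigma (2 * n + 1))%:R : R| <= K * z ^+ 15.
Proof.
(* With this exponent, D^k <= C n = C z^16 gives D^12 <= C z. *)
have [k hk] : exists k, k = (12 * 16)%N by exists (12 * 16)%N.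
have k0 : (0 < k)%N by rewrite hk.
have [C1 hC1] := tau_pow_le k0; have [kc hkc] := kbound_le.
pose C := ((C1 + k ^ k) * 300 + 1)%N; have C0 : (0 < C)%N by rewrite /C addn1.
(* 300 n covers every argument below; the largest is 8q <= 32 T <= 256 n. *)
have hCC (m n : nat) : (m <= 300 * n)%N -> (0 < m)%N -> (tau m ^ k <= C * n)%N /\ (ell m ^ k <= C * n)%N.
  move=> mn m0; have le1 : ((C1 + k ^ k) * m <= C * n)%N.
    rewrite /C [leqRHS]mulnDl -mulnA; apply: leq_trans (leq_addr _ _); by rewrite leq_mul2l mn orbT.
  split; apply: leq_trans le1; rewrite mulnDl.
    by apply: leq_trans (hC1 m m0) _; rewrite leq_addr.
  apply: leq_trans (pow_le_exp2 _ k0) _; apply: leq_trans (leq_addl _ _); rewrite leq_mul2l.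
  by rewrite /ell trunc_logP ?orbT.
clearbody C; clear hC1.
pose A : R := 30 * 161 ^+ 3; have A0 : 0 <= A by rewrite /A mulr_ge0 // exprn_ge0.
exists (A * 3 * (kc%:R + 36) * C%:R + 12 * C%:R); split.
  by rewrite !addr_ge0 // !mulr_ge0 // addr_ge0.
move=> n z n0 z1 zn.
have z0 : 0 < z by lra.
have n1 : 1 <= (2 * n)%:R :> R by rewrite ler1n muln_gt0.
have [K [K0 /andP[K1 K2]]] := trunc_sqrt n1.
rewrite -!natrX ler_nat ltr_nat in K1 K2.
pose T := K.+1; have nT : (2 * n < T ^ 2)%N by [].
have T8 : (T ^ 2 <= 8 * n)%N by move: K1; rewrite /T -!mulnn; move: K0; clear; nia.
have T0 : (0 < T)%N by [].
have Tn : (T <= 8 * n)%N by apply: leq_trans T8; rewrite -mulnn leq_pmulr.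
have Cn0 : (0 < C * n)%N by rewrite muln_gt0 C0.
(* The integer k-th root of C n bounds at once every divisor function and every logarithm that
   occurs. *)
have [D [D0 /andP[D1 D2]]] := pow_between k0 Cn0.
have Dt m : (m <= 300 * n)%N -> (0 < m)%N -> (tau m <= D)%N /\ (ell m <= D)%N.
  move=> mn m0; have [h1 h2] := hCC m n mn m0.
  by split; rewrite -ltnS -(ltn_exp2r _ _ k0); apply: leq_ltn_trans D2.
have hDm m : (m <= n)%N -> (tau (4 * m + 1) <= D)%N.
  move=> mn; apply: (Dt _ _ _).1; last by rewrite addn1.
  by move: mn n0; clear; lia.
have Dz : D%:R ^+ 12 <= C%:R * z.
  rewrite -(@ler_pXn2r _ 16) ?nnegrE ?exprn_ge0 ?mulr_ge0 ?(ltW z0) //.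
  rewrite -exprM exprMn zn -hk -!natrX -natrM ler_nat; apply: leq_trans D1 _.
  by rewrite leq_mul2r -{1}[C]expn1 leq_pexp2l ?orbT.
have Tz : T%:R <= 3 * z ^+ 8.
  rewrite -(@ler_pXn2r _ 2) ?nnegrE ?mulr_ge0 ?exprn_ge0 ?(ltW z0) //.
  rewrite exprMn -exprM zn -natrX -natrX -natrM ler_nat; apply: leq_trans T8 _.
  by rewrite leq_mul2r orbT.
have DR : 1 <= D%:R :> R by rewrite ler1n.
(* Of order T^(-1/4), this balances lam^-3 against lam T: both have size z^6. *)
pose lam : R := (z ^+ 2)^-1.
have l0 : 0 < lam by rewrite invr_gt0 exprn_gt0.
(* Both q and s are at most 8T, so each divides one of the two factorials. *)
pose P := ((2 * (4 * T))`! ^ 2)%N.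
have dvP q s : (0 < q <= 4 * T)%N -> (q < s <= 2 * (4 * T))%N -> (q * s %| P)%N.
  move=> /andP[q0 qQ] /andP[qs sQ]; rewrite /P -mulnn dvdn_mul // dvdn_fact ?q0 //=; move: q0 qQ qs sQ; clear; lia.
have P_gt : (64 * T ^ 2 <= P)%N.
  rewrite /P (_ : 64 * T ^ 2 = (2 * (4 * T)) ^ 2)%N; last by rewrite -!mulnn; ring.
  by rewrite leq_exp2r // dvdn_leq ?fact_gt0 // dvdn_fact // leqnn muln_gt0.
have T2P : (T ^ 2 %| P)%N.
  by rewrite /P dvdn_exp2r // dvdn_fact // mulnA leq_pmull.
have nT4 : (n <= 4 * T ^ 2)%N by move: nT; clear; lia.
pose B : R := A * T%:R * D%:R ^+ 6 * ((kc * D ^ 5 * D)%:R / lam ^+ 3 + 3 * lam * (4 * T)%:R).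
have hB (e : 'I_4 -> bool) i0 : e i0 -> `|scount R e n T| <= B.
  move=> ei; rewrite -cabs_signed_count.
  apply: (signed_count_le ei T0 nT4 dvP P_gt T2P l0 hkc D0) => [q hq|q /andP[q0 hq]|].
  - case: (posnP q) => [->|q0]; first by [].
    by apply: (Dt _ _ _).2 => //; move: hq Tn; clear; lia.
  - by apply: (Dt _ _ _).1; [move: hq Tn; clear; lia | rewrite muln_gt0].
  by apply: (Dt _ _ _).1; [move: n0; clear; lia | rewrite addn4].
apply: le_trans (expansion_le nT hDm hB) _.
have D6 : D%:R ^+ 6 <= D%:R ^+ 12 :> R by rewrite ler_weXn2l.
have D12 : 0 <= D%:R ^+ 12 :> R by rewrite exprn_ge0.
have zz (i j : nat) : (i <= j)%N -> z ^+ i <= z ^+ j by move=> ij; rewrite ler_weXn2l.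
have BE : B <= A * (3 * z ^+ 8) * ((kc%:R + 36) * z ^+ 6 * D%:R ^+ 12).
  rewrite /B -(mulrA (A * T%:R)) -(mulrA A T%:R) -(mulrA A (3 * z ^+ 8)); apply: ler_wpM2l => //; apply: ler_pM => //.
    by apply: mulr_ge0; [exact: exprn_ge0 | apply: addr_ge0; [apply: divr_ge0 => //; apply: exprn_ge0; exact: ltW | rewrite !mulr_ge0 ?(ltW l0)]].
  have -> : (kc * D ^ 5 * D)%:R / lam ^+ 3 = kc%:R * D%:R ^+ 6 * z ^+ 6 :> R.
    rewrite /lam exprVn invrK -exprM -mulnA -expnSr natrM natrX; ring.
  have h1 : 3 * lam * (4 * T)%:R <= 36 * z ^+ 6.
    rewrite natrM; apply: (@le_trans _ _ (3 * lam * (4 * (3 * z ^+ 8)))).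
      by rewrite ler_wpM2l ?mulr_ge0 ?(ltW l0) // ler_wpM2l.
    rewrite le_eqVlt; apply/orP; left; apply/eqP; rewrite /lam; field; by rewrite gt_eqF.
  have z6 : 0 <= z ^+ 6 by rewrite exprn_ge0 // ltW.
  have d6 : 1 <= D%:R ^+ 6 :> R by rewrite exprn_ege1.
  have kc0 : 0 <= kc%:R :> R by [].
  have -> : D%:R ^+ 12 = D%:R ^+ 6 * D%:R ^+ 6 :> R by rewrite -exprD.
  move: h1 d6 z6; move: (3 * _ * _) (D%:R ^+ 6) (z ^+ 6) => u d w h1 d6 z6.
  apply: (@le_trans _ _ (d * (kc%:R * d * w + 36 * w))).
    by apply: ler_wpM2l; [lra | apply: lerD].
  rewrite -subr_ge0 (_ : _ - _ = 36 * w * d * (d - 1)); last by ring.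
  by rewrite !mulr_ge0 //; lra.
rewrite [leRHS]mulrDl; apply: lerD.
  apply: le_trans BE _.
  apply: (@le_trans _ _ (A * (3 * z ^+ 8) * ((kc%:R + 36) * z ^+ 6 * (C%:R * z)))).
    apply: ler_wpM2l; first by apply: mulr_ge0 => //; apply: mulr_ge0 => //; exact/exprn_ge0/ltW.
    by apply: ler_wpM2l => //; apply: mulr_ge0; [exact: addr_ge0 | exact/exprn_ge0/ltW].
  by rewrite le_eqVlt; apply/orP; left; apply/eqP; ring.
have D1z : D%:R <= C%:R * z by apply: le_trans Dz; rewrite -{1}[D%:R]expr1 ler_weXn2l.
rewrite natrM; apply: (@le_trans _ _ (4 * ((C%:R * z) * (3 * z ^+ 8)))).
  by rewrite ler_wpM2l // ler_pM.
rewrite (_ : 4 * _ = 12 * C%:R * z ^+ 9); last by ring.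
by rewrite ler_wpM2l ?mulr_ge0 // zz.
Qed.

End MainBound.

Local Close Scope complex_scope.

Theorem corollary1p2 (R : realType) (eps : R) (eps_gt0 : 0 < eps) :
  (fun n : nat => (r6 n)%:R : R) =
  (fun n : nat => 1 / 16 * (sigma (2 * n + 1)%N)%:R : R)
    +O_\oo (fun n : nat => n%:R `^ (15 / 16 + eps) : R).
Proof.
have [K [K0 hK]] := main_bound R.
apply/eqaddOP; near=> k; near=> n.
have n0 : (0 < n)%N by near: n; exact: nbhs_infty_gt.
have n1 : 1 <= n%:R :> R by rewrite ler1n.
pose z : R := n%:R `^ (1 / 16).
have z1 : 1 <= z by rewrite -[1](powRr0 n%:R) ler_powR // divr_ge0.
have zn : z ^+ 16 = n%:R.
  by rewrite -powR_mulrn ?powR_ge0 // -powRrM (_ : 1 / 16 * 16 = 1) ?powRr1 //; field.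
have -> : ((fun n : nat => (r6 n)%:R : R) - (fun n : nat => 1 / 16 * (sigma (2 * n + 1)%N)%:R : R)) n =
   (r6 n)%:R - 1 / 16 * (sigma (2 * n + 1))%:R by [].
apply: le_trans (hK n z n0 z1 zn) _.
rewrite [X in _ <= _ * X]ger0_norm ?powR_ge0 //; apply: ler_pM => //.
  by rewrite exprn_ge0 // powR_ge0.
rewrite -powR_mulrn ?powR_ge0 // -powRrM ler_powR //.
rewrite (_ : 1 / 16 * 15 = 15 / 16); last by field.
by rewrite lerDl ltW.
Unshelve. all: by end_near.
Qed.
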